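(* Suppose the following hold for the federated compositional problem and the FedCoMuon-VR algorithm described in the context. (1) $F_*:=\inf_{W\in\mathbb R^{m\times n}}F(W)>-\infty$. (2) There are constants $\sigma_g,\sigma_{\nabla g},\sigma_f>0$ such that for all $k\in[K]$, $W\in\mathbb R^{m\times n}$, $y\in\mathbb R^d$: $\mathbb E_{\xi^k}[g^k(W;\xi^k)]=g^k(W)$, $\mathbb E_{\xi^k}[\nabla g^k(W;\xi^k)]=\nabla g^k(W)$, $\mathbb E_{\zeta^k}[\nabla_y f^k(y;\zeta^k)]=\nabla_y f^k(y)$, $\mathbb E_{\xi^k}\|g^k(W;\xi^k)-g^k(W)\|^2\le\sigma_g^2$, $\mathbb E_{\xi^k}\|\nabla g^k(W;\xi^k)-\nabla g^k(W)\|_F^2\le\sigma_{\nabla g}^2$, $\mathbb E_{\zeta^k}\|\nabla_y f^k(y;\zeta^k)-\nabla_y f^k(y)\|^2\le\sigma_f^2$; the samples are independent across clients and iterations, and $\xi^k$ is independent of $\zeta^k$. (3) For all $k,W,y$: $\mathbb E_{\xi^k}\|\nabla g^k(W;\xi^k)\|_F^2\le C_g^2$ and $\mathbb E_{\zeta^k}\|\nabla_y f^k(y;\zeta^k)\|^2\le C_f^2$, where $C_g,C_f>0$ are the constants used in the algorithm's projections. (4) There are constants $L_g,L_f$ such that for all $k$, $W_1,W_2$, $y_1,y_2$: $\mathbb E_{\xi^k}\|g^k(W_1;\xi^k)-g^k(W_2;\xi^k)\|^2\le C_g^2\|W_1-W_2\|_F^2$, $\mathbb E_{\xi^k}\|\nabla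 g^k(W_1;\xi^k)-\nabla g^k(W_2;\xi^k)\|_F^2\le L_g^2\|W_1-W_2\|_F^2$, $\mathbb E_{\zeta^k}\|\nabla_yf^k(y_1;\zeta^k)-\nabla_yf^k(y_2;\zeta^k)\|^2\le L_f^2\|y_1-y_2\|^2$. (5) There are constants $\Delta_g,\Delta_{\nabla g},\Delta_f\ge0$ such that for all $k,j\in[K]$, $W$, $y$: $\|\nabla_yf^k(y)-\nabla_yf^j(y)\|\le\Delta_f$, $\|\nabla g^k(W)-\nabla g^j(W)\|_F\le\Delta_{\nabla g}$, $\|g^k(W)-g^j(W)\|\le\Delta_g$. Let $L_F=C_fL_g+C_g^2L_f$, and let $\{W_t^k,u_t^k,v_t^k,H_t^k,M_t^k\}$ be generated by FedCoMuon-VR with $\eta>0$, $0<\alpha,\beta,\gamma,\rho<1$, $b\ge1$, $\tau>0$. Then for every integer $T\ge1$, $$\begin{aligned} \frac1T\sum_{t=0}^{T-1}\mathbb E\|\nabla F(\bar W_t)\|_F\le{}&\frac{F(\bar W_0)-F_*}{\eta T}+\frac{L_Fn\eta}{2}+2\sqrt n\Biggl[\frac{4C_gC_f}{\rho T}+\frac{L_F\sqrt n\,\eta}{\rho}+(2+\sqrt6\,\rho\tau)\,A^{1/2}\\ &+\sqrt6\,\rho\tau\bigl(C_f^2\Delta_{\nabla g}^2+2C_g^2\Delta_f^2+2C_g^2L_f^2\Delta_g^2\bigr)^{1/2}\Biggr], \end{aligned}$$ where $$\begin{aligned} A={}&C_f^2\sigma_{\nabla g}^2\Bigl(\frac1{\gamma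 Tb}+2\gamma\Bigr)+2C_g^2\sigma_f^2\Bigl(\frac1{\beta Tb}+2\beta\Bigr)+2C_g^2L_f^2\sigma_g^2\Bigl[\frac1{\alpha Tb}+2\alpha+\frac{8\alpha}{\beta Tb}+\frac{8\alpha^2}{\beta}(1+2\alpha)\Bigr]\\ &+4n\eta^2\tau\Bigl(\frac{2C_g^4L_f^2}{\alpha}+\frac{4C_g^4L_f^2}{\beta}+\frac{16C_g^4L_f^2\alpha}{\beta}+\frac{C_f^2L_g^2}{\gamma}\Bigr)+n\eta^2\tau^2\Bigl(C_f^2L_g^2+C_g^4L_f^2+\frac{L_F^2}{2}\Bigr). \end{aligned}$$
   Context: Problem. Let $K,m,n,d\ge1$ be integers, $[K]=\{1,\dots,K\}$. For each $k\in[K]$ let $\mathcal D_g^k,\mathcal D_f^k$ be probability distributions, and let $g^k(W;\xi)\in\mathbb R^d$ ($W\in\mathbb R^{m\times n}$, $\xi\sim\mathcal D_g^k$) and $f^k(y;\zeta)\in\mathbb R$ ($y\in\mathbb R^d$, $\zeta\sim\mathcal D_f^k$) be differentiable in $W$, resp. $y$. Put $g^k(W)=\mathbb E_\xi[g^k(W;\xi)]$, $f^k(y)=\mathbb E_\zeta[f^k(y;\zeta)]$ (also differentiable), $F^k(W)=f^k(g^k(W))$, $F(W)=\frac1K\sum_{k=1}^KF^k(W)$. $\|\cdot\|$ is the Euclidean norm of vectors, $\|\cdot\|_F$ the Frobenius norm, $\otimes$ the Kronecker product. The Jacobian $\nabla g^k(W)$ is the $m\times nd$ matrix $[\nabla g^k_1(W),\dots,\nabla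 g^k_d(W)]$ of the $m\times n$ gradients of the components (similarly for $\nabla g^k(W;\xi)$), so that $\nabla g^k(W)(v\otimes I_n)=\sum_{i=1}^d v_i\nabla g_i^k(W)$ for $v\in\mathbb R^d$ and $\nabla F^k(W)=\nabla g^k(W)(\nabla_yf^k(g^k(W))\otimes I_n)$. FedCoMuon-VR algorithm. Inputs: $\eta>0$, $\alpha,\beta,\gamma,\rho\in[0,1)$, integers $\tau,b\ge1$, constants $C_f,C_g>0$, deterministic $W_0\in\mathbb R^{m\times n}$. $\Pi_{C_f}$ and $\Pi_{C_g}$ are the Euclidean projections onto $\{v\in\mathbb R^d:\|v\|\le C_f\}$ and $\{H\in\mathbb R^{m\times nd}:\|H\|_F\le C_g\}$. Initialization: $W_0^k=W_0$; draw i.i.d. $\xi_{0,1}^k,\dots,\xi_{0,b}^k\sim\mathcal D_g^k$ and i.i.d. $\zeta_{0,1}^k,\dots,\zeta_{0,b}^k\sim\mathcal D_f^k$; set $u_0^k=\frac1b\sum_jg^k(W_0;\xi_{0,j}^k)$, $H_0^k=\frac1b\sum_j\nabla g^k(W_0;\xi_{0,j}^k)$, $v_0^k=\frac1b\sum_j\nabla_yf^k(u_0^k;\zeta_{0,j}^k)$, and, for all $k$, $M_0^k=\frac1K\sum_{j=1}^KH_0^j(v_0^j\otimes I_n)$. For $t=0,1,2,\dots$: each client takes a compact singular value decomposition $M_t^k=U_t^k\Sigma_t^k(V_t^k)^\top$ (only nonzero singular values) and sets $\tilde W_{t+1}^k=W_t^k-\eta U_t^k(V_t^k)^\top$. If $\tau$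 divides $t+1$, $W_{t+1}^k=\frac1K\sum_j\tilde W_{t+1}^j$ for all $k$; otherwise $W_{t+1}^k=\tilde W_{t+1}^k$. Then each client draws fresh $\xi_{t+1}^k\sim\mathcal D_g^k$, $\zeta_{t+1}^k\sim\mathcal D_f^k$ and sets $u_{t+1}^k=g^k(W_{t+1}^k;\xi_{t+1}^k)+(1-\alpha)(u_t^k-g^k(W_t^k;\xi_{t+1}^k))$, $v_{t+1}^k=\Pi_{C_f}[\nabla_yf^k(u_{t+1}^k;\zeta_{t+1}^k)+(1-\beta)(v_t^k-\nabla_yf^k(u_t^k;\zeta_{t+1}^k))]$, $H_{t+1}^k=\Pi_{C_g}[\nabla g^k(W_{t+1}^k;\xi_{t+1}^k)+(1-\gamma)(H_t^k-\nabla g^k(W_t^k;\xi_{t+1}^k))]$, $\tilde M_{t+1}^k=(1-\rho)M_t^k+\rho H_{t+1}^k(v_{t+1}^k\otimes I_n)$. If $\tau$ divides $t+1$, $M_{t+1}^k=\frac1K\sum_j\tilde M_{t+1}^j$ for all $k$; otherwise $M_{t+1}^k=\tilde M_{t+1}^k$. Write $\bar W_t=\frac1K\sum_kW_t^k$, $\bar M_t=\frac1K\sum_kM_t^k$. $\mathbb E$ is over all samples. *)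

(* Defs.v *)
From HB Require Import structures.
From mathcomp Require Import all_boot all_order all_algebra.
From mathcomp Require Import finmap.
From mathcomp Require Import all_classical all_reals all_analysis.
From mathcomp.real_closed Require Import mxtens.

Set Implicit Arguments.
Unset Strict Implicit.
Unset Printing Implicit Defensive.

Import Order.TTheory GRing.Theory Num.Theory.
Import numFieldNormedType.Exports.

Local Open Scope classical_set_scope.
Local Open Scope ring_scope.

(* The library norm `|A| on matrices is the max norm; it is used below only
   through the (equivalent) topology underlying differentiability. On column
   vectors fronorm is the Euclidean norm. *)
Definition fronorm (R : realType) (p q : nat) (A : 'M[R]_(p, q)) : R :=
  Num.sqrt (\sum_i \sum_j A i j ^+ 2).

Definition average (R : realType) (V : lmodType R) (N : nat)
  (x : 'I_N -> V) : V := N%:R^-1 *: \sum_i x i.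

(* For q = 1 this is the usual gradient of a function on column vectors. *)
Definition gradient (R : realType) (p q : nat) (h : 'M[R]_(p, q) -> R)
  (A : 'M[R]_(p, q)) : 'M[R]_(p, q) :=
  \matrix_(i, j) 'D_(delta_mx i j) h A.

(* [grad h_1, ..., grad h_d]: column i * n + j is column j of grad h_i. *)
Definition jac (R : realType) (m n d : nat) (h : 'M[R]_(m, n) -> 'cV[R]_d)
  (A : 'M[R]_(m, n)) : 'M[R]_(m, d * n) :=
  \matrix_(a, c) gradient (fun B => h B (mxtens_unindex c).1 ord0) A
                   a (mxtens_unindex c).2.

(* v (x) I_n; the cast only turns the column count 1 * n into n. *)
Definition kronI (R : realType) (d n : nat) (v : 'cV[R]_d) :
  'M[R]_(d * n, n) :=
  castmx (erefl, mul1n n) (tensmx v (1%:M : 'M[R]_n)).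
Arguments kronI {R d} n v.

Definition is_compact_svd (R : realType) (m n r : nat) (A : 'M[R]_(m, n))
  (U : 'M[R]_(m, r)) (s : 'rV[R]_r) (V : 'M[R]_(n, r)) : Prop :=
  [/\ U^T *m U = 1%:M, V^T *m V = 1%:M, (forall i, 0 < s ord0 i) &
      A = U *m diag_mx s *m V^T].

Definition is_ball_proj (R : realType) (p q : nat) (C : R)
  (A B : 'M[R]_(p, q)) : Prop :=
  fronorm B <= C /\
  forall B' : 'M[R]_(p, q), fronorm B' <= C ->
    fronorm (A - B) <= fronorm (A - B').

Section Mean.
Context (R : realType) (dT : measure_display) (T : measurableType dT).

Definition mxmean (p q : nat) (mu : probability T R) (X : T -> 'M[R]_(p, q)) :
  'M[R]_(p, q) := \matrix_(i, j) fine ('E_mu[fun x => X x i j])%E.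

Definition mxintegrable (p q : nat) (mu : probability T R)
  (X : T -> 'M[R]_(p, q)) : Prop :=
  forall i j, mu.-integrable setT (EFin \o (fun x => X x i j)).

Definition has_mean (p q : nat) (mu : probability T R)
  (X : T -> 'M[R]_(p, q)) (A : 'M[R]_(p, q)) : Prop :=
  mxintegrable mu X /\ mxmean mu X = A.

End Mean.

Definition independent_systems (R : realType) (dO : measure_display)
  (Omega : measurableType dO) (P : probability Omega R) (I : choiceType)
  (S : I -> set (set Omega)) : Prop :=
  forall (J : {fset I}) (E : I -> set Omega),
    (forall i, i \in J -> S i (E i)) ->
    P (\bigcap_(i in [set i | i \in J]) E i) =
      (\big[*%E/1%E]_(i <- J) P (E i))%E.

Record problem (R : realType) (K m n d : nat) := Problem {
  dXi : 'I_K -> measure_display;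
  Xi : forall k, measurableType (dXi k);
  Dg : forall k, probability (Xi k) R;
  dZeta : 'I_K -> measure_display;
  Zeta : forall k, measurableType (dZeta k);
  Df : forall k, probability (Zeta k) R;
  gs : forall k, 'M[R]_(m, n) -> Xi k -> 'cV[R]_d;
  fs : forall k, 'cV[R]_d -> Zeta k -> R
}.

Section Problem.
Context (R : realType) (K m n d : nat) (p : problem R K m n d).
Implicit Types (k : 'I_K) (W : 'M[R]_(m, n)) (y : 'cV[R]_d).

Definition gbar k W : 'cV[R]_d := mxmean (Dg p k) (gs W).

Definition fbar k y : R := fine ('E_(Df p k)[fs y])%E.

Definition Fk k W : R := fbar k (gbar k W).

Definition Fobj W : R := K%:R^-1 * \sum_(k < K) Fk k W.

Definition well_posed : Prop :=
  [/\ (forall k x W, differentiable (fun W' => gs (p := p) (k := k) W' x) W),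
      (forall k z y, differentiable (fun y' => fs (p := p) (k := k) y' z) y),
      (forall k y, (Df p k).-integrable setT (EFin \o fs y)),
      (forall k W, differentiable (gbar k) W) &
      (forall k y, differentiable (fbar k) y)].

End Problem.

(* Index of a client's draws: [inl j] is the j-th sample of the initial batch,
   [inr t] is the sample drawn in round t to form the iterates of index t+1. *)
Definition draw (b : nat) := ('I_b + nat)%type.

Section Samples.
Context (R : realType) (K m n d : nat) (p : problem R K m n d) (b : nat).
Context (dO : measure_display) (Omega : measurableType dO).
Context (P : probability Omega R).
Context (xi : forall k : 'I_K, draw b -> {mfun Omega >-> Xi p k}).
Context (zeta : forall k : 'I_K, draw b -> {mfun Omega >-> Zeta p k}).

Definition sample_events (i : ('I_K * draw b) + ('I_K * draw b)) :
  set (set Omega) :=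
  match i with
  | inl (k, a) => preimage_set_system setT (xi k a) measurable
  | inr (k, a) => preimage_set_system setT (zeta k a) measurable
  end.

Definition is_sampling : Prop :=
  [/\ (forall k a A, measurable A -> distribution P (xi k a) A = Dg p k A),
      (forall k a A, measurable A -> distribution P (zeta k a) A = Df p k A) &
      independent_systems P sample_events].

End Samples.

Section Algorithm.
Context (R : realType) (K m n d : nat) (p : problem R K m n d).
Context (eta alpha beta gamma rho : R) (tau b : nat) (Cf Cg : R).
Context (W0 : 'M[R]_(m, n)).
Context (dO : measure_display) (Omega : measurableType dO).
Context (xi : forall k : 'I_K, draw b -> {mfun Omega >-> Xi p k}).
Context (zeta : forall k : 'I_K, draw b -> {mfun Omega >-> Zeta p k}).
Context (W : 'I_K -> nat -> Omega -> 'M[R]_(m, n)).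
Context (u v : 'I_K -> nat -> Omega -> 'cV[R]_d).
Context (H : 'I_K -> nat -> Omega -> 'M[R]_(m, d * n)).
Context (M : 'I_K -> nat -> Omega -> 'M[R]_(m, n)).

(* Averaging over the clients when tau divides t, no communication otherwise. *)
Definition sync (V : lmodType R) (t : nat) (x : 'I_K -> V) (k : 'I_K) : V :=
  if (tau %| t)%N then average x else x k.

(* Stated as a relation because a compact SVD is not unique. *)
Record FedCoMuonVR : Prop := {
  init_W : forall k w, W k 0%N w = W0;
  init_u : forall k w,
    u k 0%N w = average (fun j : 'I_b => gs W0 (xi k (inl j) w));
  init_H : forall k w,
    H k 0%N w =
      average (fun j : 'I_b => jac (fun A => gs A (xi k (inl j) w)) W0);
  init_v : forall k w,
    v k 0%N w =
      average (fun j : 'I_b =>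
        gradient (fun y => fs y (zeta k (inl j) w)) (u k 0%N w));
  init_M : forall k w,
    M k 0%N w = average (fun j => H j 0%N w *m kronI n (v j 0%N w));
  step_W : forall t w, exists Wtilde : 'I_K -> 'M[R]_(m, n),
    (forall k, exists r (U : 'M[R]_(m, r)) (s : 'rV[R]_r) (V : 'M[R]_(n, r)),
       is_compact_svd (M k t w) U s V /\
       Wtilde k = W k t w - eta *: (U *m V^T)) /\
    (forall k, W k t.+1 w = sync t.+1 Wtilde k);
  step_u : forall k t w,
    u k t.+1 w =
      gs (W k t.+1 w) (xi k (inr t) w) +
      (1 - alpha) *: (u k t w - gs (W k t w) (xi k (inr t) w));
  step_v : forall k t w,
    let df := gradient (fun y => fs y (zeta k (inr t) w)) in
    is_ball_proj Cf
      (df (u k t.+1 w) + (1 - beta) *: (v k t w - df (u k t w)))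
      (v k t.+1 w);
  step_H : forall k t w,
    let dg := jac (fun A => gs A (xi k (inr t) w)) in
    is_ball_proj Cg
      (dg (W k t.+1 w) + (1 - gamma) *: (H k t w - dg (W k t w)))
      (H k t.+1 w);
  step_M : forall k t w,
    M k t.+1 w =
      sync t.+1 (fun j => (1 - rho) *: M j t w +
                   rho *: (H j t.+1 w *m kronI n (v j t.+1 w))) k
}.

End Algorithm.

(* Main.v *)
(** A step along the polar factor [O] of [M] satisfies <M, O> >= |M|_F and
    |O|_F^2 <= n.  The descent lemma at the averaged iterate then bounds the
    gradient norm by the decrease of [F] plus twice the mean over clients of
    sqrt n |grad F(Wbar_t) - M_t^k|.  That distance splits into the error of
    the averaged momentum, contracted by 1 - rho in each round, and the
    disagreement between clients, which is reset every tau rounds.  Both are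
    driven by the errors of [u], [v] and [H]: each of these is a
    recursive-momentum (STORM) estimator, whose second moment obeys a linear
    recursion because the sample of a round is independent of the past.
    Every square root is linearised pointwise by AM-GM, with a deterministic
    weight chosen at the end, so that only expectations of squares have to be
    bounded.

    For measurability: the polar factor is a limit of
    Newton-Schulz iterates, the stochastic Jacobians are limits of difference
    quotients, and functions continuous in one variable and measurable in the
    other are jointly measurable. *)
Require Import Defs.
From HB Require Import structures.
From mathcomp Require Import all_boot all_order all_algebra.
From mathcomp Require Import finmap.
From mathcomp Require Import all_classical all_reals all_analysis.
From mathcomp.real_closed Require Import mxtens.
From mathcomp Require Import measurable_realfun.
From mathcomp Require Import ring lra.

Set Implicit Arguments.
Unset Strict Implicit.
Unset Printing Implicit Defensive.

Import Order.TTheory GRing.Theory Num.Theory.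
Import numFieldNormedType.Exports.

Local Open Scope classical_set_scope.
Local Open Scope ring_scope.

(** * Frobenius inner product *)

(** The movement bound used in an averaging round is one on the mean over the clients. Hence a
    statement about one client only compares two integrals, and numbers appear after averaging. A
    recursive-momentum step evaluates one sample at two points, and its noise is centred only if
    both points are fixed before the draw. For [W] this holds, since the new iterate uses no draw of
    the round. The new [u] does depend on the xi of the round, so the zeta of the round has to be
    fresh with respect to a past that already contains these xi. Projections cause no loss: by
    Jensen the true Jacobian and gradient lie in the balls, and projecting never increases the
    distance to a point of the ball. The initial batch is not projected, so the errors of the
    estimated gradients are bounded outcome by outcome only from index 1 on; the driving sums
    therefore run over [t.+1], and the start enters through second moments. The constants 2 and
    [sqrt 6] are the square roots of the factors 4 and 6 in the squared error and the squared
    disagreement. The quantity [A] exceeds what the recursions give by an explicit nonnegative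
    remainder. *)

Section Frobenius.
Context (R : realType).

Definition frob (p q : nat) (A B : 'M[R]_(p, q)) : R :=
  \sum_i \sum_j A i j * B i j.

Section Fixed.
Context (p q : nat).
Implicit Types A B C : 'M[R]_(p, q).

Lemma frobC A B : frob A B = frob B A.
Proof. by apply: eq_bigr => i _; apply: eq_bigr => j _; rewrite mulrC. Qed.

Lemma frobDl A B C : frob (A + B) C = frob A C + frob B C.
Proof.
rewrite -big_split; apply: eq_bigr => i _; rewrite -big_split.
by apply: eq_bigr => j _; rewrite mxE mulrDl.
Qed.

Lemma frobZl a A B : frob (a *: A) B = a * frob A B.
Proof.
rewrite mulr_sumr; apply: eq_bigr => i _; rewrite mulr_sumr.
by apply: eq_bigr => j _; rewrite mxE mulrA.
Qed.

Lemma frobNl A B : frob (- A) B = - frob A B.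
Proof. by rewrite -scaleN1r frobZl mulN1r. Qed.

Lemma frobBl A B C : frob (A - B) C = frob A C - frob B C.
Proof. by rewrite frobDl frobNl. Qed.

Lemma frob0l B : frob 0 B = 0.
Proof. by rewrite -(scale0r 0) frobZl mul0r. Qed.

Lemma frobDr A B C : frob A (B + C) = frob A B + frob A C.
Proof. by rewrite !(frobC A) frobDl. Qed.

Lemma frobZr a A B : frob A (a *: B) = a * frob A B.
Proof. by rewrite !(frobC A) frobZl. Qed.

Lemma frobNr A B : frob A (- B) = - frob A B.
Proof. by rewrite !(frobC A) frobNl. Qed.

Lemma frobBr A B C : frob A (B - C) = frob A B - frob A C.
Proof. by rewrite frobDr frobNr. Qed.

Lemma frob_suml N (x : 'I_N -> 'M[R]_(p, q)) B :
  frob (\sum_k x k) B = \sum_k frob (x k) B.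
Proof.
elim/big_ind2: _ => [|A a B' b <- <-|//]; first exact: frob0l.
by rewrite frobDl.
Qed.

Lemma fronorm_ge0 A : 0 <= fronorm A.
Proof. exact: sqrtr_ge0. Qed.

Lemma sqr_fronormE A : fronorm A ^+ 2 = \sum_i \sum_j A i j ^+ 2.
Proof.
rewrite sqr_sqrtr//; apply: sumr_ge0 => i _.
by apply: sumr_ge0 => j _; exact: sqr_ge0.
Qed.

Lemma sqr_fronorm A : fronorm A ^+ 2 = frob A A.
Proof.
rewrite sqr_fronormE.
by apply: eq_bigr => i _; apply: eq_bigr => j _; rewrite expr2.
Qed.

Lemma sqr_fronormD A B :
  fronorm (A + B) ^+ 2 = fronorm A ^+ 2 + 2 * frob A B + fronorm B ^+ 2.
Proof. by rewrite !sqr_fronorm frobDl !frobDr (frobC B A); ring. Qed.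

Lemma sqr_fronormB A B :
  fronorm (A - B) ^+ 2 = fronorm A ^+ 2 - 2 * frob A B + fronorm B ^+ 2.
Proof. by rewrite !sqr_fronorm frobBl !frobBr (frobC B A); ring. Qed.

Lemma sqr_fronormZ a A : fronorm (a *: A) ^+ 2 = a ^+ 2 * fronorm A ^+ 2.
Proof. by rewrite !sqr_fronorm frobZl frobZr mulrA. Qed.

Lemma fronorm_le A (a : R) : 0 <= a -> fronorm A ^+ 2 <= a ^+ 2 -> fronorm A <= a.
Proof. by move=> a0; rewrite ler_pXn2r// nnegrE ?fronorm_ge0. Qed.

Lemma fronorm0_eq0 A : fronorm A = 0 -> A = 0.
Proof.
move=> A0; have : fronorm A ^+ 2 = 0 by rewrite A0 expr0n.
rewrite sqr_fronormE => /psumr_eq0P E; apply/matrixP => i j; rewrite mxE.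
have /psumr_eq0P E' : \sum_j A i j ^+ 2 = 0.
  by apply: E => // k _; apply: sumr_ge0 => l _; exact: sqr_ge0.
by apply/eqP; rewrite -sqrf_eq0; apply/eqP/E' => // k _; exact: sqr_ge0.
Qed.

Lemma fronormZ a A : fronorm (a *: A) = `|a| * fronorm A.
Proof.
apply/eqP; rewrite -(@eqrXn2 _ 2)// ?mulr_ge0 ?fronorm_ge0//.
by rewrite sqr_fronormZ exprMn real_normK// num_real.
Qed.

Lemma fronorm0 : fronorm (0 : 'M[R]_(p, q)) = 0.
Proof. by rewrite -(scale0r 0) fronormZ normr0 mul0r. Qed.

Lemma fronormN A : fronorm (- A) = fronorm A.
Proof. by rewrite -scaleN1r fronormZ normrN1 mul1r. Qed.

Lemma fronormBC A B : fronorm (A - B) = fronorm (B - A).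
Proof. by rewrite -fronormN opprB. Qed.

(** Cauchy-Schwarz from the square of [|B| A - |A| B], whose expansion has the factor [2 |A| |B|];
    it can be cancelled once both norms are nonzero. *)
Lemma frob_le A B : frob A B <= fronorm A * fronorm B.
Proof.
have [/fronorm0_eq0 ->|a0] := eqVneq (fronorm A) 0.
  by rewrite frob0l fronorm0 mul0r.
have [/fronorm0_eq0 ->|b0] := eqVneq (fronorm B) 0.
  by rewrite frobC frob0l fronorm0 mulr0.
have a_gt0 : 0 < fronorm A by rewrite lt_neqAle eq_sym a0 fronorm_ge0.
have b_gt0 : 0 < fronorm B by rewrite lt_neqAle eq_sym b0 fronorm_ge0.
have := sqr_ge0 (fronorm (fronorm B *: A - fronorm A *: B)).
rewrite sqr_fronormB !sqr_fronormZ frobZl frobZr.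
have -> : fronorm B ^+ 2 * fronorm A ^+ 2 -
  2 * (fronorm B * (fronorm A * frob A B)) + fronorm A ^+ 2 * fronorm B ^+ 2 =
  2 * (fronorm A * fronorm B) * (fronorm A * fronorm B - frob A B) by ring.
by rewrite pmulr_rge0 ?subr_ge0// !mulr_gt0.
Qed.

Lemma fronormD A B : fronorm (A + B) <= fronorm A + fronorm B.
Proof.
apply: fronorm_le; first by rewrite addr_ge0 ?fronorm_ge0.
rewrite sqr_fronormD sqrrD mulr2n.
by have := frob_le A B; lra.
Qed.

Lemma fronormB A B : fronorm (A - B) <= fronorm A + fronorm B.
Proof. by rewrite -(fronormN B) fronormD. Qed.

Lemma sqr_fronormD_le A B :
  fronorm (A + B) ^+ 2 <= 2 * fronorm A ^+ 2 + 2 * fronorm B ^+ 2.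
Proof.
have := sqr_ge0 (fronorm (A - B)).
by rewrite sqr_fronormB sqr_fronormD; lra.
Qed.

Lemma fronorm_sum N (x : 'I_N -> 'M[R]_(p, q)) :
  fronorm (\sum_k x k) <= \sum_k fronorm (x k).
Proof.
elim/big_ind2: _ => [|A a B b Aa Bb|//]; first by rewrite fronorm0.
by apply: le_trans (fronormD a b) _; exact: lerD.
Qed.

Lemma sqr_fronorm_entry A i j : A i j ^+ 2 <= fronorm A ^+ 2.
Proof.
rewrite sqr_fronormE (bigD1 i)//= (bigD1 j)//= -addrA lerDl.
rewrite addr_ge0// sumr_ge0// => ? _; rewrite ?sqr_ge0//.
by apply: sumr_ge0 => ? _; exact: sqr_ge0.
Qed.

End Fixed.

(** * Averages over the clients *)

Section Mean.
Context (p q N : nat).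
Hypothesis N0 : (0 < N)%N.
Implicit Types (x : 'I_N -> 'M[R]_(p, q)).

Let NR0 : 0 < N%:R :> R.
Proof. by rewrite ltr0n. Qed.

Definition mean (f : 'I_N -> R) : R := N%:R^-1 * \sum_k f k.

Lemma mean_le (f g : 'I_N -> R) : (forall k, f k <= g k) -> mean f <= mean g.
Proof. by move=> fg; rewrite ler_pM2l ?invr_gt0//; exact: ler_sum. Qed.

Lemma mean_cst (c : R) : mean (fun=> c) = c.
Proof.
by rewrite /mean sumr_const card_ord -[c *+ N]mulr_natl mulrA mulVf ?mul1r// gt_eqF.
Qed.

Lemma meanD (f g : 'I_N -> R) : mean (fun k => f k + g k) = mean f + mean g.
Proof. by rewrite /mean big_split mulrDr. Qed.

Lemma meanZ (c : R) (f : 'I_N -> R) : mean (fun k => c * f k) = c * mean f.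
Proof. by rewrite /mean -mulr_sumr mulrCA. Qed.

Lemma mean_ge0 (f : 'I_N -> R) : (forall k, 0 <= f k) -> 0 <= mean f.
Proof. by move=> f0; rewrite mulr_ge0 ?invr_ge0 ?(ltW NR0)// sumr_ge0. Qed.

(** Expansion of a nonnegative variance. *)
Lemma mean_sqr (f : 'I_N -> R) : mean f ^+ 2 <= mean (fun k => f k ^+ 2).
Proof.
have : 0 <= mean (fun k => (f k - mean f) ^+ 2) by apply: mean_ge0 => k; exact: sqr_ge0.
have -> : mean (fun k => (f k - mean f) ^+ 2) =
    mean (fun k => f k ^+ 2 + ((- 2 * mean f) * f k + mean f ^+ 2)).
  by congr (_ * _); apply: eq_bigr => k _; ring.
by rewrite meanD meanD meanZ mean_cst; lra.
Qed.

Lemma average_cst (V : lmodType R) (a : V) : average (fun _ : 'I_N => a) = a.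
Proof.
rewrite /average sumr_const card_ord -[a *+ N]scaler_nat scalerA mulVf ?scale1r//.
by rewrite gt_eqF.
Qed.

Lemma averageB (V : lmodType R) (x y : 'I_N -> V) :
  average (fun k => x k - y k) = average x - average y.
Proof. by rewrite /average sumrB scalerBr. Qed.

Lemma averageD (V : lmodType R) (x y : 'I_N -> V) :
  average (fun k => x k + y k) = average x + average y.
Proof. by rewrite /average big_split scalerDr. Qed.

Lemma averageZ (V : lmodType R) a (x : 'I_N -> V) :
  average (fun k => a *: x k) = a *: average x.
Proof. by rewrite /average -scaler_sumr !scalerA mulrC. Qed.

Lemma fronorm_average x : fronorm (average x) <= mean (fun k => fronorm (x k)).
Proof.
rewrite fronormZ ger0_norm ?invr_ge0 ?ler0n//.
by rewrite /mean ler_pM2l ?invr_gt0//; exact: fronorm_sum.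
Qed.

Lemma frob_average x A : frob (average x) A = mean (fun k => frob (x k) A).
Proof. by rewrite frobZl frob_suml. Qed.

(** The parallel axis identity: the cross term is linear in the deviations from the average, which
    sum to 0. Dropping a term shows that the average is the best common centre; for averaging rounds
    the full identity is needed. *)
Lemma sqr_fronorm_sub_average x A :
  mean (fun k => fronorm (x k - A) ^+ 2) =
  mean (fun k => fronorm (x k - average x) ^+ 2) + fronorm (average x - A) ^+ 2.
Proof.
have -> : mean (fun k => fronorm (x k - A) ^+ 2) =
  mean (fun k => fronorm (x k - average x) ^+ 2 +
   (2 * frob (x k - average x) (average x - A) + fronorm (average x - A) ^+ 2)).
  by congr (_ * _); apply: eq_bigr => k _; rewrite addrA -sqr_fronormD addrA subrK.
rewrite meanD meanD meanZ mean_cst -frob_average averageB average_cst.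
by rewrite subrr frob0l mulr0 add0r.
Qed.

Lemma sqr_fronorm_average_le x A :
  mean (fun k => fronorm (x k - average x) ^+ 2) <=
  mean (fun k => fronorm (x k - A) ^+ 2).
Proof. by rewrite sqr_fronorm_sub_average lerDl sqr_ge0. Qed.

Lemma sqr_fronorm_average x :
  fronorm (average x) ^+ 2 <= mean (fun k => fronorm (x k) ^+ 2).
Proof.
have := sqr_fronorm_sub_average x 0.
have -> : mean (fun k => fronorm (x k - 0) ^+ 2) = mean (fun k => fronorm (x k) ^+ 2).
  by congr (_ * _); apply: eq_bigr => k _; rewrite subr0.
rewrite subr0 => ->; rewrite lerDr; apply: mean_ge0 => k; exact: sqr_ge0.
Qed.

End Mean.

(** * Products with the Kronecker factor *)

Section Kronecker.
Context (d n : nat).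

Lemma sum_mxtens_index (f : 'I_(d * n) -> R) :
  \sum_c f c = \sum_l \sum_i f (mxtens_index (l, i)).
Proof.
rewrite (reindex (@mxtens_index d n)) /=; last first.
  by exists (@mxtens_unindex d n) => i _; rewrite ?mxtens_indexK ?mxtens_unindexK.
by rewrite pair_bigA; apply: eq_bigr => -[].
Qed.

Lemma kronIE (v : 'cV[R]_d) l i j :
  kronI n v (mxtens_index (l, i)) j = v l ord0 * (i == j)%:R.
Proof.
rewrite castmxE cast_ord_id mxE mxtens_indexK mxE.
congr (v _ _ * _); first exact: ord1.
by congr (_ == _)%:R; apply: val_inj; rewrite /= modn_small.
Qed.

Lemma mulmx_kronIE m (H : 'M[R]_(m, d * n)) (v : 'cV[R]_d) a j :
  (H *m kronI n v) a j = \sum_l v l ord0 * H a (mxtens_index (l, j)).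
Proof.
rewrite mxE sum_mxtens_index.
apply: eq_bigr => l _; rewrite (bigD1 j)//= big1 ?addr0 => [|i /negPf ij].
  by rewrite kronIE eqxx mulr1 mulrC.
by rewrite kronIE ij !mulr0.
Qed.

Lemma kronIB (v w : 'cV[R]_d) : kronI n (v - w) = kronI n v - kronI n w.
Proof.
apply/matrixP => c j; rewrite -[c]mxtens_unindexK; case: (mxtens_unindex c) => l i.
by rewrite [RHS]mxE [X in _ = _ + X]mxE !kronIE !mxE mulrBl.
Qed.

(** Functions on [I] are read as row vectors through [enum_val], which reduces the claim to
    [frob_le], applied to [f] and to its opposite. *)
Lemma sqr_sum_mul_le (I : finType) (f g : I -> R) :
  (\sum_i f i * g i) ^+ 2 <= (\sum_i f i ^+ 2) * (\sum_i g i ^+ 2).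
Proof.
pose X (h : I -> R) := \row_(i < #|I|) h (enum_val i).
have E h h' : frob (X h) (X h') = \sum_i h i * h' i.
  rewrite /frob big_ord1 [RHS](reindex (@enum_val I I)) /=; last first.
    by exists enum_rank => i _; rewrite ?enum_valK ?enum_rankK.
  by apply: eq_bigr => i _; rewrite !mxE.
have E2 h : \sum_i h i ^+ 2 = fronorm (X h) ^+ 2.
  by rewrite sqr_fronorm E; apply: eq_bigr => i _; rewrite expr2.
rewrite !E2 -E -exprMn -real_normK ?num_real// ler_pXn2r ?nnegrE//; last first.
  by rewrite mulr_ge0 ?fronorm_ge0.
rewrite ler_norml frob_le andbT lerNl -frobNl -(fronormN (X f)).
exact: frob_le.
Qed.

(** The Frobenius norm of [kronI n v] is [sqrt n |v|], so submultiplicativity would lose a factor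
    [sqrt n]. Cauchy-Schwarz over the component index alone loses nothing. *)
Lemma fronorm_mulmx_kronI m (H : 'M[R]_(m, d * n)) (v : 'cV[R]_d) :
  fronorm (H *m kronI n v) <= fronorm H * fronorm v.
Proof.
apply: fronorm_le; first by rewrite mulr_ge0 ?fronorm_ge0.
rewrite exprMn !sqr_fronormE mulr_suml; apply: ler_sum => a _.
rewrite sum_mxtens_index exchange_big /=.
rewrite mulr_suml; apply: ler_sum => j _; rewrite mulmx_kronIE mulrC.
apply: le_trans (sqr_sum_mul_le _ _) _.
rewrite le_eqVlt; apply/orP; left; apply/eqP; congr (_ * _).
by apply: eq_bigr => l _; rewrite big_ord1.
Qed.

End Kronecker.

End Frobenius.

(** * Samples independent of the past *)

Section Fresh.
Context (R : realType) (dO : measure_display) (Omega : measurableType dO).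
Context (P : probability Omega R).
Context (G : set (set Omega)) (GO : G `<=` measurable).

Lemma g_sigma_sub : <<s G >> `<=` @measurable _ Omega.
Proof. by apply: smallest_sub => //; exact: sigma_algebra_measurable. Qed.

Let Y : measurableType _ := g_sigma_algebraType G.

(** The identity into the coarser sigma-algebra, a random variable whose law is [P] restricted to
    the past. *)
Let idG : Omega -> Y := id.

Let measurable_idG : measurable_fun setT idG.
Proof. by move=> _ A mA; rewrite setTI; exact: g_sigma_sub. Qed.

HB.instance Definition _ := isMeasurableFun.Build _ _ _ _ idG measurable_idG.

Context (dS : measure_display) (S : measurableType dS) (mu : probability S R).
Context (X : {mfun Omega >-> S}).

(** With [A] the whole space this says that [X] has law [mu]; the general case then says that [X] is
    independent of the past. *)
Definition fresh := forall A B, <<s G >> A -> measurable B ->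
  P (A `&` X @^-1` B) = (P A * mu B)%E.

Hypothesis fX : fresh.

Let pairX : Omega -> (Y * S)%type := fun w => (w, X w).

Let measurable_pairX : measurable_fun setT pairX.
Proof. by apply/measurable_fun_pair => //; exact: measurable_idG. Qed.

HB.instance Definition _ := isMeasurableFun.Build _ _ _ _ pairX measurable_pairX.

(** The joint law of the past and [X] is a product measure, so Tonelli integrates the sample first,
    with the past frozen. This takes the place of conditional expectations and, for nonnegative
    integrands, asks for no integrability. *)
Lemma fresh_integral (phi : Y * S -> \bar R) :
  measurable_fun setT phi -> (forall z, 0 <= phi z)%E ->
  (\int[P]_w phi (w, X w) = \int[P]_w \int[mu]_x phi (w, x))%E.
Proof.
move=> mphi phi0.
pose PG : probability Y R := distribution P idG.
pose PX : probability _ R := distribution P pairX.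
have <- : (\int[PX]_z phi z = \int[P]_w phi (w, X w))%E.
  rewrite ge0_integral_pushforward//.
have -> : (\int[PX]_z phi z = \int[PG \x mu]_z phi z)%E.
  apply: eq_measure_integral => A mA _; apply/esym.
  exact: product_measure_unique.
rewrite fubini_tonelli1//.
rewrite ge0_integral_pushforward//.
- exact: measurable_fun_fubini_tonelli_F.
- by move=> w _; exact: integral_ge0.
Qed.

End Fresh.

Section Independence.
Context (R : realType) (dO : measure_display) (Omega : measurableType dO).
Context (P : probability Omega R) (I : choiceType) (S : I -> set (set Omega)).
Hypothesis indep : independent_systems P S.
Hypothesis SO : forall i, S i `<=` measurable.
Hypothesis ST : forall i, S i setT.
Hypothesis SI : forall i, setI_closed (S i).

Definition past (D : set I) : set (set Omega) := \bigcup_(i in D) S i.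

Lemma past_measurable D : past D `<=` measurable.
Proof. by move=> A [i _]; exact: SO. Qed.

(** The union [past D] is not closed under intersection; finite intersections are, and they generate
    the same sigma-algebra. The value [setT] off [J] makes the intersection of two cylinders
    pointwise in the index. *)
Let cylinder (D : set I) : set (set Omega) := [set A | exists (J : {fset I}) E,
  [/\ forall i, i \in J -> D i, forall i, S i (E i),
      forall i, i \notin J -> E i = setT & A = \bigcap_i E i]].

Let cylinder_setI D : setI_closed (cylinder D).
Proof.
move=> A B [J [E [JD SE ET ->]]] [J' [E' [JD' SE' ET' ->]]].
exists (J `|` J')%fset, (fun i => E i `&` E' i); split.
- by move=> i; rewrite inE => /orP[/JD|/JD'].
- by move=> i; exact: SI.
- by move=> i; rewrite inE negb_or => /andP[/ET -> /ET' ->]; rewrite setIT.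
- by rewrite bigcapI.
Qed.

Let past_cylinder D : past D `<=` cylinder D.
Proof.
move=> A [i Di SiA].
exists [fset i]%fset, (fun j => if j == i then A else setT); split.
- by move=> j; rewrite inE => /eqP ->.
- by move=> j; case: eqVneq => [->|].
- by move=> j; rewrite inE => /negPf ->.
- apply/seteqP; split=> [w Aw j _|w /(_ i Logic.I)]; last by rewrite eqxx.
  by case: eqVneq.
Qed.

Let cylinder_measurable D : cylinder D `<=` measurable.
Proof.
move=> A [J [E [_ SE ET ->]]].
rewrite (_ : \bigcap_i E i = \bigcap_(i in [set` J]) E i).
  by apply: fin_bigcap_measurable => // i _; exact/SO.
apply/seteqP; split=> [w wE i _|w wE i _]; first exact: wE.
by have [/wE//|/ET ->] := boolP (i \in J).
Qed.

Let cylinderE (J : {fset I}) (E : I -> set Omega) :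
  (forall i, i \notin J -> E i = setT) ->
  \bigcap_i E i = \bigcap_(i in [set i | i \in J]) E i.
Proof.
move=> ET; apply/seteqP; split=> [w wE i _|w wE i _]; first exact: wE.
by have [/wE//|/ET ->] := boolP (i \in J).
Qed.

(** Dynkin's pi-lambda theorem: with [B] fixed, the events that satisfy the product rule contain the
    cylinders and are closed under complements and disjoint countable unions. *)
Lemma past_independent (D : set I) i A B : ~ D i -> <<s past D >> A -> S i B ->
  P (A `&` B) = (P A * P B)%E.
Proof.
move=> Di pA SB.
have : <<s cylinder D >> A by move: A pA; exact: sub_sigma_algebra2 (@past_cylinder D).
have sO : <<s cylinder D >> `<=` @measurable _ Omega.
  apply: smallest_sub; first exact: sigma_algebra_measurable.
  exact: cylinder_measurable.
have mB : measurable B by exact: SO SB.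
move: A {pA}.
apply: (@dynkin_induction _ (g_sigma_algebraType (cylinder D)) (cylinder D)
  [set A | P (A `&` B) = (P A * P B)%E]) => //.
- by rewrite /= setTI probability_setT mul1e.
- move=> A [J [E [JD SE ET AE]]] /=.
  have iJ : i \notin J by apply/negP => /JD.
  (* As [i] is not in [J], [B] can be inserted as one more factor, and independence is applied with
     and without it. *)
  pose E' j := if j == i then B else E j.
  have -> : A `&` B = \bigcap_(j in [set j | j \in (i |` J)%fset]) E' j.
    rewrite AE; apply/seteqP; split.
      move=> w [wE Bw] j _; rewrite /E'; case: eqVneq => // _; exact: wE.
    move=> w wE; split; last first.
      by have := wE i; rewrite /E' eqxx; apply; rewrite /= !inE eqxx.
    move=> j _; have [jJ|/ET ->//] := boolP (j \in J).
    have := wE j; rewrite /E'; case: eqVneq => [ji|_].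
      by rewrite -ji jJ in iJ.
    by apply; rewrite /= !inE jJ orbT.
  rewrite indep; last first.
    by move=> j _; rewrite /E'; case: eqVneq => [->|].
  rewrite big_fsetU1//= /E' eqxx muleC AE (cylinderE ET) indep//.
  congr (_ * _)%E; rewrite !big_seq; apply: eq_bigr => j jJ.
  by case: eqVneq => // ji; rewrite -ji jJ in iJ.
- move=> A /sO mA /= PAB.
  have -> : P (~` (A : set Omega) `&` B) = (P B - P (A `&` B))%E.
    rewrite setIC -setDE [A `&` B]setIC; apply: measureD => //.
    by rewrite -ge0_fin_numE ?fin_num_measure.
  rewrite PAB probability_setC//.
  rewrite -(fineK (fin_num_measure P A mA)) -(fineK (fin_num_measure P B mB)).
  by rewrite -EFinM -!EFinB -EFinM; congr EFin; ring.
- move=> F mF tF /= PF.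
  pose F' : (set Omega)^nat := F.
  have mF' k : measurable (F' k) by exact: sO (mF k).
  have E : P (\bigcup_k (F' k `&` B)) = (\sum_(k <oo) P (F' k `&` B))%E.
    apply: measure_semi_bigcup.
    - by move=> k; exact: measurableI.
    - exact: trivIset_setIr.
    - by apply: bigcupT_measurable => k; exact: measurableI.
  have E' : P (\bigcup_k F' k) = (\sum_(k <oo) P (F' k))%E.
    by apply: measure_semi_bigcup => //; exact: bigcupT_measurable.
  rewrite [LHS](_ : _ = P (\bigcup_k (F' k `&` B))); last by rewrite setI_bigcupl.
  rewrite [X in (X * _)%E](_ : _ = P (\bigcup_k F' k))// E E'.
  rewrite -(fineK (fin_num_measure P B mB)) muleC -nneseriesZl//.
  by apply: eq_eseriesr => k _; rewrite PF fineK ?fin_num_measure// muleC.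
Qed.

End Independence.

(** * Measurability *)

Section MatrixMeasurability.
Context (R : realType).

Definition mxmeasurable (dY : measure_display) (Y : measurableType dY)
  (p q : nat) (Z : Y -> 'M[R]_(p, q)) := forall i j, measurable_fun setT (fun y => Z y i j).

Section Closure.
Context (dY : measure_display) (Y : measurableType dY).

Lemma mxmeasurable_cst p q (A : 'M[R]_(p, q)) : mxmeasurable (fun _ : Y => A).
Proof. by move=> i j; exact: measurable_cst. Qed.

Lemma mxmeasurableD p q (Z Z' : Y -> 'M[R]_(p, q)) :
  mxmeasurable Z -> mxmeasurable Z' -> mxmeasurable (fun y => Z y + Z' y).
Proof.
move=> mZ mZ' i j; rewrite (_ : (fun y => _) = (fun y => Z y i j + Z' y i j)).
  exact: measurable_funD.
by apply/funext => y; rewrite mxE.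
Qed.

Lemma measurable_mx_scale p q (c : Y -> R) (Z : Y -> 'M[R]_(p, q)) :
  measurable_fun setT c -> mxmeasurable Z -> mxmeasurable (fun y => c y *: Z y).
Proof.
move=> mc mZ i j; rewrite (_ : (fun y => _) = (fun y => c y * Z y i j)).
  exact: measurable_funM.
by apply/funext => y; rewrite mxE.
Qed.

Lemma mxmeasurableZ p q (c : R) (Z : Y -> 'M[R]_(p, q)) :
  mxmeasurable Z -> mxmeasurable (fun y => c *: Z y).
Proof. exact: measurable_mx_scale. Qed.

Lemma mxmeasurableN p q (Z : Y -> 'M[R]_(p, q)) :
  mxmeasurable Z -> mxmeasurable (fun y => - Z y).
Proof. by move=> mZ; under eq_fun do rewrite -scaleN1r; exact: mxmeasurableZ. Qed.

Lemma mxmeasurableB p q (Z Z' : Y -> 'M[R]_(p, q)) :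
  mxmeasurable Z -> mxmeasurable Z' -> mxmeasurable (fun y => Z y - Z' y).
Proof. by move=> mZ mZ'; apply: mxmeasurableD => //; exact: mxmeasurableN. Qed.

Lemma mxmeasurable_mulmx p q r (Z : Y -> 'M[R]_(p, q)) (Z' : Y -> 'M[R]_(q, r)) :
  mxmeasurable Z -> mxmeasurable Z' -> mxmeasurable (fun y => Z y *m Z' y).
Proof.
move=> mZ mZ' i j.
rewrite (_ : (fun y => _) = (fun y => \sum_k Z y i k * Z' y k j)).
  by apply: measurable_sum => k; exact: measurable_funM.
by apply/funext => y; rewrite mxE.
Qed.

Lemma mxmeasurable_tr p q (Z : Y -> 'M[R]_(p, q)) :
  mxmeasurable Z -> mxmeasurable (fun y => (Z y)^T).
Proof. by move=> mZ i j; under eq_fun do rewrite mxE; exact: mZ. Qed.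

Lemma mxmeasurable_sum p q (I : Type) (s : seq I) (Z : I -> Y -> 'M[R]_(p, q)) :
  (forall i, mxmeasurable (Z i)) -> mxmeasurable (fun y => \sum_(i <- s) Z i y).
Proof.
move=> mZ; elim: s => [|i s IH].
  by under eq_fun do rewrite big_nil; exact: mxmeasurable_cst.
by under eq_fun do rewrite big_cons; exact: mxmeasurableD.
Qed.

Lemma mxmeasurable_average p q N (Z : 'I_N -> Y -> 'M[R]_(p, q)) :
  (forall i, mxmeasurable (Z i)) -> mxmeasurable (fun y => average (fun k => Z k y)).
Proof. by move=> mZ; apply: mxmeasurableZ; exact: mxmeasurable_sum. Qed.

Lemma mxmeasurable_kronI d n (v : Y -> 'cV[R]_d) :
  mxmeasurable v -> mxmeasurable (fun y => kronI n (v y)).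
Proof.
move=> mv i j; rewrite -[i]mxtens_unindexK; case: (mxtens_unindex i) => l i'.
under eq_fun do rewrite kronIE.
by apply: measurable_funM => //; exact: mv.
Qed.

Lemma measurable_fronorm p q (Z : Y -> 'M[R]_(p, q)) :
  mxmeasurable Z -> measurable_fun setT (fun y => fronorm (Z y)).
Proof.
move=> mZ; apply: (measurableT_comp (f := @Num.sqrt R)).
  by apply: continuous_measurable_fun; exact: sqrt_continuous.
apply: measurable_sum => i; apply: measurable_sum => j.
exact: measurable_funX.
Qed.

Lemma measurable_sqr_fronorm p q (Z : Y -> 'M[R]_(p, q)) :
  mxmeasurable Z -> measurable_fun setT (fun y => fronorm (Z y) ^+ 2).
Proof. by move=> mZ; apply: measurable_funX; exact: measurable_fronorm. Qed.

End Closure.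

Lemma mxmeasurable_comp (dY dZ : measure_display) (Y : measurableType dY)
  (Z : measurableType dZ) p q (F : Z -> 'M[R]_(p, q)) (f : Y -> Z) :
  mxmeasurable F -> measurable_fun setT f -> mxmeasurable (fun y => F (f y)).
Proof. by move=> mF mf i j; exact: measurableT_comp (mF i j) mf. Qed.

Lemma cvg_mx p q (F : nat -> 'M[R]_(p, q)) (A : 'M[R]_(p, q)) :
  (forall i j, F k i j @[k --> \oo] --> A i j) -> F k @[k --> \oo] --> A.
Proof.
move=> FA; apply/cvg_ballP => e e0.
suff : \forall k \near \oo, ball A e (F k) by [].
have : \forall k \near \oo, forall ij : 'I_p * 'I_q, `|A ij.1 ij.2 - F k ij.1 ij.2| < e.
  apply: filter_forall => -[i j] /=.
  by have /cvgrPdist_lt/(_ _ e0) := FA i j.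
by apply: filterS => k Fk; split => // i j; exact: Fk (i, j).
Qed.

Lemma measurable_countable_case (dY dZ : measure_display) (Y : measurableType dY)
  (Z : measurableType dZ) (T : countType) (c : Y -> T) (f : T -> Y -> Z) :
  (forall t, measurable [set y | c y = t]) ->
  (forall t, measurable_fun setT (f t)) -> measurable_fun setT (fun y => f (c y) y).
Proof.
move=> mc mf _ B mB; rewrite setTI.
rewrite (_ : _ @^-1` B = \bigcup_k if @choice.unpickle T k is Some t then
    [set y | c y = t] `&` (f t @^-1` B) else set0).
  apply: bigcupT_measurable => k; case: (@choice.unpickle T k) => // t.
  by apply: measurableI => //; rewrite -[X in measurable X]setTI; exact: mf.
apply/seteqP; split=> [y By|y [k _]].
  by exists (choice.pickle (c y)); rewrite ?choice.pickleK.
by case: (@choice.unpickle T k) => // t [<-].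
Qed.

Lemma cvg_invn : (N.+1%:R^-1 : R) @[N --> \oo] --> (0 : R).
Proof. exact: cvg_harmonic. Qed.

(** [W] is rounded down to the lattice of mesh [1 / (N + 1)]. The rounded value ranges over a
    countable set, so the composite is measurable cell by cell; continuity in the matrix gives the
    limit. *)
Lemma measurable_caratheodory (dY dS : measure_display) (Y : measurableType dY)
    (S : measurableType dS) p q (Phi : 'M[R]_(p, q) -> S -> R)
    (W : Y -> 'M[R]_(p, q)) (X : Y -> S) :
  (forall A, measurable_fun setT (Phi A)) -> (forall x, continuous (Phi ^~ x)) ->
  mxmeasurable W -> measurable_fun setT X ->
  measurable_fun setT (fun y => Phi (W y) (X y)).
Proof.
move=> mPhi cPhi mW mX.
pose code N y : 'M[int]_(p, q) := \matrix_(i, j) Num.floor (N.+1%:R * W y i j).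
pose lattice N (C : 'M[int]_(p, q)) : 'M[R]_(p, q) :=
  \matrix_(i, j) (N.+1%:R^-1 * (C i j)%:~R).
apply: (measurable_fun_cvg (h := fun N y => Phi (lattice N (code N y)) (X y))).
  move=> N; apply: (measurable_countable_case (f := fun C y => Phi (lattice N C) (X y))).
    move=> C; rewrite (_ : [set y | _] =
      \bigcap_(ij in [set: 'I_p * 'I_q]) [set y |
        (C ij.1 ij.2)%:~R <= N.+1%:R * W y ij.1 ij.2 < (C ij.1 ij.2 + 1)%:~R]).
      apply: fin_bigcap_measurable => // -[i j] _ /=.
      have m1 : measurable_fun setT (fun y => N.+1%:R * W y i j).
        by apply: measurable_funM => //; exact: mW.
      have := m1 measurableT _ (measurable_itv `[(C i j)%:~R, (C i j + 1)%:~R[).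
      by rewrite setTI; congr measurable; apply/seteqP; split => y /=; rewrite in_itv.
    apply/seteqP; split => [y <- [i j] _ /=|y yC].
      by rewrite mxE floor_itv.
    by apply/matrixP => i j; rewrite mxE; apply/eqP; rewrite floor_eq; exact: (yC (i, j)).
  by move=> C; exact: measurableT_comp.
move=> y _; apply: (cvg_comp (fun N => lattice N (code N y)) (Phi ^~ (X y))); last exact: cPhi.
apply: cvg_mx => i j.
have E N : W y i j - N.+1%:R^-1 <= lattice N (code N y) i j <= W y i j.
  have N0 : 0 < N.+1%:R :> R by rewrite ltr0n.
  rewrite !mxE; set a := W y i j.
  have /andP[+ +] := floor_itv (N.+1%:R * a); rewrite intrD => h1 h2.
  rewrite -(ler_pM2l N0) -[X in _ && X](ler_pM2l N0) mulrBr !mulrA divff ?gt_eqF// !mul1r.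
  by rewrite h1 andbT lerBlDr ltW.
apply: (squeeze_cvgr (f := fun N => W y i j - N.+1%:R^-1) (h := fun=> W y i j)).
- by near=> N; exact: E.
- rewrite -[X in _ --> X]subr0; apply: cvgB; first exact: cvg_cst.
  exact: cvg_invn.
- exact: cvg_cst.
Unshelve. all: by end_near. Qed.

End MatrixMeasurability.

Section JointMeasurability.
Context (R : realType) (dS : measure_display) (S : measurableType dS).

(** Stated through composites, so that [Y] may carry any sigma-algebra, in particular that of a
    history. *)
Definition jointly_measurable p q r s (Phi : 'M[R]_(p, q) -> S -> 'M[R]_(r, s)) :=
  forall dY (Y : measurableType dY) (W : Y -> 'M[R]_(p, q)) (X : Y -> S),
    mxmeasurable W -> measurable_fun setT X ->
    mxmeasurable (fun y => Phi (W y) (X y)).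

Lemma differentiable_entry p q r s (Phi : 'M[R]_(p, q) -> 'M[R]_(r, s)) A i j :
  differentiable Phi A -> differentiable (fun B => Phi B i j : R) A.
Proof.
move=> dPhi; apply: (@differentiable_comp _ _ _ _ Phi (fun N : 'M[R]_(r, s) => N i j : R)) => //.
exact: differentiable_coord.
Qed.

Lemma differentiable_jointly_measurable p q r s
    (Phi : 'M[R]_(p, q) -> S -> 'M[R]_(r, s)) :
  (forall A, mxmeasurable (Phi A)) ->
  (forall x A, differentiable (fun B => Phi B x) A) -> jointly_measurable Phi.
Proof.
move=> mPhi dPhi dY Y W X mW mX i j.
apply: (measurable_caratheodory (Phi := fun A x => Phi A x i j)) => //.
  by move=> A; exact: mPhi.
by move=> x A; apply: differentiable_continuous; exact: differentiable_entry.
Qed.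

Lemma gradient_jointly_measurable p q (f : 'M[R]_(p, q) -> S -> R) :
  (forall A, measurable_fun setT (f A)) ->
  (forall x A, differentiable (fun B => f B x) A) ->
  jointly_measurable (fun A x => gradient (fun B => f B x) A).
Proof.
move=> mf df dY Y W X mW mX i j; under eq_fun do rewrite mxE.
apply: (measurable_fun_cvg (h := fun N y => N.+1%:R *
  (f (N.+1%:R^-1 *: delta_mx i j + W y) (X y) - f (W y) (X y)))).
  move=> N; apply: measurable_funM => //; apply: measurable_funB.
    apply: measurable_caratheodory => //.
      by move=> x A; exact: differentiable_continuous.
    by apply: mxmeasurableD => //; exact: mxmeasurable_cst.
  apply: measurable_caratheodory => //.
  by move=> x A; exact: differentiable_continuous.
move=> y _; have := @diff_derivable _ _ _ _ _ (delta_mx i j) (df (X y) (W y)).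
rewrite /derivable => /cvg_ex[l dl]; rewrite /derive (cvg_lim _ dl)//.
pose u N : R := N.+1%:R^-1.
(* The derivative is a limit over punctured neighbourhoods of 0, so the sequence must stay
   nonzero. *)
have u0 : u N @[N --> \oo] --> (0 : R)^'.
  move=> B; rewrite /dnbhs/= => /nbhs_ballP[e /= e0 Be].
  have : \forall N \near \oo, `|0 - u N| < e.
    by have /cvgrPdist_lt/(_ _ e0) := @cvg_invn R.
  by apply: filterS => N uN; apply: Be => //; rewrite /u invr_neq0.
have E : (fun h => h^-1 *: ((f^~ (X y) \o shift (W y)) (h *: delta_mx i j) -
    f (W y) (X y))) \o u =
  fun N => N.+1%:R * (f (N.+1%:R^-1 *: delta_mx i j + W y) (X y) - f (W y) (X y)).
  by apply/funext => N /=; rewrite /u invrK.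
by have := cvg_comp _ _ u0 dl; rewrite E.
Qed.

Lemma jac_jointly_measurable m n d (g : 'M[R]_(m, n) -> S -> 'cV[R]_d) :
  (forall A, mxmeasurable (g A)) ->
  (forall x A, differentiable (fun B => g B x) A) ->
  jointly_measurable (fun A x => jac (fun B => g B x) A).
Proof.
move=> mg dg dY Y W X mW mX a c; under eq_fun do rewrite mxE.
apply: (gradient_jointly_measurable
  (f := fun B x => g B x (mxtens_unindex c).1 ord0)) => //.
  by move=> A; exact: mg.
by move=> x A; exact: differentiable_entry.
Qed.

End JointMeasurability.

(** * Polar factor and projection onto a ball *)

Section Polar.
Context (R : realType) (m n : nat).
Implicit Types M : 'M[R]_(m, n).

(* The Newton-Schulz step for the matrix sign: on singular values it is
   s |-> s (3 - s^2) / 2, which fixes 0 and attracts ]0, 1] to 1. *)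
Definition newton_schulz M : 'M[R]_(m, n) :=
  (3 / 2) *: M - (1 / 2) *: (M *m M^T *m M).

(** Singular values are at most [fronorm M], so dividing by [1 + fronorm M] brings them into ]0, 1[,
    and is harmless at [M = 0]. *)
Definition polar_iter k M : 'M[R]_(m, n) :=
  iter k newton_schulz ((1 + fronorm M)^-1 *: M).

Definition polar M : 'M[R]_(m, n) :=
  \matrix_(i, j) lim (polar_iter k M i j @[k --> \oo]).

Let ns (s : R) := 3 / 2 * s - 1 / 2 * s ^+ 3.

Let ns_cvg (s : R) : 0 < s <= 1 -> iter k ns s @[k --> \oo] --> (1 : R).
Proof.
move=> /andP[s0 s1].
(* One step multiplies the gap [1 - t] by [1 - (t + t^2) / 2], which is at most [1 - s / 2] as long
   as [s <= t]; the second conjunct maintains the latter. *)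
have H k : 0 <= 1 - iter k ns s <= (1 - s / 2) ^+ k /\ s <= iter k ns s.
  elim: k => [|k [/andP[H1 H2] H3]] /=; first by rewrite expr0; split; lra.
  move: H1 H2 H3; set t := iter k ns s => H1 H2 H3.
  have -> : 1 - ns t = (1 - t) * (1 - (t + t ^+ 2) / 2) by rewrite /ns; field.
  have t0 : 0 <= 1 - (t + t ^+ 2) / 2 by nra.
  split; last by rewrite /ns; nra.
  rewrite mulr_ge0//= [leRHS]exprS [leLHS]mulrC ler_pM//; nra.
have E : (1 - s / 2) ^+ k @[k --> \oo] --> (0 : R).
  by apply: cvg_expr; rewrite ger0_norm; lra.
apply: (squeeze_cvgr (f := fun k => 1 - (1 - s / 2) ^+ k) (h := fun=> 1)).
- near=> k; have [/andP[H1 H2] _] := H k; lra.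
- by rewrite -[X in _ --> X]subr0; apply: cvgB => //; exact: cvg_cst.
- exact: cvg_cst.
Unshelve. all: by end_near. Qed.

Lemma cvg_sumr (I : Type) (r : seq I) (f : I -> nat -> R) (l : I -> R) :
  (forall i, f i k @[k --> \oo] --> l i) ->
  \sum_(i <- r) f i k @[k --> \oo] --> \sum_(i <- r) l i.
Proof.
move=> fl; elim: r => [|i r IH].
  by under eq_fun do rewrite big_nil; rewrite big_nil; exact: cvg_cst.
by under eq_fun do rewrite big_cons; rewrite big_cons; exact: cvgD.
Qed.

Context (r : nat) (M : 'M[R]_(m, n)) (U : 'M[R]_(m, r)) (s : 'rV[R]_r) (V : 'M[R]_(n, r)).
Hypothesis svd : is_compact_svd M U s V.

Let UU : U^T *m U = 1%:M. Proof. by case: svd. Qed.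
Let VV : V^T *m V = 1%:M. Proof. by case: svd. Qed.
Let s0 i : 0 < s ord0 i. Proof. by case: svd. Qed.
Let ME : M = U *m diag_mx s *m V^T. Proof. by case: svd. Qed.

Lemma frob_mxtrace p q (A B : 'M[R]_(p, q)) : frob A B = \tr (A *m B^T).
Proof.
by apply: eq_bigr => i _; rewrite mxE; apply: eq_bigr => j _; rewrite mxE.
Qed.

Let frob_UV (a b : 'rV[R]_r) :
  frob (U *m diag_mx a *m V^T) (U *m diag_mx b *m V^T) = \sum_i a ord0 i * b ord0 i.
Proof.
rewrite frob_mxtrace !trmx_mul trmxK tr_diag_mx.
rewrite -!mulmxA (mulmxA V^T) VV mul1mx (mulmxA (diag_mx a)) mulmx_diag.
rewrite mxtrace_mulC -!mulmxA UU mulmx1 mxtrace_diag.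
by apply: eq_bigr => i _; rewrite mxE.
Qed.

Let UVE : U *m V^T = U *m diag_mx (const_mx 1) *m V^T.
Proof. by rewrite diag_const_mx mulmx1. Qed.

Let sqr_fronorm_svd : fronorm M ^+ 2 = \sum_i s ord0 i ^+ 2.
Proof. by rewrite sqr_fronorm ME frob_UV; apply: eq_bigr => i _; rewrite expr2. Qed.

(** The square is the number [r] of singular values, and [r <= n] because [V] has [r] orthonormal
    columns of length [n]. *)
Lemma sqr_fronorm_polar_factor : fronorm (U *m V^T) ^+ 2 <= n%:R.
Proof.
rewrite sqr_fronorm UVE frob_UV.
under eq_bigr do rewrite mxE mulr1.
by rewrite sumr_const card_ord ler_nat; exact: mulmx1_min VV.
Qed.

(** The inner product is the nuclear norm, the sum of the singular values, which dominates their
    Euclidean norm. *)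
Lemma fronorm_le_frob_polar_factor : fronorm M <= frob M (U *m V^T).
Proof.
rewrite UVE [in frob M _]ME frob_UV.
under eq_bigr do rewrite mxE mulr1.
have S0 : 0 <= \sum_i s ord0 i by apply: sumr_ge0 => i _; exact: ltW.
apply: fronorm_le => //; rewrite sqr_fronorm_svd expr2 mulr_suml.
apply: ler_sum => i _; rewrite expr2 ler_wpM2l ?(ltW (s0 i))//.
by rewrite (bigD1 i)//= lerDl sumr_ge0// => j _; exact: ltW.
Qed.

Let polar_iterE k : polar_iter k M =
  U *m diag_mx (\row_i iter k ns ((1 + fronorm M)^-1 * s ord0 i)) *m V^T.
Proof.
elim: k => [|k IH].
  rewrite /polar_iter/=; set c := (1 + _)^-1; rewrite ME scalemxAl scalemxAr.
  congr (_ *m _ *m _).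
  by apply/matrixP => i j; rewrite !mxE mulrnAr.
rewrite /polar_iter iterS -/(polar_iter k M) IH /newton_schulz.
set t := \row_i _; rewrite !trmx_mul trmxK tr_diag_mx.
have -> : U *m diag_mx t *m V^T *m (V *m (diag_mx t *m U^T)) *m (U *m diag_mx t *m V^T)
  = U *m (diag_mx t *m diag_mx t *m diag_mx t) *m V^T.
  by rewrite !mulmxA -(mulmxA _ V^T V) VV mulmx1 -(mulmxA _ U^T U) UU mulmx1.
rewrite !mulmx_diag [(3 / 2) *: _]scalemxAl [(1 / 2) *: _]scalemxAl
  [(3 / 2) *: _]scalemxAr [(1 / 2) *: _]scalemxAr -mulmxBl -mulmxBr; congr (_ *m _ *m _).
apply/matrixP => i j; rewrite !mxE /=.
rewrite /ns; case: (i == j); rewrite ?mulr1n ?mulr0n ?mulr0 ?subrr//.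
by rewrite exprS expr2 mulrA.
Qed.

Lemma cvg_polar_iter i j : polar_iter k M i j @[k --> \oo] --> (U *m V^T) i j.
Proof.
have -> : (fun k => polar_iter k M i j) = (fun k =>
    \sum_l U i l * iter k ns ((1 + fronorm M)^-1 * s ord0 l) * V j l).
  apply/funext => k; rewrite polar_iterE mxE; apply: eq_bigr => l _.
  by rewrite mul_mx_diag !mxE.
have -> : (U *m V^T) i j = \sum_l U i l * 1 * V j l.
  by rewrite mxE; apply: eq_bigr => l _; rewrite mxE mulr1.
apply: cvg_sumr => l; apply: cvgM; last exact: cvg_cst.
apply: cvgM; first exact: cvg_cst.
have N0 : 0 < 1 + fronorm M by have := fronorm_ge0 M; lra.
apply: ns_cvg; rewrite mulr_gt0 ?invr_gt0//=.
rewrite ler_pdivrMl// mulr1.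
suff : s ord0 l <= fronorm M by lra.
rewrite -(@ler_pXn2r _ 2) ?nnegrE ?fronorm_ge0 ?(ltW (s0 l))//.
rewrite sqr_fronorm_svd (bigD1 l)//= lerDl sumr_ge0// => ? _; exact: sqr_ge0.
Qed.

(** The left side does not mention the decomposition, so every compact SVD gives the same step. This
    turns the relation [step_W] into a function of the state. *)
Lemma polar_svd : polar M = U *m V^T.
Proof. by apply/matrixP => i j; rewrite mxE; apply: cvg_lim => //; exact: cvg_polar_iter. Qed.

End Polar.

Lemma measurable_invr (R : realType) (dY : measure_display) (Y : measurableType dY)
    (f : Y -> R) :
  measurable_fun setT f -> (forall y, 0 <= f y) -> measurable_fun setT (fun y => (f y)^-1).
Proof.
move=> mf f0; rewrite (_ : (fun y => _) = (fun y => f y `^ (-1))).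
  exact: (measurableT_comp (measurable_powR (-1)) mf).
by apply/funext => y; rewrite powR_inv1.
Qed.

(** An SVD makes the iterates converge, and a pointwise limit of measurable functions is measurable.
    The run itself will supply the decompositions. *)
Lemma mxmeasurable_polar (R : realType) m n (dY : measure_display)
    (Y : measurableType dY) (Z : Y -> 'M[R]_(m, n)) :
  (forall y, exists r (U : 'M[R]_(m, r)) s V, is_compact_svd (Z y) U s V) ->
  mxmeasurable Z -> mxmeasurable (fun y => polar (Z y)).
Proof.
move=> svdZ mZ i j.
apply: (measurable_fun_cvg (h := fun k y => polar_iter k (Z y) i j)) => [k|y _].
  elim: k i j => [|k IH].
    apply: measurable_mx_scale => //.
    apply: measurable_invr; first by apply: measurable_funD => //; exact: measurable_fronorm.
    by move=> y; have := fronorm_ge0 (Z y); lra.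
  apply: mxmeasurableB; apply: mxmeasurableZ => //.
  apply: mxmeasurable_mulmx => //.
  by apply: mxmeasurable_mulmx => //; exact: mxmeasurable_tr.
have [r [U [s [V svd]]]] := svdZ y.
rewrite (polar_svd svd); exact: cvg_polar_iter svd i j.
Qed.

Section BallProjection.
Context (R : realType) (p q : nat) (C : R).
Implicit Types A B : 'M[R]_(p, q).

(** The maximum with [C] merges the cases inside and outside the ball into one measurable
    formula. *)
Definition ball_proj A : 'M[R]_(p, q) := (C / Num.max C (fronorm A)) *: A.

Hypothesis C0 : 0 < C.

Lemma ball_proj_le A : fronorm (ball_proj A) <= C.
Proof.
have M0 : 0 < Num.max C (fronorm A) by rewrite lt_max C0.
rewrite fronormZ ger0_norm ?divr_ge0 ?(ltW C0) ?(ltW M0)// mulrAC ler_pdivrMr//.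
by rewrite ler_pM2l// le_max lexx orbT.
Qed.

(** The variational inequality of a projection onto a convex set. Outside the ball [A - ball_proj A]
    is a positive multiple of [A], and the claim is Cauchy-Schwarz. *)
Lemma ball_proj_obtuse A B : fronorm B <= C ->
  0 <= frob (A - ball_proj A) (ball_proj A - B).
Proof.
move=> BC; rewrite /ball_proj.
have [AC|CA] := leP (fronorm A) C.
  by rewrite divff ?gt_eqF// scale1r subrr frob0l.
have A0 : 0 < fronorm A by exact: lt_trans CA.
set c := C / fronorm A.
have cA : c * fronorm A = C by rewrite /c divfK// gt_eqF.
have c1 : 0 <= 1 - c by rewrite subr_ge0 ler_pdivrMr// mul1r ltW.
rewrite -[X in X - c *: A]scale1r -scalerBl frobZl mulr_ge0//.
rewrite frobBr frobZr -sqr_fronorm expr2 mulrA cA.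
have := frob_le A B; have : fronorm A * fronorm B <= fronorm A * C by rewrite ler_pM2l.
by rewrite [C * _]mulrC; lra.
Qed.

(** A nearest point is unique: a candidate [B] no farther from [A] has [|ball_proj A - B|^2 <= 0] by
    the obtuse angle inequality. *)
Lemma ball_projE A B : is_ball_proj C A B -> B = ball_proj A.
Proof.
move=> [BC /(_ _ (ball_proj_le A)) AB].
have := ball_proj_obtuse A BC.
have : fronorm (A - B) ^+ 2 <= fronorm (A - ball_proj A) ^+ 2.
  by rewrite ler_pXn2r ?nnegrE ?fronorm_ge0.
have -> : A - B = (A - ball_proj A) + (ball_proj A - B) by rewrite addrA subrK.
rewrite sqr_fronormD => h1 h2.
have : fronorm (ball_proj A - B) ^+ 2 <= 0 by lra.
rewrite le_eqVlt ltNge sqr_ge0 orbF sqrf_eq0 => /eqP/fronorm0_eq0/eqP.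
by rewrite subr_eq0 => /eqP.
Qed.

Lemma ball_proj_nonexpansive A B : fronorm B <= C ->
  fronorm (ball_proj A - B) ^+ 2 <= fronorm (A - B) ^+ 2.
Proof.
move=> BC; have -> : A - B = (A - ball_proj A) + (ball_proj A - B) by rewrite addrA subrK.
by rewrite [leRHS]sqr_fronormD; have := ball_proj_obtuse A BC;
  have := sqr_ge0 (fronorm (A - ball_proj A)); lra.
Qed.

Lemma mxmeasurable_ball_proj (dY : measure_display) (Y : measurableType dY)
    (Z : Y -> 'M[R]_(p, q)) :
  mxmeasurable Z -> mxmeasurable (fun y => ball_proj (Z y)).
Proof.
move=> mZ; apply: measurable_mx_scale => //.
apply: measurable_funM => //.
apply: measurable_invr.
  by apply: measurable_maxr => //; exact: measurable_fronorm.
by move=> y; rewrite le_max ltW.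
Qed.

End BallProjection.

(** * Expectation bounds *)

Section ExpectLe.
Context (R : realType) (dT : measure_display) (T : measurableType dT).
Context (mu : probability T R).
Implicit Types (f g : T -> R) (r s : R).

(** Measurability and sign are part of the predicate, so that bounds can be added, scaled and
    averaged without any question of integrability. *)
Definition expect_le f r := [/\ measurable_fun setT f, (forall x, 0 <= f x) &
  (\int[mu]_x (f x)%:E <= r%:E)%E].

Lemma expect_leW f r s : expect_le f r -> r <= s -> expect_le f s.
Proof. by case=> mf f0 fr rs; split=> //; rewrite (le_trans fr)// lee_fin. Qed.

Lemma expect_le_mono f g r : measurable_fun setT g ->
  (forall x, 0 <= g x <= f x) -> expect_le f r -> expect_le g r.
Proof.
move=> mg gf [mf f0 fr]; split=> // [x|]; first by have /andP[] := gf x.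
apply: le_trans fr; apply: ge0_le_integral => //.
- by move=> x _; rewrite lee_fin; have /andP[] := gf x.
- exact/measurable_EFinP.
- exact/measurable_EFinP.
- by move=> x _; rewrite lee_fin; have /andP[] := gf x.
Qed.

Lemma expect_leD f g r s : expect_le f r -> expect_le g s ->
  expect_le (fun x => f x + g x) (r + s).
Proof.
move=> [mf f0 fr] [mg g0 gs]; split.
- exact: measurable_funD.
- by move=> x; rewrite addr_ge0.
under eq_integral do rewrite EFinD.
rewrite ge0_integralD//; first by rewrite EFinD leeD.
- by move=> x _; rewrite lee_fin.
- exact/measurable_EFinP.
- by move=> x _; rewrite lee_fin.
- exact/measurable_EFinP.
Qed.

Lemma expect_leZ (c : R) f r : 0 <= c -> expect_le f r ->
  expect_le (fun x => c * f x) (c * r).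
Proof.
move=> c0 [mf f0 fr]; split.
- exact: measurable_funM.
- by move=> x; rewrite mulr_ge0.
under eq_integral do rewrite EFinM.
rewrite ge0_integralZl_EFin//; first by rewrite EFinM lee_wpmul2l// lee_fin.
- by move=> x _; rewrite lee_fin.
- exact/measurable_EFinP.
Qed.

Lemma expect_le_cst r : 0 <= r -> expect_le (fun=> r) r.
Proof.
move=> r0; split=> //.
by rewrite integral_cst//= probability_setT mule1.
Qed.

Lemma expect_le_sum (I : Type) (s : seq I) (f : I -> T -> R) (r : I -> R) :
  (forall i, expect_le (f i) (r i)) ->
  expect_le (fun x => \sum_(i <- s) f i x) (\sum_(i <- s) r i).
Proof.
move=> fr; elim: s => [|i s IH].
  rewrite big_nil; under eq_fun do rewrite big_nil; exact: expect_le_cst.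
rewrite big_cons; under eq_fun do rewrite big_cons; exact: expect_leD.
Qed.

Lemma expect_le_mean N (f : 'I_N -> T -> R) (r : 'I_N -> R) :
  (forall i, expect_le (f i) (r i)) ->
  expect_le (fun x => mean (fun i => f i x)) (mean r).
Proof.
by move=> fr; apply: expect_leZ; [rewrite invr_ge0 ler0n|exact: expect_le_sum].
Qed.

Let integral_sqr_shift (x : T -> R) (a : R) :
  mu.-integrable setT (EFin \o x) -> mu.-integrable setT (EFin \o (fun w => x w ^+ 2)) ->
  (\int[mu]_w ((a + x w) ^+ 2)%:E =
   (fine (\int[mu]_w (x w ^+ 2)%:E) + 2 * a * fine (\int[mu]_w (x w)%:E) + a ^+ 2)%:E)%E.
Proof.
move=> ix ix2.
have ic : mu.-integrable setT (cst (a ^+ 2)%:E) by exact: finite_measure_integrable_cst.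
have iZ : mu.-integrable setT (fun w => ((2 * a)%:E * (x w)%:E)%E) by exact: integrableZl.
have -> : (fun w => ((a + x w) ^+ 2)%:E) = (fun w => (x w ^+ 2)%:E +
    (2 * a)%:E * (x w)%:E + cst (a ^+ 2)%:E w)%E.
  by apply/funext => w /=; rewrite -EFinM -!EFinD; congr EFin; ring.
rewrite integralD//; last exact: integrableD.
rewrite integralD// integralZl// integral_cst//= probability_setT mule1.
rewrite EFinD EFinD (EFinM (2 * a)) !fineK//.
  exact: (integrable_fin_num _ ix).
exact: (integrable_fin_num _ ix2).
Qed.

(** Expansion of [|A + X|^2], entry by entry. The finite bound [s] makes every squared entry
    integrable, which allows the integral to be split. *)
Lemma expect_le_shift p q (X : T -> 'M[R]_(p, q)) (m A : 'M[R]_(p, q)) s :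
  has_mean mu X m -> expect_le (fun x => fronorm (X x) ^+ 2) s ->
  expect_le (fun x => fronorm (A + X x) ^+ 2) (s + 2 * frob A m + fronorm A ^+ 2).
Proof.
move=> [iX <-] [mX X0 Xs].
have mXij i j : measurable_fun setT (fun w => X w i j).
  by have /measurable_int/measurable_EFinP := iX i j.
have iX2 i j : mu.-integrable setT (EFin \o (fun w => X w i j ^+ 2)).
  apply/integrableP; split; first by apply/measurable_EFinP/measurable_funX.
  under eq_integral do rewrite /= ger0_norm ?sqr_ge0//.
  apply: le_lt_trans (ltry s); apply: le_trans Xs; apply: ge0_le_integral => //.
  - by move=> w _; rewrite lee_fin sqr_ge0.
  - by apply/measurable_EFinP/measurable_funX.
  - exact/measurable_EFinP.
  - by move=> w _; rewrite lee_fin; exact: sqr_fronorm_entry.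
have entry (Z : T -> 'M[R]_(p, q)) : (forall i j, measurable_fun setT (fun w => Z w i j)) ->
    (\int[mu]_w (fronorm (Z w) ^+ 2)%:E = \sum_i \sum_j \int[mu]_w (Z w i j ^+ 2)%:E)%E.
  move=> mZ; under eq_integral do rewrite sqr_fronormE -sumEFin.
  rewrite ge0_integral_sum//.
  - apply: eq_bigr => i _; under eq_integral do rewrite -sumEFin.
    rewrite ge0_integral_sum//.
    + by move=> j; apply/measurable_EFinP/measurable_funX.
    + by move=> j w _; rewrite lee_fin sqr_ge0.
  - move=> i; apply/measurable_EFinP; apply: measurable_sum => j.
    exact: measurable_funX.
  - by move=> i w _; rewrite lee_fin; apply: sumr_ge0 => j _; exact: sqr_ge0.
have mAX i j : measurable_fun setT (fun w => (A + X w) i j).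
  by under eq_fun do rewrite mxE; exact: measurable_funD.
split=> [|x|]; first exact: measurable_sqr_fronorm.
  exact: sqr_ge0.
rewrite entry//.
under eq_bigr => i _ do under eq_bigr => j _ do
  (under eq_integral do rewrite mxE; rewrite integral_sqr_shift//).
under eq_bigr do rewrite sumEFin.
rewrite sumEFin lee_fin.
move: Xs; rewrite entry//.
have fE i j : (\int[mu]_w (X w i j ^+ 2)%:E)%E = (fine (\int[mu]_w (X w i j ^+ 2)%:E))%:E.
  by rewrite fineK//; exact: integrable_fin_num (iX2 i j).
under eq_bigr => i _ do (under eq_bigr => j _ do rewrite fE; rewrite sumEFin).
rewrite sumEFin lee_fin => Xs.
under eq_bigr => i _ do rewrite !big_split /=.
rewrite !big_split /= -!sqr_fronormE lerD2r lerD//.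
rewrite /frob mulr_sumr; apply: ler_sum => i _; rewrite mulr_sumr.
by apply: ler_sum => j _; rewrite mxE unlock mulrA.
Qed.

(** [expect_le_shift] at [- m]: the terms [- 2 |m|^2] and [|m|^2] leave the gain [- |m|^2]. *)
Lemma expect_le_center p q (X : T -> 'M[R]_(p, q)) (m : 'M[R]_(p, q)) s :
  has_mean mu X m -> expect_le (fun x => fronorm (X x) ^+ 2) s ->
  expect_le (fun x => fronorm (X x - m) ^+ 2) (s - fronorm m ^+ 2).
Proof.
move=> Xm Xs; have := expect_le_shift (- m) Xm Xs.
rewrite frobNl fronormN -sqr_fronorm.
by under eq_fun do rewrite addrC; move/expect_leW; apply; lra.
Qed.

Lemma expect_le_ge0 f r : expect_le f r -> 0 <= r.
Proof.
move=> [mf f0]; rewrite -lee_fin; apply: le_trans.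
by apply: integral_ge0 => x _; rewrite lee_fin.
Qed.

(** Jensen's inequality, read off from the sign of the variance bound [s - |m|^2]. *)
Lemma sqr_fronorm_mean_le p q (X : T -> 'M[R]_(p, q)) (m : 'M[R]_(p, q)) s :
  has_mean mu X m -> expect_le (fun x => fronorm (X x) ^+ 2) s -> fronorm m ^+ 2 <= s.
Proof.
by move=> Xm /(expect_le_center Xm)/expect_le_ge0; rewrite subr_ge0.
Qed.

Lemma has_meanD p q (X Y : T -> 'M[R]_(p, q)) (a b : 'M[R]_(p, q)) :
  has_mean mu X a -> has_mean mu Y b -> has_mean mu (fun x => X x + Y x) (a + b).
Proof.
move=> [iX <-] [iY <-]; split=> [i j|].
  rewrite (_ : EFin \o _ = (fun x => ((X x i j)%:E + (Y x i j)%:E)%E)).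
    by apply: integrableD => //; [exact: iX|exact: iY].
  by apply/funext => x /=; rewrite mxE.
apply/matrixP => i j; rewrite !mxE unlock.
under eq_integral do rewrite mxE EFinD.
rewrite integralD//; [|exact: iX|exact: iY].
rewrite fineD//; first exact: integrable_fin_num (iX i j).
exact: integrable_fin_num (iY i j).
Qed.

Lemma has_meanZ p q c (X : T -> 'M[R]_(p, q)) (a : 'M[R]_(p, q)) :
  has_mean mu X a -> has_mean mu (fun x => c *: X x) (c *: a).
Proof.
move=> [iX <-]; split=> [i j|].
  rewrite (_ : EFin \o _ = (fun x => (c%:E * (X x i j)%:E)%E)).
    by apply: integrableZl => //; exact: iX.
  by apply/funext => x /=; rewrite mxE.
apply/matrixP => i j; rewrite !mxE unlock.
under eq_integral do rewrite mxE EFinM.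
rewrite integralZl//; last exact: iX.
by rewrite fineM//; exact: integrable_fin_num (iX i j).
Qed.

Lemma has_mean_cst p q (a : 'M[R]_(p, q)) : has_mean mu (fun=> a) a.
Proof.
split=> [i j|]; first exact: finite_measure_integrable_cst.
by apply/matrixP => i j; rewrite mxE expectation_cst.
Qed.

Lemma has_meanB p q (X Y : T -> 'M[R]_(p, q)) (a b : 'M[R]_(p, q)) :
  has_mean mu X a -> has_mean mu Y b -> has_mean mu (fun x => X x - Y x) (a - b).
Proof.
move=> Xa Yb; apply: has_meanD => //.
rewrite -scaleN1r (_ : (fun x => _) = (fun x => (-1) *: Y x)); first exact: has_meanZ.
by apply/funext => x; rewrite scaleN1r.
Qed.

Lemma has_mean_measurable p q (X : T -> 'M[R]_(p, q)) a :
  has_mean mu X a -> mxmeasurable X.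
Proof. by move=> [iX _] i j; have /measurable_int/measurable_EFinP := iX i j. Qed.

End ExpectLe.

Section Dominated.
Context (R : realType) (dT : measure_display) (T : measurableType dT).
Context (P : probability T R).

(** Relates two integrals without giving a value to either. This is the form for a single client,
    since numerical bounds are carried for means over the clients only. *)
Definition mean_dominated (f g : T -> R) := [/\ measurable_fun setT f,
  forall w, 0 <= f w & (\int[P]_w (f w)%:E <= \int[P]_w (g w)%:E)%E].

Lemma mean_dominated_expect_le f g r :
  mean_dominated f g -> expect_le P g r -> expect_le P f r.
Proof. by move=> [mf f0 fg] [_ _ gr]; split=> //; exact: le_trans fg gr. Qed.

Lemma mean_dominated_mean N (f g : 'I_N -> T -> R) r :
  (forall k, mean_dominated (f k) (g k)) ->
  (forall k, measurable_fun setT (g k)) -> (forall k w, 0 <= g k w) ->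
  expect_le P (fun w => mean (fun k => g k w)) r ->
  expect_le P (fun w => mean (fun k => f k w)) r.
Proof.
move=> fg mg g0 [_ _ gr].
have mf k : measurable_fun setT (f k) by case: (fg k).
have f0 k w : 0 <= f k w by case: (fg k).
split=> [|w|]; first by apply: measurable_funM => //; exact: measurable_sum.
  by rewrite mulr_ge0 ?invr_ge0 ?ler0n// sumr_ge0.
apply: le_trans gr.
have E (h : 'I_N -> T -> R) : (forall k, measurable_fun setT (h k)) ->
    (forall k w, 0 <= h k w) ->
    (\int[P]_w (mean (fun k => h k w))%:E = N%:R^-1%:E * \sum_k \int[P]_w (h k w)%:E)%E.
  move=> mh h0; under eq_integral do rewrite EFinM -sumEFin.
  rewrite ge0_integralZl_EFin//.
  - rewrite ge0_integral_sum//.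
    + by move=> k; exact/measurable_EFinP.
    + by move=> k w _; rewrite lee_fin.
  - by move=> w _; apply: sume_ge0 => k _; rewrite lee_fin.
  - by apply: emeasurable_sum => k; exact/measurable_EFinP.
rewrite !E// lee_wpmul2l ?lee_fin ?invr_ge0 ?ler0n//.
by apply: lee_sum => k _; case: (fg k).
Qed.

End Dominated.

Section FreshExpectation.
Context (R : realType) (dO : measure_display) (Omega : measurableType dO).
Context (P : probability Omega R) (G : set (set Omega)) (GO : G `<=` measurable).
Context (dS : measure_display) (S : measurableType dS) (mu : probability S R).
Context (X : {mfun Omega >-> S}) (fX : fresh P G mu X).

Lemma measurable_pastW (dZ : measure_display) (Z : measurableType dZ) (f : Omega -> Z) :
  @measurable_fun _ _ (g_sigma_algebraType G) Z setT f -> measurable_fun setT f.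
Proof. by move=> mf _ B mB; apply: (g_sigma_sub GO); exact: mf. Qed.

Lemma fresh_mean_dominated (phi : Omega -> S -> R) (psi : Omega -> R) :
  measurable_fun setT (fun z : g_sigma_algebraType G * S => phi z.1 z.2) ->
  (forall w, expect_le mu (phi w) (psi w)) -> measurable_fun setT psi ->
  mean_dominated P (fun w => phi w (X w)) psi.
Proof.
move=> mphi phipsi mpsi.
have phi0 w x : 0 <= phi w x by case: (phipsi w).
pose idG : Omega -> g_sigma_algebraType G := id.
have mid : measurable_fun setT idG.
  by move=> _ B mB; rewrite setTI; exact: (g_sigma_sub GO).
have mpair : measurable_fun setT (fun w : Omega => (idG w, X w)).
  by apply: (measurable_fun_pair mid).
pose Phi (z : g_sigma_algebraType G * S) := (phi z.1 z.2)%:E.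
have mPhi : measurable_fun setT Phi by exact/measurable_EFinP.
have Phi0 z : (0 <= Phi z)%E by rewrite lee_fin.
split=> //; first exact: (measurableT_comp mphi mpair).
rewrite (fresh_integral GO fX mPhi Phi0).
apply: ge0_le_integral => //.
- by move=> w _; apply: integral_ge0.
- apply: measurable_pastW.
  exact: (@measurable_fun_fubini_tonelli_F _ _ (g_sigma_algebraType G) S R mu Phi).
- exact/measurable_EFinP.
- by move=> w _; case: (phipsi w).
Qed.

End FreshExpectation.

(** A crude factor, the sharp one being [sqrt (p q)]; it only has to carry continuity from the max
    norm to [fronorm]. *)
Lemma fronorm_le_norm (R : realType) p q (A : 'M[R]_(p, q)) :
  fronorm A <= (p * q)%:R * `|A|.
Proof.
apply: fronorm_le; first by rewrite mulr_ge0.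
have E i j : A i j ^+ 2 <= `|A| ^+ 2.
  rewrite -[A i j ^+ 2]real_normK ?num_real// ler_pXn2r ?nnegrE//.
  by rewrite [leRHS]mx_normrE (le_trans _ (le_bigmax _ _ (i, j))).
rewrite sqr_fronormE exprMn; apply: (@le_trans _ _ (\sum_(i < p) \sum_(j < q) `|A| ^+ 2)).
  by apply: ler_sum => i _; apply: ler_sum.
rewrite !sumr_const !card_ord -mulrnA mulnC -[leLHS]mulr_natl.
rewrite ler_wpM2r ?sqr_ge0// -natrX ler_nat.
by case: (p * q)%N => // k; rewrite -[leqLHS]expn1 leq_pexp2l.
Qed.

Lemma continuous_fronorm_lipschitz (R : realType) p q r s
    (phi : 'M[R]_(p, q) -> 'M[R]_(r, s)) (L : R) i j :
  (forall A B, fronorm (phi A - phi B) <= L * fronorm (A - B)) ->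
  continuous (fun A => phi A i j).
Proof.
move=> lip A.
have FA : Filter (nbhs A) by exact: nbhs_filter.
apply/cvgrPdist_le => e e0.
(* The [+ 1] keeps [c] positive when [L], [p] or [q] vanishes. *)
pose c := `|L| * (p * q)%:R + 1.
have c0 : 0 < c by rewrite /c ltr_wpDl ?mulr_ge0.
have : \forall B \near A, `|A - B| < e / c.
  by apply/nbhs_normP; exists (e / c) => //=; rewrite divr_gt0.
apply: filterS => B AB.
have h1 : `|phi A i j - phi B i j| <= fronorm (phi A - phi B).
  rewrite -(@ler_pXn2r _ 2) ?nnegrE ?fronorm_ge0// real_normK ?num_real//.
  by have := sqr_fronorm_entry (phi A - phi B) i j; rewrite !mxE.
apply: (le_trans h1); apply: le_trans (lip A B) _.
apply: (@le_trans _ _ (`|L| * ((p * q)%:R * `|A - B|))).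
  apply: (@le_trans _ _ (`|L| * fronorm (A - B))).
    by rewrite ler_wpM2r ?fronorm_ge0// ler_norm.
  by rewrite ler_wpM2l// fronorm_le_norm.
rewrite mulrA; apply: (@le_trans _ _ (c * `|A - B|)).
  by rewrite ler_wpM2r// lerDl.
by rewrite -ler_pdivlMl// mulrC ltW.
Qed.

(** * Stochastic oracles and recursive momentum *)

Section Oracle.
Context (R : realType) (dS : measure_display) (S : measurableType dS).
Context (mu : probability S R) (p q r s : nat).
Context (Phi : 'M[R]_(p, q) -> S -> 'M[R]_(r, s)) (phi : 'M[R]_(p, q) -> 'M[R]_(r, s)).
Context (sigma L : R).

(** The common shape of the samples of [g], of its Jacobian and of the gradient of [f], so that one
    analysis serves [u], [H] and [v]. *)
Record oracle := Oracle {
  oracle_measurable : jointly_measurable Phi;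
  oracle_mean : forall A, has_mean mu (Phi A) (phi A);
  oracle_var : forall A, expect_le mu (fun x => fronorm (Phi A x - phi A) ^+ 2) (sigma ^+ 2);
  oracle_lip : forall A B, expect_le mu (fun x => fronorm (Phi A x - Phi B x) ^+ 2)
    (L ^+ 2 * fronorm (A - B) ^+ 2) }.

Hypotheses (oPhi : oracle) (L0 : 0 <= L).

(** Jensen, applied to the difference of the samples at two points. *)
Lemma oracle_mean_lipschitz A B : fronorm (phi A - phi B) <= L * fronorm (A - B).
Proof.
apply: fronorm_le; first by rewrite mulr_ge0 ?fronorm_ge0.
rewrite exprMn; apply: sqr_fronorm_mean_le (oracle_lip oPhi A B).
by apply: has_meanB; exact: oracle_mean.
Qed.

Lemma mxmeasurable_oracle_mean dY (Y : measurableType dY) (W : Y -> 'M[R]_(p, q)) :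
  mxmeasurable W -> mxmeasurable (fun y => phi (W y)).
Proof.
move=> mW i j.
apply: (measurable_caratheodory (Phi := fun A (_ : Y) => phi A i j) (X := id)) => //.
move=> _; apply: continuous_fronorm_lipschitz; exact: oracle_mean_lipschitz.
Qed.

Let has_mean_noise A : has_mean mu (fun x => Phi A x - phi A) 0.
Proof.
rewrite -(subrr (phi A)); apply: has_meanB; [exact: oracle_mean|exact: has_mean_cst].
Qed.

Let measurable_Phi A : mxmeasurable (Phi A).
Proof. exact: has_mean_measurable (oracle_mean oPhi A). Qed.

Lemma oracle_shift A Z :
  expect_le mu (fun x => fronorm (Z + (Phi A x - phi A)) ^+ 2)
    (fronorm Z ^+ 2 + sigma ^+ 2).
Proof.
have := expect_le_shift Z (has_mean_noise A) (oracle_var oPhi A).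
by rewrite frobC frob0l mulr0 addr0 addrC.
Qed.

Lemma storm_step (a : R) (A A' : 'M[R]_(p, q)) (U : 'M[R]_(r, s)) : 0 <= a <= 1 ->
  expect_le mu (fun x => fronorm (Phi A' x + (1 - a) *: (U - Phi A x) - phi A') ^+ 2)
    ((1 - a) ^+ 2 * fronorm (U - phi A) ^+ 2 + 2 * a ^+ 2 * sigma ^+ 2 +
     2 * L ^+ 2 * fronorm (A' - A) ^+ 2).
Proof.
move=> /andP[a0 a1].
(* The error splits into the deterministic (1 - a)(U - phi A) and the centred N. *)
pose D x := (Phi A' x - Phi A x) - (phi A' - phi A).
pose N x := a *: (Phi A' x - phi A') + (1 - a) *: D x.
have meanD' : has_mean mu (fun x => Phi A' x - Phi A x) (phi A' - phi A).
  by apply: has_meanB; exact: oracle_mean.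
have meanN : has_mean mu N 0.
  rewrite -[0](addr0 0) -[X in X + _](scaler0 _ a) -[X in _ + X](scaler0 _ (1 - a)).
  apply: has_meanD; apply: has_meanZ => //.
  by rewrite -(subrr (phi A' - phi A)); apply: has_meanB => //; exact: has_mean_cst.
have EN : expect_le mu (fun x => fronorm (N x) ^+ 2)
    (2 * (a ^+ 2 * sigma ^+ 2) + 2 * (L ^+ 2 * fronorm (A' - A) ^+ 2)).
  apply: (@expect_le_mono _ _ _ _ (fun x => 2 * (a ^+ 2 * fronorm (Phi A' x - phi A') ^+ 2)
     + 2 * fronorm (D x) ^+ 2)).
  - by apply: measurable_sqr_fronorm; exact: has_mean_measurable meanN.
  - move=> x; rewrite sqr_ge0/=; apply: le_trans (sqr_fronormD_le _ _) _.
    rewrite !sqr_fronormZ lerD2l ler_pM2l// ler_piMl ?sqr_ge0//.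
    by rewrite expr_le1//; lra.
  - apply: expect_leD; apply: expect_leZ => //.
      by apply: expect_leZ; [exact: sqr_ge0|exact: oracle_var].
    (* Centring the increment can only lower its second moment. *)
    apply: expect_leW (expect_le_center meanD' (oracle_lip oPhi A' A)) _.
    by rewrite gerBl sqr_ge0.
have := expect_le_shift ((1 - a) *: (U - phi A)) meanN EN.
rewrite frobC frob0l mulr0 addr0 sqr_fronormZ => H.
have <- : (fun x => fronorm ((1 - a) *: (U - phi A) + N x) ^+ 2) =
  (fun x => fronorm (Phi A' x + (1 - a) *: (U - Phi A x) - phi A') ^+ 2).
  apply/funext => x; congr (fronorm _ ^+ 2); rewrite /N /D.
  by apply/matrixP => i j; rewrite !mxE; ring.
by apply: expect_leW H _; lra.
Qed.

(** The movement of the estimator in one round matters because [u] is in turn the point at which [v]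
    is queried. It is [Phi A' - Phi A] plus [a] times the sum of the current error and the noise. *)
Lemma storm_drift (a : R) (A A' : 'M[R]_(p, q)) (U : 'M[R]_(r, s)) :
  expect_le mu (fun x => fronorm (Phi A' x + (1 - a) *: (U - Phi A x) - U) ^+ 2)
    (2 * L ^+ 2 * fronorm (A' - A) ^+ 2 + 2 * a ^+ 2 * sigma ^+ 2 +
     2 * a ^+ 2 * fronorm (U - phi A) ^+ 2).
Proof.
have := expect_leD (expect_leZ (ler0n _ 2) (oracle_lip oPhi A' A))
  (expect_leZ (ler0n _ 2) (expect_leZ (sqr_ge0 a) (oracle_shift A (phi A - U)))).
have -> : 2 * (L ^+ 2 * fronorm (A' - A) ^+ 2) + 2 * (a ^+ 2 *
   (fronorm (phi A - U) ^+ 2 + sigma ^+ 2)) =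
  2 * L ^+ 2 * fronorm (A' - A) ^+ 2 + 2 * a ^+ 2 * sigma ^+ 2 +
     2 * a ^+ 2 * fronorm (U - phi A) ^+ 2 by rewrite (fronormBC U); ring.
apply: expect_le_mono => [|x].
  apply: measurable_sqr_fronorm; apply: mxmeasurableB; last exact: mxmeasurable_cst.
  by apply: mxmeasurableD => //; apply/mxmeasurableZ/mxmeasurableB => //; exact: mxmeasurable_cst.
rewrite sqr_ge0/= -sqr_fronormZ.
have -> : Phi A' x + (1 - a) *: (U - Phi A x) - U =
  (Phi A' x - Phi A x) + a *: (phi A - U + (Phi A x - phi A)).
  by apply/matrixP => i j; rewrite !mxE; ring.
exact: sqr_fronormD_le.
Qed.

Context (dO : measure_display) (Omega : measurableType dO) (P : probability Omega R).

(* [g_sigma_algebraType G] has the carrier of [Omega] and only changes its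
   sigma-algebra, which type inference cannot see: it has to be given explicitly. *)
Definition adapted (G : set (set Omega)) k l (Z : Omega -> 'M[R]_(k, l)) :=
  @mxmeasurable R _ (g_sigma_algebraType G) k l Z.

Section Fresh.
Context (G : set (set Omega)) (GO : G `<=` measurable).
Context (X : {mfun Omega >-> S}) (fX : fresh P G mu X).
Context (A A' : Omega -> 'M[R]_(p, q)) (U : Omega -> 'M[R]_(r, s)).
Hypotheses (mA : adapted G A) (mA' : adapted G A') (mU : adapted G U).

Let mfst k l (Z : Omega -> 'M[R]_(k, l)) : adapted G Z ->
  mxmeasurable (fun z : g_sigma_algebraType G * S => Z z.1).
Proof. by move=> mZ; apply: (mxmeasurable_comp mZ); exact: measurable_fst. Qed.

Let mPhi (Z : Omega -> 'M[R]_(p, q)) : adapted G Z ->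
  mxmeasurable (fun z : g_sigma_algebraType G * S => Phi (Z z.1) z.2).
Proof.
move=> mZ; apply: (oracle_measurable oPhi); last exact: measurable_snd.
exact: mfst.
Qed.

Let mphi (Z : Omega -> 'M[R]_(p, q)) : adapted G Z -> adapted G (fun w => phi (Z w)).
Proof. exact: mxmeasurable_oracle_mean. Qed.

Let sqrW k l (Z : Omega -> 'M[R]_(k, l)) : adapted G Z ->
  measurable_fun setT (fun w => fronorm (Z w) ^+ 2).
Proof. by move=> mZ; apply: (measurable_pastW GO); exact: measurable_sqr_fronorm. Qed.

Let storm (a : R) w x := Phi (A' w) x + (1 - a) *: (U w - Phi (A w) x).

Let mstorm a : mxmeasurable (fun z : g_sigma_algebraType G * S => storm a z.1 z.2).
Proof.
apply: mxmeasurableD; first exact: mPhi.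
by apply/mxmeasurableZ/mxmeasurableB; [exact: mfst|exact: mPhi].
Qed.

Lemma fresh_storm_step (a : R) : 0 <= a <= 1 ->
  mean_dominated P (fun w => fronorm (storm a w (X w) - phi (A' w)) ^+ 2)
    (fun w => (1 - a) ^+ 2 * fronorm (U w - phi (A w)) ^+ 2 + 2 * a ^+ 2 * sigma ^+ 2 +
     2 * L ^+ 2 * fronorm (A' w - A w) ^+ 2).
Proof.
move=> a01.
apply: (fresh_mean_dominated GO fX (phi := fun w x => fronorm (storm a w x - phi (A' w)) ^+ 2)).
- apply: measurable_sqr_fronorm; apply: mxmeasurableB; first exact: mstorm.
  exact: (mfst (mphi mA')).
- by move=> w; exact: storm_step.
- apply: measurable_funD; last first.
    by apply: measurable_funM => //; apply: (sqrW (Z := fun w => A' w - A w)); exact: mxmeasurableB.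
  apply: measurable_funD => //; apply: measurable_funM => //.
  apply: (sqrW (Z := fun w => U w - phi (A w))).
  by apply: mxmeasurableB => //; exact: mphi.
Qed.

Lemma fresh_storm_drift (a : R) :
  mean_dominated P (fun w => fronorm (storm a w (X w) - U w) ^+ 2)
    (fun w => 2 * L ^+ 2 * fronorm (A' w - A w) ^+ 2 + 2 * a ^+ 2 * sigma ^+ 2 +
     2 * a ^+ 2 * fronorm (U w - phi (A w)) ^+ 2).
Proof.
apply: (fresh_mean_dominated GO fX (phi := fun w x => fronorm (storm a w x - U w) ^+ 2)).
- by apply: measurable_sqr_fronorm; apply: mxmeasurableB; [exact: mstorm|exact: mfst].
- by move=> w; exact: storm_drift.
- apply: measurable_funD; last first.
    apply: measurable_funM => //; apply: (sqrW (Z := fun w => U w - phi (A w))).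
    by apply: mxmeasurableB => //; exact: mphi.
  apply: measurable_funD => //; apply: measurable_funM => //.
  by apply: (sqrW (Z := fun w => A' w - A w)); exact: mxmeasurableB.
Qed.

(** The noise is centred once the past is frozen, so its cross term with the adapted [Z]
    vanishes. *)
Lemma fresh_shift (Z : Omega -> 'M[R]_(r, s)) v : adapted G Z ->
  expect_le P (fun w => fronorm (Z w) ^+ 2) v ->
  expect_le P (fun w => fronorm (Z w + (Phi (A w) (X w) - phi (A w))) ^+ 2) (v + sigma ^+ 2).
Proof.
move=> mZ EZ.
apply: (@mean_dominated_expect_le _ _ _ _ _ (fun w => fronorm (Z w) ^+ 2 + sigma ^+ 2)).
  apply: (fresh_mean_dominated GO fX
    (phi := fun w x => fronorm (Z w + (Phi (A w) x - phi (A w))) ^+ 2)).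
  - apply: measurable_sqr_fronorm; apply: mxmeasurableD; first exact: mfst.
    by apply: mxmeasurableB; [exact: mPhi|exact: (mfst (mphi mA))].
  - by move=> w; exact: oracle_shift.
  - by apply: measurable_funD => //; exact: sqrW.
by apply: expect_leD => //; apply: expect_le_cst; exact: sqr_ge0.
Qed.

Lemma fresh_oracle (f : 'M[R]_(r, s) -> R) v : 0 <= v ->
  (forall dY (Y : measurableType dY) (Z : Y -> 'M[R]_(r, s)),
    mxmeasurable Z -> measurable_fun setT (fun y => f (Z y))) ->
  (forall B, expect_le mu (fun x => f (Phi B x)) v) ->
  expect_le P (fun w => f (Phi (A w) (X w))) v.
Proof.
move=> v0 mf fv; apply: (mean_dominated_expect_le (g := fun=> v)); last exact: expect_le_cst.
apply: (fresh_mean_dominated GO fX (phi := fun w x => f (Phi (A w) x))) => //.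
by apply: mf; exact: mPhi.
Qed.

End Fresh.

Section Batch.
Context (I : eqType) (G : seq I -> set (set Omega)) (GO : forall l, G l `<=` measurable).
Context (X : I -> {mfun Omega >-> S}).
Hypothesis fX : forall i l, uniq (i :: l) -> fresh P (G l) mu (X i).
Hypothesis mX : forall i l, i \in l ->
  @measurable_fun _ _ (g_sigma_algebraType (G l)) S setT (X i).
Context (A : Omega -> 'M[R]_(p, q)) (mA : forall l, adapted (G l) A).

Let adapted_sum l l' : {subset l' <= l} ->
  adapted (G l) (fun w => \sum_(i <- l') (Phi (A w) (X i w) - phi (A w))).
Proof.
elim: l' => [|i l' IH] sub; rewrite /adapted.
  under eq_fun do rewrite big_nil; exact: mxmeasurable_cst.
under eq_fun do rewrite big_cons; apply: mxmeasurableD; last first.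
  by apply: IH => j jl'; apply: sub; rewrite inE jl' orbT.
apply: mxmeasurableB; last exact: mxmeasurable_oracle_mean (@mA l).
apply: (oracle_measurable oPhi); first exact: mA.
by apply: mX; apply: sub; rewrite mem_head.
Qed.

(** The batch is revealed one sample at a time: the samples in [l] belong to the past [G l], for
    which the next one is fresh, so variances add up. *)
Lemma batch_variance l : uniq l ->
  expect_le P (fun w => fronorm (\sum_(i <- l) (Phi (A w) (X i w) - phi (A w))) ^+ 2)
    ((size l)%:R * sigma ^+ 2).
Proof.
elim: l => [|i l IH] il.
  under eq_fun do rewrite big_nil fronorm0 expr0n; rewrite mul0r.
  exact: expect_le_cst.
under eq_fun do rewrite big_cons addrC.
rewrite /= -natr1 mulrDl mul1r.
apply: (fresh_shift (GO (l := l)) (fX il)); first exact: mA.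
  exact: adapted_sum.
by apply: IH; case/andP: il.
Qed.

End Batch.

Lemma batch_average_variance N (G : seq 'I_N -> set (set Omega))
    (X : 'I_N -> {mfun Omega >-> S}) (A : Omega -> 'M[R]_(p, q)) : (0 < N)%N ->
  (forall l, G l `<=` measurable) ->
  (forall i l, uniq (i :: l) -> fresh P (G l) mu (X i)) ->
  (forall i l, i \in l -> @measurable_fun _ _ (g_sigma_algebraType (G l)) S setT (X i)) ->
  (forall l, adapted (G l) A) ->
  expect_le P (fun w => fronorm (average (fun i => Phi (A w) (X i w)) - phi (A w)) ^+ 2)
    (sigma ^+ 2 / N%:R).
Proof.
move=> N0 GO fX mX mA.
have NR : N%:R != 0 :> R by rewrite pnatr_eq0 -lt0n.
have := batch_variance GO fX mX mA (enum_uniq 'I_N).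
rewrite size_enum_ord => /(expect_leZ (sqr_ge0 (N%:R^-1))).
have -> : N%:R^-1 ^+ 2 * (N%:R * sigma ^+ 2) = sigma ^+ 2 / N%:R by field.
congr (expect_le P _ _); apply/funext => w.
rewrite big_enum -sqr_fronormZ -[phi (A w) in RHS](average_cst N0).
by rewrite -averageB.
Qed.

End Oracle.

(** * Gradients and the descent lemma *)

Section Gradient.
Context (R : realType).

Lemma derive_gradient p q (f : 'M[R]_(p, q) -> R) A V :
  differentiable f A -> 'D_V f A = frob (gradient f A) V.
Proof.
move=> df; rewrite deriveE// {1}[V]matrix_sum_delta linear_sum.
apply: eq_bigr => i _; rewrite linear_sum; apply: eq_bigr => j _.
by rewrite linearZ /= mxE deriveE// mulrC.
Qed.

Lemma gradient_comp m n d (f : 'cV[R]_d -> R) (g : 'M[R]_(m, n) -> 'cV[R]_d) A :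
  differentiable g A -> differentiable f (g A) ->
  gradient (f \o g) A = jac g A *m kronI n (gradient f (g A)).
Proof.
move=> dg df; apply/matrixP => a j; rewrite mulmx_kronIE mxE.
have dfg : differentiable (f \o g) A by exact: differentiable_comp.
rewrite deriveE// diff_comp//= -deriveE// derive_gradient//.
apply: eq_bigr => l _; rewrite big_ord1; congr (_ * _).
rewrite !mxE mxtens_indexK /= -deriveE// derive_mx; last exact: diff_derivable.
by rewrite mxE.
Qed.

Lemma is_derive_line p q (f : 'M[R]_(p, q) -> R) A D (s : R) :
  differentiable f (s *: D + A) ->
  is_derive s 1 (fun s => f (s *: D + A)) (frob (gradient f (s *: D + A)) D).
Proof.
move=> df; have dD := @diff_derivable _ _ _ _ _ D df.
have E : (fun h : R => h^-1 *:
    (((fun s => f (s *: D + A)) \o shift s) (h *: (1 : R)) - f (s *: D + A))) =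
   (fun h : R => h^-1 *: ((f \o shift (s *: D + A)) (h *: D) - f (s *: D + A))).
  apply/funext => h /=; congr (_ *: (f _ - _)).
  by rewrite scalerDl /= [h *: (1 : R)]mulr1 addrA.
split; first by rewrite /derivable E.
by rewrite /derive E -derive_gradient.
Qed.

(** The mean value theorem along the segment, applied to [f] minus the quadratic majorant; by the
    Lipschitz bound the derivative of this difference is nonpositive on ]0, 1[. *)
Lemma descent_lemma p q (f : 'M[R]_(p, q) -> R) (L : R) A B :
  (forall C, differentiable f C) ->
  (forall C D, fronorm (gradient f C - gradient f D) <= L * fronorm (C - D)) ->
  f B <= f A + frob (gradient f A) (B - A) + L / 2 * fronorm (B - A) ^+ 2.
Proof.
move=> df lip; set D := B - A; set G := gradient f A.
pose h (s : R) := f (s *: D + A) - (frob G D * s + L / 2 * fronorm D ^+ 2 * s ^+ 2).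
pose dh (s : R) := frob (gradient f (s *: D + A)) D - (frob G D + L * fronorm D ^+ 2 * s).
have dhE (s : R) : is_derive s (1 : R) h (dh s).
  have H1 := is_derive_line (df (s *: D + A)).
  have H2 : is_derive s (1 : R) (fun s : R => frob G D * s + L / 2 * fronorm D ^+ 2 * s ^+ 2)
     (frob G D + L * fronorm D ^+ 2 * s).
    have Hid := @is_derive_id R R s 1.
    have H := is_deriveD (is_deriveZ (frob G D) Hid)
      (is_deriveZ (L / 2 * fronorm D ^+ 2) (is_deriveX 2 Hid)).
    have -> : (fun s : R => frob G D * s + L / 2 * fronorm D ^+ 2 * s ^+ 2) =
      (frob G D \*: (id : R -> R)) + ((L / 2 * fronorm D ^+ 2) \*: ((id : R -> R) ^+ 2)).
      by apply/funext => x; rewrite /GRing.add/= expr2.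
    apply: (is_derive_eq H); rewrite /GRing.scale/= expr1.
    by field.
  exact: is_deriveB.
have [c /[!in_itv]/= /andP[c0 c1] hc] : exists2 c, c \in `]0, 1[%R & h 1 - h 0 = dh c * (1 - 0).
  apply: MVT => //; apply: derivable_within_continuous => x _.
  by have [] := dhE x.
have : dh c <= 0.
  rewrite /dh opprD addrA -frobBl subr_le0.
  apply: le_trans (frob_le _ _) _.
  have := lip (c *: D + A) A; rewrite addrK fronormZ gtr0_norm// => H.
  apply: (@le_trans _ _ (L * (c * fronorm D) * fronorm D)).
    by rewrite ler_wpM2r ?fronorm_ge0.
  by rewrite le_eqVlt; apply/orP; left; apply/eqP; ring.
have : h 1 - h 0 = dh c by rewrite hc; ring.
rewrite /h scale1r scale0r add0r subrK.
by lra.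
Qed.

Lemma gradient_mean p q N (f : 'I_N -> 'M[R]_(p, q) -> R) A :
  (forall k, differentiable (f k) A) ->
  gradient (fun B => N%:R^-1 * \sum_(k < N) f k B) A = average (fun k => gradient (f k) A).
Proof.
move=> df; apply/matrixP => i j.
have dfk k : derivable (f k) A (delta_mx i j) by exact: diff_derivable.
have -> : (fun B => N%:R^-1 * \sum_(k < N) f k B) = N%:R^-1 *: (\sum_(k < N) f k).
  by apply/funext => B /=; rewrite fct_sumE.
rewrite mxE deriveZ; last exact: derivable_sum.
rewrite derive_sum// !mxE summxE; congr (_ * _).
by apply: eq_bigr => k _; rewrite mxE.
Qed.

Lemma differentiable_mean p q N (f : 'I_N -> 'M[R]_(p, q) -> R) A :
  (forall k, differentiable (f k) A) ->
  differentiable (fun B => N%:R^-1 * \sum_(k < N) f k B) A.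
Proof.
move=> df.
have -> : (fun B => N%:R^-1 * \sum_(k < N) f k B) = N%:R^-1 *: (\sum_(k < N) f k).
  by apply/funext => B /=; rewrite fct_sumE.
by apply: differentiableZ; exact: differentiable_sum.
Qed.

End Gradient.

(** * Sums along recursive inequalities *)

Lemma contraction_sum (R : realType) (a : R) (x y : nat -> R) T :
  (forall t, x t.+1 <= (1 - a) * x t + y t) ->
  a * (\sum_(t < T) x t) <= x 0%N - x T + \sum_(t < T) y t.
Proof.
move=> xy; elim: T => [|T IH]; first by rewrite !big_ord0 subrr mulr0 addr0.
by rewrite !big_ord_recr /= mulrDr; have := xy T; lra.
Qed.

(** Shifting the sum adds [a (x T - x 0)] to the left side of [contraction_sum]; the term [- x T] on
    the right absorbs this since [a <= 1]. *)
Lemma contraction_sumS (R : realType) (a : R) (x y : nat -> R) T :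
  0 < a <= 1 -> (forall t, 0 <= x t) ->
  (forall t, x t.+1 <= (1 - a) * x t + y t) ->
  \sum_(t < T) x t.+1 <= (x 0%N + \sum_(t < T) y t) / a.
Proof.
move=> /andP[a0 a1] x0 xy; rewrite ler_pdivlMr//.
have := contraction_sum T xy.
have : \sum_(t < T) x t + x T = x 0%N + \sum_(t < T) x t.+1.
  have := big_ord_recr T (fun i => x i : R) => <-.
  by rewrite big_ord_recl.
have := x0 0%N; have := x0 T; nra.
Qed.

Lemma sum_periodic_reset (R : realType) (tau : nat) (c : R) (x r : nat -> R) T :
  (0 < tau)%N -> 0 <= c -> (forall t, 0 <= x t) -> (forall t, 0 <= r t) ->
  (forall t, (tau %| t)%N -> x t = 0) -> (forall t, x t.+1 <= x t + c * r t) ->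
  \sum_(t < T) x t <= c * tau%:R * (\sum_(t < T) r t).
Proof.
move=> tau0 c0 x0 r0 xdvd xr.
(* Potential: the last value may recur in every round left until the next reset. *)
suff : \sum_(t < T) x t + (tau - T %% tau)%:R * x T <= c * tau%:R * (\sum_(t < T) r t).
  by apply: le_trans; rewrite lerDl mulr_ge0.
elim: T => [|T IH].
  by rewrite !big_ord0 xdvd ?dvdn0// !mulr0 addr0.
rewrite !big_ord_recr /= mulrDr.
have cr : 0 <= c * tau%:R * r T by rewrite !mulr_ge0.
have lt_mod : (T %% tau < tau)%N by rewrite ltn_mod.
have [dvd|ndvd] := boolP (tau %| T.+1)%N.
  rewrite (xdvd _ dvd) mulr0 addr0.
  have : x T <= (tau - T %% tau)%:R * x T by rewrite ler_peMl// ler1n subn_gt0.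
  by lra.
have modS : (T.+1 %% tau = (T %% tau).+1)%N by rewrite modnS (negbTE ndvd).
have lt_modS : ((T %% tau).+1 < tau)%N by rewrite -modS ltn_mod.
rewrite modS; set l := (T %% tau)%N in IH lt_mod lt_modS *.
have E : (tau - l)%:R = (tau - l.+1)%:R + 1 :> R by rewrite natr1 subnSK.
have le_tau : (tau - l.+1)%:R <= tau%:R :> R by rewrite ler_nat leq_subr.
have : (tau - l.+1)%:R * x T.+1 <= (tau - l.+1)%:R * (x T + c * r T).
  by rewrite ler_wpM2l// ler0n.
have : (tau - l.+1)%:R * (c * r T) <= tau%:R * (c * r T).
  by rewrite ler_wpM2r// mulr_ge0.
move: IH; rewrite E mulrDl mul1r mulrDr => IH h1 h2.
have -> : c * tau%:R * r T = tau%:R * (c * r T) by ring.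
by lra.
Qed.

(** Communication leaves the average unchanged, so averaged quantities follow a recursion that does
    not see [tau]. *)
Lemma average_sync (R : realType) K tau (V : lmodType R) t (x : 'I_K -> V) :
  (0 < K)%N -> average (sync tau t x) = average x.
Proof. by move=> K0; rewrite /sync; case: (tau %| t)%N => //; exact: average_cst. Qed.

(** * Deterministic analysis of the local steps *)

Section LocalSteps.
Context (R : realType) (K m n tau : nat) (eta rho L : R).
Hypotheses (K0 : (0 < K)%N) (tau0 : (0 < tau)%N) (eta0 : 0 < eta) (rho01 : 0 < rho < 1).
Hypothesis L0 : 0 <= L.
Context (F : 'M[R]_(m, n) -> R) (Fs : R).
Hypothesis F_diff : forall A, differentiable F A.
Hypothesis F_lip : forall A B, fronorm (gradient F A - gradient F B) <= L * fronorm (A - B).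
Hypothesis F_ge : forall A, Fs <= F A.
(** Everything in this section holds outcome by outcome. [G] stands for the products of [H] with
    [kronI n v], [O] for the polar factors. *)
Context (W M G O : 'I_K -> nat -> 'M[R]_(m, n)).
Hypothesis O_le : forall k t, fronorm (O k t) ^+ 2 <= n%:R.
Hypothesis O_polar : forall k t, fronorm (M k t) <= frob (M k t) (O k t).
Context (W0 : 'M[R]_(m, n)).
Hypothesis W_init : forall k, W k 0%N = W0.
Hypothesis W_step : forall k t, W k t.+1 = sync tau t.+1 (fun j => W j t - eta *: O j t) k.
Hypothesis M_init : forall k, M k 0%N = average (fun j => G j 0%N).
Hypothesis M_step : forall k t, M k t.+1 =
  sync tau t.+1 (fun j => (1 - rho) *: M j t + rho *: G j t.+1) k.

Let Wb t := average (fun k => W k t).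
Let Mb t := average (fun k => M k t).
Let Gb t := average (fun k => G k t).
Let Ob t := average (fun k => O k t).
Let sn : R := Num.sqrt n%:R.

Let sn0 : 0 <= sn. Proof. exact: sqrtr_ge0. Qed.
Let sn2 : sn ^+ 2 = n%:R. Proof. by rewrite sqr_sqrtr. Qed.

Let fronorm_O k t : fronorm (O k t) <= sn.
Proof. by apply: fronorm_le => //; rewrite sn2. Qed.

Let WbS t : Wb t.+1 = Wb t - eta *: Ob t.
Proof.
rewrite /Wb (_ : (fun k => W k t.+1) = sync tau t.+1 (fun j => W j t - eta *: O j t)).
  by rewrite average_sync// averageB averageZ.
by apply/funext => k; exact: W_step.
Qed.

Let MbS t : Mb t.+1 = (1 - rho) *: Mb t + rho *: Gb t.+1.
Proof.
rewrite /Mb (_ : (fun k => M k t.+1) =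
    sync tau t.+1 (fun j => (1 - rho) *: M j t + rho *: G j t.+1)).
  by rewrite average_sync// averageD !averageZ.
by apply/funext => k; exact: M_step.
Qed.

Let fronorm_Ob t : fronorm (Ob t) <= sn.
Proof.
apply: le_trans (fronorm_average _ _) _ => //.
by rewrite -[leRHS](mean_cst K0); apply: mean_le => // k; exact: fronorm_O.
Qed.

Let sqr_fronorm_Wb t : fronorm (Wb t.+1 - Wb t) ^+ 2 <= n%:R * eta ^+ 2.
Proof.
rewrite WbS addrC addKr fronormN sqr_fronormZ mulrC ler_wpM2r ?sqr_ge0// -sn2.
by rewrite ler_pXn2r ?nnegrE ?fronorm_ge0.
Qed.

Let fronorm_Wb t : fronorm (Wb t.+1 - Wb t) <= sn * eta.
Proof.
apply: fronorm_le; first by rewrite mulr_ge0 ?(ltW eta0).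
by rewrite exprMn sn2 sqr_fronorm_Wb.
Qed.

Hypothesis n0 : (0 < n)%N.

Let descent t : eta * fronorm (gradient F (Wb t)) <= F (Wb t) - F (Wb t.+1) +
  eta * (2 * sn * mean (fun k => fronorm (gradient F (Wb t) - M k t))) +
  L / 2 * (n%:R * eta ^+ 2).
Proof.
have := descent_lemma (Wb t) (Wb t.+1) F_diff F_lip.
set D := gradient F (Wb t).
have := sqr_fronorm_Wb t.
(* Exchanging [M] for the gradient [D] costs [|D - M|] in the norm and [sn |D - M|] in the inner
   product; [1 <= sn] merges both into [2 sn |D - M|]. *)
have sn1 : 1 <= sn by rewrite -sqrtr1 ler_wsqrtr// ler1n.
have : fronorm D - 2 * sn * mean (fun k => fronorm (D - M k t)) <= frob D (Ob t).
  rewrite frobC frob_average.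
  have -> : fronorm D - 2 * sn * mean (fun k => fronorm (D - M k t)) =
      mean (fun k => fronorm D + - (2 * sn) * fronorm (D - M k t)).
    by rewrite meanD meanZ mean_cst//; ring.
  apply: mean_le => // k; rewrite frobC.
  have -> : frob D (O k t) = frob (M k t) (O k t) - frob (M k t - D) (O k t).
    by rewrite frobBl; ring.
  have := O_polar k t; have := frob_le (M k t - D) (O k t).
  have : fronorm (M k t - D) * fronorm (O k t) <= fronorm (D - M k t) * sn.
    by rewrite fronormBC ler_wpM2l ?fronorm_ge0.
  have : fronorm (D - M k t) <= fronorm (D - M k t) * sn.
    by rewrite ler_peMr ?fronorm_ge0.
  have : fronorm D <= fronorm (D - M k t) + fronorm (M k t).
    by apply: le_trans (fronormD _ _); rewrite subrK.
  by lra.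
have -> : frob D (Wb t.+1 - Wb t) = - (eta * frob D (Ob t)).
  by rewrite WbS addrC addKr frobNr frobZr.
move=> h1 h2 h3.
have : eta * (fronorm D - 2 * sn * mean (fun k => fronorm (D - M k t))) <= eta * frob D (Ob t).
  by rewrite ler_pM2l.
have : L / 2 * fronorm (Wb t.+1 - Wb t) ^+ 2 <= L / 2 * (n%:R * eta ^+ 2).
  by rewrite ler_wpM2l// divr_ge0.
by rewrite mulrBr; lra.
Qed.

Lemma descent_sum T : eta * (\sum_(t < T) fronorm (gradient F (Wb t))) <= F W0 - Fs +
  eta * (2 * sn * \sum_(t < T) mean (fun k => fronorm (gradient F (Wb t) - M k t))) +
  T%:R * (L / 2 * (n%:R * eta ^+ 2)).
Proof.
have Wb0 : Wb 0 = W0.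
  by rewrite /Wb; under eq_fun do rewrite W_init; exact: average_cst.
suff : eta * (\sum_(t < T) fronorm (gradient F (Wb t))) <= F W0 - F (Wb T) +
  eta * (2 * sn * \sum_(t < T) mean (fun k => fronorm (gradient F (Wb t) - M k t))) +
  T%:R * (L / 2 * (n%:R * eta ^+ 2)) by have := F_ge (Wb T); lra.
elim: T => [|T IH]; first by rewrite !big_ord0 Wb0 !mulr0 mul0r; lra.
rewrite !big_ord_recr /= -[T.+1%:R]natr1.
by have := descent T; lra.
Qed.

(** The momentum error is split into that of the average, [e], and the disagreement, [e']. They are
    driven by [q] and [r], the same two quantities for [G]. *)
Let e t := fronorm (gradient F (Wb t) - Mb t).
Let e' t := mean (fun k => fronorm (M k t - Mb t)).
Let q t := fronorm (gradient F (Wb t) - Gb t).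
Let r t := mean (fun k => fronorm (G k t - Gb t)).

Let eS t : e t.+1 <= (1 - rho) * e t + (L * (sn * eta) + rho * q t.+1).
Proof.
have [/ltW r0 /ltW r1] := andP rho01.
have r1' : 0 <= 1 - rho by lra.
rewrite /e MbS.
have -> : gradient F (Wb t.+1) - ((1 - rho) *: Mb t + rho *: Gb t.+1) =
  (1 - rho) *: (gradient F (Wb t) - Mb t) +
  ((1 - rho) *: (gradient F (Wb t.+1) - gradient F (Wb t)) +
   rho *: (gradient F (Wb t.+1) - Gb t.+1)).
  by apply/matrixP => i j; rewrite !mxE; ring.
apply: le_trans (fronormD _ _) _; rewrite fronormZ ger0_norm// lerD2l.
apply: le_trans (fronormD _ _) _; rewrite !fronormZ !ger0_norm// lerD2r.
apply: (@le_trans _ _ (fronorm (gradient F (Wb t.+1) - gradient F (Wb t)))).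
  by rewrite ler_piMl ?fronorm_ge0//; lra.
apply: le_trans (F_lip _ _) _; rewrite ler_wpM2l//.
Qed.

(** Without communication the factor [1 - rho] is simply bounded by 1: the periodic reset controls
    the disagreement, at the price of the factor [rho tau]. *)
Let e'S t : e' t.+1 <= e' t + rho * r t.+1.
Proof.
have [/ltW r0 /ltW r1] := andP rho01.
have e'0 s : 0 <= e' s by apply: mean_ge0 => // k; exact: fronorm_ge0.
have r0' : 0 <= r t.+1 by apply: mean_ge0 => // k; exact: fronorm_ge0.
have [dvd|ndvd] := boolP (tau %| t.+1)%N.
  rewrite [e' t.+1](_ : _ = 0); first by rewrite addr_ge0// mulr_ge0.
  rewrite /e' -[RHS](mean_cst K0); congr mean; apply/funext => k.
  rewrite MbS M_step /sync dvd averageD !averageZ subrr; exact: fronorm0.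
rewrite /e' -meanZ -meanD; apply: mean_le => // k.
rewrite MbS M_step /sync (negbTE ndvd).
have -> : (1 - rho) *: M k t + rho *: G k t.+1 - ((1 - rho) *: Mb t + rho *: Gb t.+1) =
  (1 - rho) *: (M k t - Mb t) + rho *: (G k t.+1 - Gb t.+1).
  by apply/matrixP => i j; rewrite !mxE; ring.
apply: le_trans (fronormD _ _) _; rewrite !fronormZ !ger0_norm ?subr_ge0// lerD2r.
by rewrite ler_piMl ?fronorm_ge0//; lra.
Qed.

(** The sources appear at [t.+1] only: [G] at index 0 enters through [e 0], and [e'] starts at 0
    because the initial momenta agree. *)
Lemma momentum_error_sum T :
  \sum_(t < T) mean (fun k => fronorm (gradient F (Wb t) - M k t)) <=
  e 0 / rho + T%:R * (L * (sn * eta)) / rho +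
  \sum_(t < T) (q t.+1 + rho * tau%:R * r t.+1).
Proof.
have [r0 r1] := andP rho01.
have e0 t : 0 <= e t by exact: fronorm_ge0.
apply: (@le_trans _ _ (\sum_(t < T) e t + \sum_(t < T) e' t)).
  rewrite -big_split /=; apply: ler_sum => t _.
  rewrite -[e t](mean_cst K0) /e' -meanD; apply: mean_le => // k.
  rewrite (fronormBC (M k t)); apply: le_trans (fronormD _ _).
  by rewrite addrA subrK.
have -> : \sum_(t < T) (q t.+1 + rho * tau%:R * r t.+1) =
    \sum_(t < T) q t.+1 + rho * tau%:R * \sum_(t < T) r t.+1.
  by rewrite big_split mulr_sumr.
rewrite addrA; apply: lerD; last first.
  apply: (sum_periodic_reset (x := e') (r := fun t => r t.+1)) => //.
  - exact: ltW.
  - by move=> t; apply: mean_ge0 => // k; exact: fronorm_ge0.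
  - by move=> t; apply: mean_ge0 => // k; exact: fronorm_ge0.
  - case=> [_|t dvd]; rewrite /e' -[RHS](mean_cst K0); congr mean; apply/funext => k.
      rewrite /Mb; under eq_fun do rewrite M_init.
      by rewrite average_cst// M_init subrr fronorm0.
    by rewrite MbS M_step /sync dvd averageD !averageZ subrr fronorm0.
have := contraction_sum T eS; rewrite big_split sumr_const card_ord -[_ *+ T]mulr_natl /=.
rewrite -mulr_sumr => H.
rewrite -[leRHS](@mulfK _ rho) ?gt_eqF// ler_pdivlMr// mulrC.
apply: (le_trans H); have := e0 T.
rewrite !mulrDl !divfK ?gt_eqF//; lra.
Qed.

Lemma momentum_error_init : e 0 = fronorm (gradient F W0 - Gb 0).
Proof.
rewrite /e /Wb /Mb; under eq_fun do rewrite W_init.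
by rewrite average_cst//; under eq_fun do rewrite M_init; rewrite average_cst.
Qed.

(** [Z] is the last common iterate, and each local step moves a client by at most [sn eta]. The
    existential lets the induction change [Z] at a reset. *)
Lemma anchor t : exists Z, forall k, fronorm (W k t - Z) <= sn * eta * (t %% tau)%:R.
Proof.
elim: t => [|t [Z IH]].
  by exists W0 => k; rewrite W_init subrr fronorm0 mod0n mulr0.
have [dvd|ndvd] := boolP (tau %| t.+1)%N.
  exists (Wb t.+1) => k; rewrite (eqP dvd) mulr0.
  by rewrite WbS W_step /sync dvd averageB averageZ subrr fronorm0.
exists Z => k; rewrite W_step /sync (negbTE ndvd) modnS (negbTE ndvd) -natr1 mulrDr mulr1.
rewrite addrAC; apply: le_trans (fronormB _ _) _; apply: lerD => //.
by rewrite fronormZ gtr0_norm// mulrC ler_wpM2r// ltW.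
Qed.

Lemma consensus t :
  mean (fun k => fronorm (W k t - Wb t) ^+ 2) <= n%:R * eta ^+ 2 * (tau.-1%:R) ^+ 2.
Proof.
have [Z HZ] := anchor t.
apply: le_trans (sqr_fronorm_average_le K0 _ Z) _.
rewrite -[leRHS](mean_cst K0); apply: mean_le => // k.
rewrite -sn2 -!exprMn ler_pXn2r ?nnegrE ?fronorm_ge0//; last first.
  by rewrite !mulr_ge0 ?(ltW eta0).
apply: (le_trans (HZ k)); rewrite ler_wpM2l ?mulr_ge0 ?(ltW eta0)//.
by rewrite ler_nat -ltnS prednK// ltn_mod.
Qed.

(** A local step has squared length at most [n eta^2]. An averaging round also closes the distance
    to the average, which is where [(tau - 1)^2] comes from. *)
Definition drift_bound t : R :=
  n%:R * eta ^+ 2 * (1 + if (tau %| t.+1)%N then tau.-1%:R ^+ 2 else 0).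

Lemma local_drift t : mean (fun k => fronorm (W k t.+1 - W k t) ^+ 2) <= drift_bound t.
Proof.
rewrite /drift_bound; case: ifP => dvd; last first.
  rewrite addr0 mulr1 -[leRHS](mean_cst K0); apply: mean_le => // k.
  rewrite W_step /sync dvd addrC addKr fronormN sqr_fronormZ mulrC.
  by rewrite ler_wpM2r ?sqr_ge0 ?O_le.
rewrite mulrDr mulr1.
(* After averaging every client sits at [Wb t.+1]; the parallel axis identity then separates the
   consensus distance from the movement of the average. *)
have -> : mean (fun k => fronorm (W k t.+1 - W k t) ^+ 2) =
    mean (fun k => fronorm (W k t - Wb t.+1) ^+ 2).
  congr mean; apply/funext => k; rewrite fronormBC; congr (fronorm (_ - _) ^+ 2).
  by rewrite WbS W_step /sync dvd averageB averageZ.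
rewrite sqr_fronorm_sub_average// addrC fronormBC.
by apply: lerD; [exact: sqr_fronorm_Wb|exact: consensus].
Qed.

(** There are [T %/ tau] averaging rounds, and [(T %/ tau) (tau - 1)^2 <= T (tau - 1)]: spread over
    a period, the quadratic jumps cost a single factor [tau]. *)
Lemma drift_bound_sum T : \sum_(t < T) drift_bound t <= n%:R * eta ^+ 2 * tau%:R * T%:R.
Proof.
rewrite /drift_bound -mulr_sumr -[leRHS]mulrA ler_wpM2l ?mulr_ge0 ?(ltW eta0)//.
have E : \sum_(t < T) (1 + if (tau %| t.+1)%N then tau.-1%:R ^+ 2 else 0) =
   T%:R + (T %/ tau)%:R * tau.-1%:R ^+ 2 :> R.
  elim: T => [|T IH]; first by rewrite big_ord0 div0n mul0r addr0.
  rewrite big_ord_recr /= IH divnS// natrD -natr1 mulrDl.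
  by case: (tau %| T.+1)%N => /=; rewrite ?mul1r ?mul0r; ring.
have Et : tau%:R = tau.-1%:R + 1 :> R by rewrite natr1 prednK.
rewrite E [X in _ <= X * _]Et mulrDl mul1r addrC lerD2r expr2 mulrA mulrC.
rewrite ler_wpM2l// -natrM ler_nat.
apply: leq_trans (leq_trunc_div T tau); rewrite leq_mul2l leq_pred orbT//.
Qed.

End LocalSteps.

(** * Error and disagreement of the gradient estimates in one round *)

Section StepErrors.
Context (R : realType) (K m n : nat) (L c S het : R).
Hypothesis K0 : (0 < K)%N.
Context (D : 'I_K -> 'M[R]_(m, n) -> 'M[R]_(m, n)) (W G : 'I_K -> 'M[R]_(m, n)).
Context (s : 'I_K -> R).
Hypothesis D_lip : forall k A B, fronorm (D k A - D k B) <= L * fronorm (A - B).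
Hypothesis het_D : forall k j A, fronorm (D k A - D j A) ^+ 2 <= 2 * het.
Hypothesis G_err : forall k, fronorm (D k (W k) - G k) ^+ 2 <= 2 * s k.
Hypothesis Wc : mean (fun k => fronorm (W k - average W) ^+ 2) <= c.

Let Db := average (fun k => D k (average W)).

Let D_lip2 k :
  fronorm (D k (average W) - D k (W k)) ^+ 2 <= L ^+ 2 * fronorm (W k - average W) ^+ 2.
Proof.
have := D_lip k (average W) (W k); rewrite (fronormBC (average W)) => H.
have H0 : 0 <= L * fronorm (W k - average W) by apply: le_trans H; exact: fronorm_ge0.
by rewrite -exprMn ler_pXn2r ?nnegrE ?fronorm_ge0.
Qed.

Let D_lip_mean : mean (fun k => L ^+ 2 * fronorm (W k - average W) ^+ 2) <= L ^+ 2 * c.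
Proof. by rewrite meanZ ler_wpM2l ?sqr_ge0. Qed.

(** Splitting at [D k (W k)] gives [2 L^2 c] plus 4 times the mean of [s]; taking out the 4 leaves
    the [L^2 / 2] of the final constant. *)
Lemma sqr_average_error :
  fronorm (Db - average G) ^+ 2 <= 4 * (mean s + L ^+ 2 * c / 2).
Proof.
rewrite /Db -averageB; apply: le_trans (sqr_fronorm_average K0 _) _.
apply: (@le_trans _ _ (mean (fun k => 2 * (L ^+ 2 * fronorm (W k - average W) ^+ 2) + 4 * s k))).
  apply: mean_le => // k.
  have -> : D k (average W) - G k = (D k (average W) - D k (W k)) + (D k (W k) - G k).
    by rewrite addrA subrK.
  apply: le_trans (sqr_fronormD_le _ _) _.
  by have := D_lip2 k; have := G_err k; lra.
by rewrite meanD !meanZ; move: D_lip_mean; rewrite meanZ; lra.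
Qed.

(** The average of [G] is the best centre, so [Db] may replace it. The distance to [Db] has three
    parts, hence a factor 3, which the factors 2 of the hypotheses turn into 6. *)
Lemma sqr_disagreement :
  mean (fun k => fronorm (G k - average G)) ^+ 2 <= 6 * (mean s + L ^+ 2 * c / 2 + het).
Proof.
apply: le_trans (mean_sqr K0 _) _.
apply: le_trans (sqr_fronorm_average_le K0 _ Db) _.
apply: (@le_trans _ _ (mean (fun k => 3 * (L ^+ 2 * fronorm (W k - average W) ^+ 2) +
    (6 * s k + 6 * het)))).
  apply: mean_le => // k.
  have H1 : fronorm (D k (average W) - Db) ^+ 2 <= 2 * het.
    rewrite /Db -[D k _](average_cst K0) -averageB.
    apply: le_trans (sqr_fronorm_average K0 _) _.
    by rewrite -[leRHS](mean_cst K0); apply: mean_le => // j.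
  have := D_lip2 k; have := G_err k; move: H1.
  have -> : G k - Db = (D k (average W) - Db) - ((D k (average W) - D k (W k)) + (D k (W k) - G k)).
    by apply/matrixP => i j; rewrite !mxE; ring.
  set a := D k (average W) - Db; set x := _ - D k (W k); set y := _ - G k.
  (* These three squares sum exactly to [3 (|a|^2 + |x|^2 + |y|^2) - |a - (x + y)|^2]. *)
  have := sqr_ge0 (fronorm (a + x)); have := sqr_ge0 (fronorm (a + y)).
  have := sqr_ge0 (fronorm (x - y)).
  rewrite !(sqr_fronormB, sqr_fronormD) frobDr; lra.
by rewrite !meanD !meanZ mean_cst//; move: D_lip_mean; rewrite meanZ; lra.
Qed.

End StepErrors.

(** * Freshness of a draw with respect to a set of other draws *)

Section Sampling.
Context (R : realType) (K m n d : nat) (p : problem R K m n d) (b : nat).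
Context (dO : measure_display) (Omega : measurableType dO) (P : probability Omega R).
Context (xi : forall k : 'I_K, draw b -> {mfun Omega >-> Xi p k}).
Context (zeta : forall k : 'I_K, draw b -> {mfun Omega >-> Zeta p k}).
Hypothesis hsample : is_sampling P xi zeta.

Definition index := (('I_K * draw b) + ('I_K * draw b))%type.

(** Indexed by an arbitrary set of draws rather than by time: the initial batch is revealed sample
    by sample, and within a round the xi precede the zeta. *)
Definition history (D : set index) : set (set Omega) := past (sample_events xi zeta) D.

Let preimage_measurable (dS : measure_display) (S : measurableType dS) (X : {mfun Omega >-> S}) :
  preimage_set_system setT X measurable `<=` @measurable _ Omega.
Proof. by move=> _ [B mB <-]; exact: measurable_funP. Qed.

Let preimage_setT (dS : measure_display) (S : measurableType dS) (X : {mfun Omega >-> S}) :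
  preimage_set_system setT X measurable [set: Omega].
Proof. by exists setT => //; rewrite setTI preimage_setT. Qed.

Let preimage_setI (dS : measure_display) (S : measurableType dS) (X : {mfun Omega >-> S}) :
  setI_closed (preimage_set_system setT X measurable).
Proof.
move=> _ _ [B mB <-] [C mC <-]; exists (B `&` C); first exact: measurableI.
by rewrite !setTI preimage_setI.
Qed.

Lemma sample_events_measurable i : sample_events xi zeta i `<=` measurable.
Proof. by case: i => -[k a]; exact: preimage_measurable. Qed.

Lemma history_measurable D : history D `<=` measurable.
Proof. by apply: past_measurable; exact: sample_events_measurable. Qed.

Let history_independent (D : set index) i A B : ~ D i -> <<s history D >> A ->
  sample_events xi zeta i B -> P (A `&` B) = (P A * P B)%E.
Proof.
case: hsample => _ _ indep; apply: (past_independent indep).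
- exact: sample_events_measurable.
- by case=> -[k a]; exact: preimage_setT.
- by case=> -[k a]; exact: preimage_setI.
Qed.

Lemma fresh_xi (D : set index) k a : ~ D (inl (k, a)) -> fresh P (history D) (Dg p k) (xi k a).
Proof.
move=> Dk A B hA mB; case: hsample => dxi _ _; rewrite -(dxi k a B mB).
apply: history_independent Dk hA _; exists B => //; exact: setTI.
Qed.

Lemma fresh_zeta (D : set index) k a : ~ D (inr (k, a)) -> fresh P (history D) (Df p k) (zeta k a).
Proof.
move=> Dk A B hA mB; case: hsample => _ dzeta _; rewrite -(dzeta k a B mB).
apply: history_independent Dk hA _; exists B => //; exact: setTI.
Qed.

Lemma measurable_xi (D : set index) k a : D (inl (k, a)) ->
  @measurable_fun _ _ (g_sigma_algebraType (history D)) (Xi p k) setT (xi k a).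
Proof.
move=> Dk _ B mB; apply: sub_sigma_algebra; exists (inl (k, a)) => //.
by exists B.
Qed.

Lemma measurable_zeta (D : set index) k a : D (inr (k, a)) ->
  @measurable_fun _ _ (g_sigma_algebraType (history D)) (Zeta p k) setT (zeta k a).
Proof.
move=> Dk _ B mB; apply: sub_sigma_algebra; exists (inr (k, a)) => //.
by exists B.
Qed.

Lemma adaptedW (D D' : set index) r s (Z : Omega -> 'M[R]_(r, s)) :
  D `<=` D' -> adapted (history D) Z -> adapted (history D') Z.
Proof.
move=> DD' mZ i j _ B mB; have := mZ i j measurableT B mB.
by apply: sub_sigma_algebra2; exact: bigcup_subset.
Qed.

End Sampling.

Ltac nonneg := repeat first
  [ by [] | exact: sqr_ge0 | exact: fronorm_ge0 | apply: addr_ge0 | apply: mulr_ge0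
  | rewrite invr_ge0 ].

(** * One round of recursive momentum, averaged over the clients *)

Section ClientFamily.
Context (R : realType) (K : nat) (hK : (0 < K)%N) (p q r s : nat).
Context (dS : 'I_K -> measure_display) (S : forall k, measurableType (dS k)).
Context (mu : forall k, probability (S k) R).
Context (Phi : forall k, 'M[R]_(p, q) -> S k -> 'M[R]_(r, s))
  (phi : 'I_K -> 'M[R]_(p, q) -> 'M[R]_(r, s)) (sigma L : R).
Hypotheses (oPhi : forall k, oracle (mu k) (@Phi k) (phi k) sigma L) (L0 : 0 <= L).
Context (dO : measure_display) (Omega : measurableType dO) (P : probability Omega R).
Context (G : set (set Omega)) (GO : G `<=` measurable).
Context (X : forall k, {mfun Omega >-> S k}) (fX : forall k, fresh P G (mu k) (X k)).
Context (A A' : 'I_K -> Omega -> 'M[R]_(p, q)) (U : 'I_K -> Omega -> 'M[R]_(r, s)).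
Hypotheses (mA : forall k, adapted G (A k)) (mA' : forall k, adapted G (A' k))
  (mU : forall k, adapted G (U k)).
Context (a x drift : R).
Hypothesis Ux : expect_le P (fun w => mean (fun k => fronorm (U k w - phi k (A k w)) ^+ 2)) x.
Hypothesis A'A : expect_le P (fun w => mean (fun k => fronorm (A' k w - A k w) ^+ 2)) drift.

Let sqrW k l (Z : Omega -> 'M[R]_(k, l)) : adapted G Z ->
  measurable_fun setT (fun w => fronorm (Z w) ^+ 2).
Proof. by move=> mZ; apply: (measurable_pastW GO); exact: measurable_sqr_fronorm. Qed.

Let mU_err k : measurable_fun setT (fun w => fronorm (U k w - phi k (A k w)) ^+ 2).
Proof.
apply: (sqrW (Z := fun w => U k w - phi k (A k w))); apply: mxmeasurableB; first exact: mU.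
exact: (mxmeasurable_oracle_mean (oPhi k) L0 (@mA k)).
Qed.

Let mA_err k : measurable_fun setT (fun w => fronorm (A' k w - A k w) ^+ 2).
Proof.
by apply: (sqrW (Z := fun w => A' k w - A k w)); apply: mxmeasurableB; [exact: mA'|exact: mA].
Qed.

Lemma client_storm_step : 0 <= a <= 1 ->
  expect_le P (fun w => mean (fun k => fronorm (Phi (A' k w) (X k w) +
      (1 - a) *: (U k w - Phi (A k w) (X k w)) - phi k (A' k w)) ^+ 2))
    ((1 - a) ^+ 2 * x + (2 * a ^+ 2 * sigma ^+ 2 + 2 * L ^+ 2 * drift)).
Proof.
move=> a01.
have D k := fresh_storm_step (oPhi k) L0 GO (@fX k) (@mA k) (@mA' k) (@mU k) a01.
have H := mean_dominated_mean D; apply: H => [k|k w|].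
- apply: measurable_funD; first apply: measurable_funD => //.
    by apply: measurable_funM => //; exact: mU_err.
  by apply: measurable_funM => //; exact: mA_err.
- by nonneg.
have E w : mean (fun k => (1 - a) ^+ 2 * fronorm (U k w - phi k (A k w)) ^+ 2 +
    2 * a ^+ 2 * sigma ^+ 2 + 2 * L ^+ 2 * fronorm (A' k w - A k w) ^+ 2) =
  (1 - a) ^+ 2 * mean (fun k => fronorm (U k w - phi k (A k w)) ^+ 2) +
  (2 * a ^+ 2 * sigma ^+ 2 + 2 * L ^+ 2 * mean (fun k => fronorm (A' k w - A k w) ^+ 2)).
  by rewrite !meanD !meanZ mean_cst// addrA.
rewrite (funext E); apply: expect_leD; first by apply: expect_leZ => //; exact: sqr_ge0.
apply: expect_leD; first by apply: expect_le_cst; nonneg.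
by apply: expect_leZ => //; nonneg.
Qed.

Lemma client_storm_drift :
  expect_le P (fun w => mean (fun k => fronorm (Phi (A' k w) (X k w) +
      (1 - a) *: (U k w - Phi (A k w) (X k w)) - U k w) ^+ 2))
    (2 * L ^+ 2 * drift + 2 * a ^+ 2 * sigma ^+ 2 + 2 * a ^+ 2 * x).
Proof.
have D k := fresh_storm_drift (oPhi k) L0 GO (@fX k) (@mA k) (@mA' k) (@mU k) a.
have H := mean_dominated_mean D; apply: H => [k|k w|].
- apply: measurable_funD; first apply: measurable_funD => //.
    by apply: measurable_funM => //; exact: mA_err.
  by apply: measurable_funM => //; exact: mU_err.
- by nonneg.
have E w : mean (fun k => 2 * L ^+ 2 * fronorm (A' k w - A k w) ^+ 2 +
    2 * a ^+ 2 * sigma ^+ 2 + 2 * a ^+ 2 * fronorm (U k w - phi k (A k w)) ^+ 2) =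
  2 * L ^+ 2 * mean (fun k => fronorm (A' k w - A k w) ^+ 2) +
  2 * a ^+ 2 * sigma ^+ 2 + 2 * a ^+ 2 * mean (fun k => fronorm (U k w - phi k (A k w)) ^+ 2).
  by rewrite !meanD !meanZ mean_cst.
rewrite (funext E); apply: expect_leD; last first.
  by apply: expect_leZ => //; nonneg.
apply: expect_leD; last by apply: expect_le_cst; nonneg.
by apply: expect_leZ => //; nonneg.
Qed.

End ClientFamily.

(** The recursion of [client_storm_step] with equality, started at the variance of the batch mean;
    the factor [2 L^2] is part of [drift]. *)
Fixpoint storm_bound (R : realType) (a sigma : R) (b : nat) (drift : nat -> R) t : R :=
  if t is t'.+1 then (1 - a) ^+ 2 * storm_bound a sigma b drift t' +
    (2 * a ^+ 2 * sigma ^+ 2 + drift t')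
  else sigma ^+ 2 / b%:R.

Lemma storm_bound_ge0 (R : realType) (a sigma : R) b drift t :
  (forall t, 0 <= drift t) -> 0 <= storm_bound a sigma b drift t.
Proof.
move=> d0; by elim: t => [|t IH] /=; nonneg.
Qed.

Section StormBoundSum.
Context (R : realType) (a sigma : R) (b : nat) (drift : nat -> R) (T : nat).
Hypotheses (a01 : 0 < a < 1) (d0 : forall t, 0 <= drift t).
Let x := storm_bound a sigma b drift.
Let y t := 2 * a ^+ 2 * sigma ^+ 2 + drift t.

Let x_ge0 t : 0 <= x t. Proof. exact: storm_bound_ge0. Qed.

Let xy t : x t.+1 <= (1 - a) * x t + y t.
Proof.
have [a0 a1] := andP a01; rewrite /= lerD2r ler_wpM2r//.
by rewrite expr2 ler_piMl; lra.
Qed.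

Let sum_y : \sum_(t < T) y t = T%:R * (2 * a ^+ 2 * sigma ^+ 2) + \sum_(t < T) drift t.
Proof. by rewrite big_split sumr_const card_ord -[_ *+ T]mulr_natl. Qed.

Lemma storm_bound_sumS : \sum_(t < T) x t.+1 <=
  (sigma ^+ 2 / b%:R + (T%:R * (2 * a ^+ 2 * sigma ^+ 2) + \sum_(t < T) drift t)) / a.
Proof.
have [a0 /ltW a1] := andP a01.
by have := @contraction_sumS _ a x y T; rewrite sum_y a0 a1; apply.
Qed.

(** The unshifted sum serves the drift of [u] inside [df_bound], where the error of [u] enters at
    index [t]. *)
Lemma storm_bound_sum : \sum_(t < T) x t <=
  (sigma ^+ 2 / b%:R + (T%:R * (2 * a ^+ 2 * sigma ^+ 2) + \sum_(t < T) drift t)) / a.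
Proof.
have [a0 a1] := andP a01; rewrite ler_pdivlMr// mulrC.
have := contraction_sum T xy; rewrite sum_y => h; apply: le_trans h _.
by rewrite lerD2r gerBl.
Qed.

End StormBoundSum.

(** * The run of the algorithm *)

Section Run.
Context (R : realType) (K m n d : nat) (hK : (1 <= K)%N).
Context (p : problem R K m n d) (hp : well_posed p).
Context (eta alpha beta gamma rho : R) (tau b : nat) (Cf Cg : R) (W0 : 'M[R]_(m, n)).
Hypotheses (heta : 0 < eta) (halpha : 0 < alpha < 1) (hbeta : 0 < beta < 1)
  (hgamma : 0 < gamma < 1) (hrho : 0 < rho < 1)
  (htau : (1 <= tau)%N) (hb : (1 <= b)%N) (hCf : 0 < Cf) (hCg : 0 < Cg).
Context (sigma_g sigma_dg sigma_f : R).
Hypotheses (mean_g : forall k W, has_mean (Dg p k) (gs W) (gbar p k W))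
  (mean_dg : forall k W,
     has_mean (Dg p k) (fun x => jac (fun A => gs A x) W) (jac (gbar p k) W))
  (mean_df : forall k y,
     has_mean (Df p k) (fun z => gradient (fun y' => fs y' z) y)
       (gradient (fbar p k) y))
  (var_g : forall k W,
     ('E_(Dg p k)[fun x => (fronorm (gs W x - gbar p k W) ^+ 2)%R]
       <= (sigma_g ^+ 2)%:E)%E)
  (var_dg : forall k W,
     ('E_(Dg p k)[fun x =>
         (fronorm (jac (fun A => gs A x) W - jac (gbar p k) W) ^+ 2)%R]
       <= (sigma_dg ^+ 2)%:E)%E)
  (var_df : forall k y,
     ('E_(Df p k)[fun z =>
         (fronorm (gradient (fun y' => fs y' z) y - gradient (fbar p k) y)
           ^+ 2)%R]
       <= (sigma_f ^+ 2)%:E)%E).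
Context (dO : measure_display) (Omega : measurableType dO) (P : probability Omega R)
  (xi : forall k : 'I_K, draw b -> {mfun Omega >-> Xi p k})
  (zeta : forall k : 'I_K, draw b -> {mfun Omega >-> Zeta p k}).
Hypothesis hsample : is_sampling P xi zeta.
Hypotheses (bound_dg : forall k W,
     ('E_(Dg p k)[fun x => (fronorm (jac (fun A => gs A x) W) ^+ 2)%R]
       <= (Cg ^+ 2)%:E)%E)
  (bound_df : forall k y,
     ('E_(Df p k)[fun z => (fronorm (gradient (fun y' => fs y' z) y) ^+ 2)%R]
       <= (Cf ^+ 2)%:E)%E).
Context (Lg Lf : R).
Hypotheses (hLg : 0 <= Lg) (hLf : 0 <= Lf)
  (lip_g : forall k W1 W2,
     ('E_(Dg p k)[fun x => (fronorm (gs W1 x - gs W2 x) ^+ 2)%R]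
       <= (Cg ^+ 2 * fronorm (W1 - W2) ^+ 2)%:E)%E)
  (lip_dg : forall k W1 W2,
     ('E_(Dg p k)[fun x =>
         (fronorm (jac (fun A => gs A x) W1 - jac (fun A => gs A x) W2)
           ^+ 2)%R]
       <= (Lg ^+ 2 * fronorm (W1 - W2) ^+ 2)%:E)%E)
  (lip_df : forall k y1 y2,
     ('E_(Df p k)[fun z =>
         (fronorm (gradient (fun y => fs y z) y1
                   - gradient (fun y => fs y z) y2) ^+ 2)%R]
       <= (Lf ^+ 2 * fronorm (y1 - y2) ^+ 2)%:E)%E).
Context (W : 'I_K -> nat -> Omega -> 'M[R]_(m, n))
  (u v : 'I_K -> nat -> Omega -> 'cV[R]_d)
  (H : 'I_K -> nat -> Omega -> 'M[R]_(m, d * n))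
  (M : 'I_K -> nat -> Omega -> 'M[R]_(m, n)).
Hypothesis hrun : FedCoMuonVR eta alpha beta gamma rho tau Cf Cg W0 xi zeta W u v H M.

(** * The three oracles *)

Let expect_sqr (dS : measure_display) (S : measurableType dS) (mu : probability S R)
    r s (X : S -> 'M[R]_(r, s)) c : mxmeasurable X ->
  ('E_mu[fun x => (fronorm (X x) ^+ 2)%R] <= c%:E)%E ->
  expect_le mu (fun x => fronorm (X x) ^+ 2) c.
Proof.
rewrite unlock => mX Xc; split=> //; first exact: measurable_sqr_fronorm.
by move=> x; exact: sqr_ge0.
Qed.

Let Mg k A : mxmeasurable (fun x : Xi p k => gs A x).
Proof. exact: has_mean_measurable (mean_g k A). Qed.

Lemma oracle_g k : oracle (Dg p k) (fun A x => gs A x) (gbar p k) sigma_g Cg.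
Proof.
have [dg _ _ _ _] := hp.
split.
- by apply: differentiable_jointly_measurable => [A|x A]; [exact: Mg|exact: dg].
- exact: mean_g.
- by move=> A; apply: expect_sqr => //; apply: mxmeasurableB => //; exact: mxmeasurable_cst.
- by move=> A B; apply: expect_sqr => //; exact: mxmeasurableB.
Qed.

Let Mdg k A : mxmeasurable (fun x : Xi p k => jac (fun A => gs A x) A).
Proof. exact: has_mean_measurable (mean_dg k A). Qed.

Lemma oracle_dg k :
  oracle (Dg p k) (fun A x => jac (fun A => gs A x) A) (jac (gbar p k)) sigma_dg Lg.
Proof.
have [dg _ _ _ _] := hp.
split.
- by apply: jac_jointly_measurable => [A|x A]; [exact: Mg|exact: dg].
- exact: mean_dg.
- by move=> A; apply: expect_sqr => //; apply: mxmeasurableB => //; exact: mxmeasurable_cst.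
- by move=> A B; apply: expect_sqr => //; exact: mxmeasurableB.
Qed.

Let Mdf k y : mxmeasurable (fun z : Zeta p k => gradient (fun y => fs y z) y).
Proof. exact: has_mean_measurable (mean_df k y). Qed.

Lemma oracle_df k :
  oracle (Df p k) (fun y z => gradient (fun y => fs y z) y) (gradient (fbar p k)) sigma_f Lf.
Proof.
have [_ df fint _ _] := hp.
split.
- apply: gradient_jointly_measurable => [y|z y]; last exact: df.
  by have /measurable_int/measurable_EFinP := fint k y.
- exact: mean_df.
- by move=> A; apply: expect_sqr => //; apply: mxmeasurableB => //; exact: mxmeasurable_cst.
- by move=> A B; apply: expect_sqr => //; exact: mxmeasurableB.
Qed.

Lemma fronorm_dg_le k A : fronorm (jac (gbar p k) A) <= Cg.
Proof.
apply: fronorm_le; first exact: ltW.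
by apply: sqr_fronorm_mean_le (mean_dg k A) _; exact: expect_sqr.
Qed.

Lemma fronorm_df_le k y : fronorm (gradient (fbar p k) y) <= Cf.
Proof.
apply: fronorm_le; first exact: ltW.
by apply: sqr_fronorm_mean_le (mean_df k y) _; exact: expect_sqr.
Qed.

(** * The steps as functions of the state *)

Let O k t w := polar (M k t w).

Lemma svd_M k t w : exists r (U : 'M[R]_(m, r)) s V, is_compact_svd (M k t w) U s V.
Proof.
have [Wt [/(_ k) [r [U [s [V [svd _]]]]] _]] := step_W hrun t w.
by exists r, U, s, V.
Qed.

Lemma W_step k t w : W k t.+1 w = sync tau t.+1 (fun j => W j t w - eta *: O j t w) k.
Proof.
have [Wt [HWt ->]] := step_W hrun t w; congr sync; apply/funext => j.
by have [r [U [s [V [svd ->]]]]] := HWt j; rewrite /O (polar_svd svd).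
Qed.

Lemma sqr_fronorm_O k t w : fronorm (O k t w) ^+ 2 <= n%:R.
Proof.
have [r [U [s [V svd]]]] := svd_M k t w.
by rewrite /O (polar_svd svd); exact: sqr_fronorm_polar_factor svd.
Qed.

Lemma fronorm_M_le k t w : fronorm (M k t w) <= frob (M k t w) (O k t w).
Proof.
have [r [U [s [V svd]]]] := svd_M k t w.
by rewrite /O (polar_svd svd); exact: fronorm_le_frob_polar_factor svd.
Qed.

Let v_tilde k t w : 'cV[R]_d :=
  let df := gradient (fun y => fs y (zeta k (inr t) w)) in
  df (u k t.+1 w) + (1 - beta) *: (v k t w - df (u k t w)).

Let H_tilde k t w : 'M[R]_(m, d * n) :=
  let dg := jac (fun A => gs A (xi k (inr t) w)) in
  dg (W k t.+1 w) + (1 - gamma) *: (H k t w - dg (W k t w)).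

Lemma v_step k t w : v k t.+1 w = ball_proj Cf (v_tilde k t w).
Proof. by apply: ball_projE => //; exact: step_v hrun k t w. Qed.

Lemma H_step k t w : H k t.+1 w = ball_proj Cg (H_tilde k t w).
Proof. by apply: ball_projE => //; exact: step_H hrun k t w. Qed.

(* Indices drawn before round [t]; in round [t] the draws xi come first. *)
Definition before t : set (index K b) := [set i | match i with
  | inl (_, inl _) | inr (_, inl _) => True
  | inl (_, inr s) | inr (_, inr s) => (s < t)%N end].

Definition midway t : set (index K b) := [set i | match i with
  | inl (_, inl _) | inr (_, inl _) => True
  | inl (_, inr s) => (s <= t)%N
  | inr (_, inr s) => (s < t)%N end].

Let before_midway t : before t `<=` midway t.
Proof. by move=> [[k [j|s]]|[k [j|s]]] //=; exact: ltnW. Qed.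

Let midwayS t : midway t `<=` before t.+1.
Proof. by move=> [[k [j|s]]|[k [j|s]]] //=; exact: ltnW. Qed.

Let beforeS t : before t `<=` before t.+1.
Proof. exact: subset_trans (@before_midway t) (@midwayS t). Qed.

(** * Adaptedness of the iterates *)

Let hist t := history xi zeta (before t).
Let mid t := history xi zeta (midway t).

(** [u] at time 0 depends on these draws only, so the initial zeta are fresh when the gradient of
    [f] is sampled there. *)
Let initial_xi : set (index K b) := [set i | if i is inl (_, inl _) then True else False].

Let adapted_u0 k : adapted (history xi zeta initial_xi) (u k 0%N).
Proof.
rewrite /adapted (_ : u k 0%N = fun w => average (fun j => gs W0 (xi k (inl j) w))).
  apply: mxmeasurable_average => j.
  apply: (oracle_measurable (oracle_g k) (Y := g_sigma_algebraType (history xi zeta initial_xi))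
    (W := fun=> W0) (X := xi k (inl j))).
    exact: mxmeasurable_cst.
  exact: measurable_xi.
by apply/funext => w; exact: init_u hrun k w.
Qed.

Let adapted_state t k := [/\ adapted (hist t) (W k t), adapted (hist t) (u k t),
  adapted (hist t) (v k t), adapted (hist t) (H k t) & adapted (hist t) (M k t)].

Let adapted_G D k t : adapted (history xi zeta D) (H k t) -> adapted (history xi zeta D) (v k t) ->
  adapted (history xi zeta D) (fun w => H k t w *m kronI n (v k t w)).
Proof. by move=> mH mv; apply: mxmeasurable_mulmx => //; exact: mxmeasurable_kronI. Qed.

Let adapted_init k : adapted_state 0 k.
Proof.
have au j : adapted (hist 0) (u j 0%N).
  by apply: adaptedW (adapted_u0 j) => -[[k' [j'|s]]|[k' [j'|s]]].
have aH j : adapted (hist 0) (H j 0%N).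
  rewrite /adapted (_ : H j 0%N =
    fun w => average (fun i => jac (fun A => gs A (xi j (inl i) w)) W0)).
    apply: mxmeasurable_average => i.
    apply: (oracle_measurable (oracle_dg j) (Y := g_sigma_algebraType (hist 0))
      (W := fun=> W0) (X := xi j (inl i))).
      exact: mxmeasurable_cst.
    exact: measurable_xi.
  by apply/funext => w; exact: init_H hrun j w.
have av j : adapted (hist 0) (v j 0%N).
  rewrite /adapted (_ : v j 0%N = fun w => average (fun i =>
      gradient (fun y => fs y (zeta j (inl i) w)) (u j 0%N w))).
    apply: mxmeasurable_average => i.
    apply: (oracle_measurable (oracle_df j) (Y := g_sigma_algebraType (hist 0))
      (X := zeta j (inl i))); first exact: au.
    exact: measurable_zeta.
  by apply/funext => w; exact: init_v hrun j w.
split => //.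
  rewrite /adapted (_ : W k 0%N = fun=> W0); first exact: mxmeasurable_cst.
  by apply/funext => w; exact: init_W hrun k w.
rewrite /adapted (_ : M k 0%N = fun w => average (fun j => H j 0%N w *m kronI n (v j 0%N w))).
  by apply: mxmeasurable_average => j; exact: adapted_G.
by apply/funext => w; exact: init_M hrun k w.
Qed.

Let adapted_sync D t (X : 'I_K -> Omega -> 'M[R]_(m, n)) k :
  (forall j, adapted (history xi zeta D) (X j)) ->
  adapted (history xi zeta D) (fun w => sync tau t (fun j => X j w) k).
Proof.
move=> mX; rewrite /adapted /sync; case: (tau %| t)%N; last exact: mX.
exact: mxmeasurable_average.
Qed.

(** The new [W] uses no draw of round [t], so both points at which the xi of that round is evaluated
    are known beforehand. *)
Let adapted_WS t k : (forall j, adapted_state t j) -> adapted (hist t) (W k t.+1).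
Proof.
move=> st; rewrite (_ : W k t.+1 = fun w => sync tau t.+1 (fun j => W j t w - eta *: O j t w) k).
  apply: (@adapted_sync _ t.+1 (fun j w => W j t w - eta *: O j t w) k) => j.
  have [mW _ _ _ mM] := st j.
  apply: mxmeasurableB => //; apply: mxmeasurableZ; apply: mxmeasurable_polar => //.
  by move=> w; exact: svd_M.
by apply/funext => w; exact: W_step.
Qed.

(** The new [u] depends on the xi of round [t], and the zeta of that round is evaluated at it: the
    past of this zeta is therefore [mid t], not [hist t]. *)
Let adapted_uS t k : (forall j, adapted_state t j) -> adapted (mid t) (u k t.+1).
Proof.
move=> st; rewrite (_ : u k t.+1 = fun w => gs (W k t.+1 w) (xi k (inr t) w) +
      (1 - alpha) *: (u k t w - gs (W k t w) (xi k (inr t) w))).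
  have mWS := adaptedW (@before_midway t) (adapted_WS k st).
  have [/(adaptedW (@before_midway t)) mW /(adaptedW (@before_midway t)) mu _ _ _] := st k.
  have mx : @measurable_fun _ _ (g_sigma_algebraType (mid t)) (Xi p k) setT (xi k (inr t)).
    by apply: measurable_xi; exact: leqnn.
  have mgs := oracle_measurable (oracle_g k).
  apply: mxmeasurableD; first exact: mgs.
  by apply: mxmeasurableZ; apply: mxmeasurableB => //; exact: mgs.
by apply/funext => w; exact: step_u hrun k t w.
Qed.

Lemma adapted_run t k : adapted_state t k.
Proof.
elim: t k => [|t IH] k; first exact: adapted_init.
have aW j : adapted (hist t.+1) (W j t.+1) by apply: adaptedW (adapted_WS j IH); exact: beforeS.
have au j : adapted (hist t.+1) (u j t.+1) by apply: adaptedW (adapted_uS j IH); exact: midwayS.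
have S j : [/\ adapted (hist t.+1) (W j t), adapted (hist t.+1) (u j t),
    adapted (hist t.+1) (v j t), adapted (hist t.+1) (H j t) & adapted (hist t.+1) (M j t)].
  by have [h1 h2 h3 h4 h5] := IH j; split; apply: adaptedW (@beforeS t) _.
have av j : adapted (hist t.+1) (v j t.+1).
  rewrite (_ : v j t.+1 = fun w => ball_proj Cf (v_tilde j t w)); last first.
    by apply/funext => w; exact: v_step.
  have [_ mu mv _ _] := S j.
  have mz : @measurable_fun _ _ (g_sigma_algebraType (hist t.+1)) (Zeta p j) setT (zeta j (inr t)).
    by apply: measurable_zeta; exact: ltnSn.
  have mdf := oracle_measurable (oracle_df j).
  apply: mxmeasurable_ball_proj => //; rewrite /v_tilde /=; apply: mxmeasurableD.
    exact: (mdf _ _ _ _ (au j) mz).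
  by apply: mxmeasurableZ; apply: mxmeasurableB => //; exact: (mdf _ _ _ _ mu mz).
have aH j : adapted (hist t.+1) (H j t.+1).
  rewrite (_ : H j t.+1 = fun w => ball_proj Cg (H_tilde j t w)); last first.
    by apply/funext => w; exact: H_step.
  have [mW _ _ mH _] := S j.
  have mx : @measurable_fun _ _ (g_sigma_algebraType (hist t.+1)) (Xi p j) setT (xi j (inr t)).
    by apply: measurable_xi; exact: ltnSn.
  have mdg := oracle_measurable (oracle_dg j).
  apply: mxmeasurable_ball_proj => //; rewrite /H_tilde /=; apply: mxmeasurableD.
    exact: (mdg _ _ _ _ (aW j) mx).
  by apply: mxmeasurableZ; apply: mxmeasurableB => //; exact: (mdg _ _ _ _ mW mx).
split => //.
rewrite (_ : M k t.+1 = fun w => sync tau t.+1 (fun j => (1 - rho) *: M j t w +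
                   rho *: (H j t.+1 w *m kronI n (v j t.+1 w))) k); last first.
  by apply/funext => w; exact: step_M hrun k t w.
apply: (@adapted_sync _ t.+1 (fun j w => (1 - rho) *: M j t w +
                   rho *: (H j t.+1 w *m kronI n (v j t.+1 w))) k) => j.
have [_ _ _ _ mM] := S j.
by apply: mxmeasurableD; apply: mxmeasurableZ => //; exact: adapted_G.
Qed.

Let measurable_hist t r s (Z : Omega -> 'M[R]_(r, s)) : adapted (hist t) Z -> mxmeasurable Z.
Proof.
by move=> mZ i j; apply: (measurable_pastW _ (mZ i j)); exact: history_measurable.
Qed.

(** * Mean square errors of the estimators *)

Let drift t : R := drift_bound n tau eta t.

Let drift_ge0 t : 0 <= drift t.
Proof.
rewrite /drift /drift_bound; apply: mulr_ge0; first by nonneg.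
by apply: addr_ge0 => //; case: ifP => // _; exact: sqr_ge0.
Qed.

Let mean_measurable r s (Z : 'I_K -> Omega -> 'M[R]_(r, s)) :
  (forall k, mxmeasurable (Z k)) ->
  measurable_fun setT (fun w => mean (fun k => fronorm (Z k w) ^+ 2)).
Proof.
move=> mZ; apply: measurable_funM => //; apply: measurable_sum => k.
exact: measurable_sqr_fronorm.
Qed.

Let drift_expect t :
  expect_le P (fun w => mean (fun k => fronorm (W k t.+1 w - W k t w) ^+ 2)) (drift t).
Proof.
apply: (expect_le_mono (f := fun=> drift t)); last exact: expect_le_cst.
  apply: mean_measurable => k.
  apply: mxmeasurableB; last by case: (adapted_run t k) => /measurable_hist.
  by case: (adapted_run t.+1 k) => /measurable_hist.
move=> w; rewrite mean_ge0//=; last by move=> k; exact: sqr_ge0.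
apply: (@local_drift R K m n tau eta _ _ _ (fun k t => W k t w) (fun k t => O k t w) _ W0) => //.
- by move=> k t'; exact: sqr_fronorm_O.
- by move=> k; exact: init_W hrun k w.
- by move=> k t'; exact: W_step.
Qed.

Definition g_bound := storm_bound alpha sigma_g b (fun t => 2 * Cg ^+ 2 * drift t).

Definition dg_bound := storm_bound gamma sigma_dg b (fun t => 2 * Lg ^+ 2 * drift t).

(** The drift inserted here is the movement of [u] given by [client_storm_drift]. Through it the
    noise of [u] reaches [v], which is the origin of the terms mixing [alpha] and [beta]. *)
Definition df_bound := storm_bound beta sigma_f b (fun t => 2 * Lf ^+ 2 *
  (2 * Cg ^+ 2 * drift t + 2 * alpha ^+ 2 * sigma_g ^+ 2 + 2 * alpha ^+ 2 * g_bound t)).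

Let expect_mean_cst (f : 'I_K -> Omega -> R) c : (forall k, expect_le P (f k) c) ->
  expect_le P (fun w => mean (fun k => f k w)) c.
Proof. by move=> fc; have := expect_le_mean fc; rewrite mean_cst. Qed.

Let init_g_expect k :
  expect_le P (fun w => fronorm (u k 0%N w - gbar p k (W k 0%N w)) ^+ 2) (sigma_g ^+ 2 / b%:R).
Proof.
pose D (l : seq 'I_b) : set (index K b) :=
  [set i | if i is inl (k', inl j) then (k' == k) && (j \in l) else False].
have -> : (fun w => fronorm (u k 0%N w - gbar p k (W k 0%N w)) ^+ 2) = (fun w =>
    fronorm (average (fun i => gs W0 (xi k (inl i) w)) - gbar p k W0) ^+ 2).
  by apply/funext => w; rewrite (init_u hrun) (init_W hrun).
have B := batch_average_variance (oracle_g k) (ltW hCg)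
  (P := P) (G := fun l => history xi zeta (D l))
  (X := fun j => xi k (inl j)) (A := fun=> W0) hb.
apply: B.
- by move=> l; exact: history_measurable.
- by move=> i l /= /andP[il _]; apply: fresh_xi => //=; rewrite eqxx (negbTE il).
- by move=> i l il; apply: measurable_xi => /=; rewrite eqxx.
- by move=> l; exact: mxmeasurable_cst.
Qed.

Let init_dg_expect k :
  expect_le P (fun w => fronorm (H k 0%N w - jac (gbar p k) (W k 0%N w)) ^+ 2)
    (sigma_dg ^+ 2 / b%:R).
Proof.
pose D (l : seq 'I_b) : set (index K b) :=
  [set i | if i is inl (k', inl j) then (k' == k) && (j \in l) else False].
have -> : (fun w => fronorm (H k 0%N w - jac (gbar p k) (W k 0%N w)) ^+ 2) = (fun w =>
    fronorm (average (fun i => jac (fun A => gs A (xi k (inl i) w)) W0) - jac (gbar p k) W0) ^+ 2).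
  by apply/funext => w; rewrite (init_H hrun) (init_W hrun).
have B := batch_average_variance (oracle_dg k) hLg (P := P) (G := fun l => history xi zeta (D l))
  (X := fun j => xi k (inl j)) (A := fun=> W0) hb.
apply: B.
- by move=> l; exact: history_measurable.
- by move=> i l /= /andP[il _]; apply: fresh_xi => //=; rewrite eqxx (negbTE il).
- by move=> i l il; apply: measurable_xi => /=; rewrite eqxx.
- by move=> l; exact: mxmeasurable_cst.
Qed.

Let initial_zeta k (l : seq 'I_b) : set (index K b) :=
  [set i | match i with inl (_, inl _) => True | inr (k', inl j) => (k' == k) && (j \in l)
           | _ => False end].

Let init_df_expect k :
  expect_le P (fun w => fronorm (v k 0%N w - gradient (fbar p k) (u k 0%N w)) ^+ 2)
    (sigma_f ^+ 2 / b%:R).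
Proof.
have -> : (fun w => fronorm (v k 0%N w - gradient (fbar p k) (u k 0%N w)) ^+ 2) = (fun w =>
    fronorm (average (fun i => gradient (fun y => fs y (zeta k (inl i) w)) (u k 0%N w))
      - gradient (fbar p k) (u k 0%N w)) ^+ 2).
  by apply/funext => w; rewrite (init_v hrun).
have B := batch_average_variance (oracle_df k) hLf (P := P)
  (G := fun l => history xi zeta (initial_zeta k l))
  (X := fun j => zeta k (inl j)) (A := u k 0%N) hb.
apply: B.
- by move=> l; exact: history_measurable.
- by move=> i l /= /andP[il _]; apply: fresh_zeta => //=; rewrite eqxx (negbTE il).
- by move=> i l il; apply: measurable_zeta => /=; rewrite eqxx.
- move=> l; apply: adaptedW (adapted_u0 k) => -[[k' [j|t]]|[k' [j|t]]] //.
Qed.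

Let fresh_xi_round t k : fresh P (hist t) (Dg p k) (xi k (inr t)).
Proof. by apply: fresh_xi => //=; rewrite ltnn. Qed.

Let fresh_zeta_round t k : fresh P (mid t) (Df p k) (zeta k (inr t)).
Proof. by apply: fresh_zeta => //=; rewrite ltnn. Qed.

Let le01 (c : R) : 0 < c < 1 -> 0 <= c <= 1.
Proof. by move=> /andP[/ltW -> /ltW ->]. Qed.

Lemma g_expect t :
  expect_le P (fun w => mean (fun k => fronorm (u k t w - gbar p k (W k t w)) ^+ 2)) (g_bound t).
Proof.
elim: t => [|t IH]; first exact: expect_mean_cst.
have hO : hist t `<=` measurable by exact: history_measurable.
have aW k : adapted (hist t) (W k t) by case: (adapted_run t k).
have au k : adapted (hist t) (u k t) by case: (adapted_run t k).
have aWS k : adapted (hist t) (W k t.+1) by apply: adapted_WS => j; exact: adapted_run.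
have := client_storm_step hK oracle_g (ltW hCg) hO (@fresh_xi_round t) aW aWS au IH
  (drift_expect t) (le01 halpha).
congr expect_le; apply/funext => w; congr mean; apply/funext => k.
by rewrite (step_u hrun).
Qed.

Let u_drift t : expect_le P (fun w => mean (fun k => fronorm (u k t.+1 w - u k t w) ^+ 2))
  (2 * Cg ^+ 2 * drift t + 2 * alpha ^+ 2 * sigma_g ^+ 2 + 2 * alpha ^+ 2 * g_bound t).
Proof.
have hO : hist t `<=` measurable by exact: history_measurable.
have aW k : adapted (hist t) (W k t) by case: (adapted_run t k).
have au k : adapted (hist t) (u k t) by case: (adapted_run t k).
have aWS k : adapted (hist t) (W k t.+1) by apply: adapted_WS => j; exact: adapted_run.
have := client_storm_drift hK oracle_g (ltW hCg) hO (@fresh_xi_round t) aW aWS au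
  alpha (g_expect t) (drift_expect t).
congr expect_le; apply/funext => w; congr mean; apply/funext => k.
by rewrite (step_u hrun).
Qed.

Lemma dg_expect t :
  expect_le P (fun w => mean (fun k => fronorm (H k t w - jac (gbar p k) (W k t w)) ^+ 2))
    (dg_bound t).
Proof.
elim: t => [|t IH]; first exact: expect_mean_cst.
have hO : hist t `<=` measurable by exact: history_measurable.
have aW k : adapted (hist t) (W k t) by case: (adapted_run t k).
have aH k : adapted (hist t) (H k t) by case: (adapted_run t k).
have aWS k : adapted (hist t) (W k t.+1) by apply: adapted_WS => j; exact: adapted_run.
apply: expect_le_mono (client_storm_step hK oracle_dg hLg hO (@fresh_xi_round t) aW aWS aH IH
  (drift_expect t) (le01 hgamma)) => [|w].
  apply: mean_measurable => k; apply: mxmeasurableB.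
    by case: (adapted_run t.+1 k) => _ _ _ /measurable_hist.
  apply: (mxmeasurable_oracle_mean (oracle_dg k) hLg).
  by case: (adapted_run t.+1 k) => /measurable_hist.
rewrite mean_ge0//=; last by move=> k; exact: sqr_ge0.
apply: mean_le => // k; rewrite H_step; apply: ball_proj_nonexpansive => //.
exact: fronorm_dg_le.
Qed.

Lemma df_expect t :
  expect_le P (fun w => mean (fun k => fronorm (v k t w - gradient (fbar p k) (u k t w)) ^+ 2))
    (df_bound t).
Proof.
elim: t => [|t IH]; first exact: expect_mean_cst.
have hO : mid t `<=` measurable by exact: history_measurable.
have au k : adapted (mid t) (u k t).
  by apply: adaptedW (@before_midway t) _; case: (adapted_run t k).
have av k : adapted (mid t) (v k t).
  by apply: adaptedW (@before_midway t) _; case: (adapted_run t k).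
have auS k : adapted (mid t) (u k t.+1) by apply: adapted_uS => j; exact: adapted_run.
apply: expect_le_mono (client_storm_step hK oracle_df hLf hO (@fresh_zeta_round t) au auS av IH
  (u_drift t) (le01 hbeta)) => [|w].
  apply: mean_measurable => k; apply: mxmeasurableB.
    by case: (adapted_run t.+1 k) => _ _ /measurable_hist.
  apply: (mxmeasurable_oracle_mean (oracle_df k) hLf).
  by case: (adapted_run t.+1 k) => _ /measurable_hist.
rewrite mean_ge0//=; last by move=> k; exact: sqr_ge0.
apply: mean_le => // k; rewrite v_step; apply: ball_proj_nonexpansive => //.
exact: fronorm_df_le.
Qed.

(** * Errors of the estimated gradients along one outcome *)

Let LF := Cf * Lg + Cg ^+ 2 * Lf.

Let LF0 : 0 <= LF.
Proof. by rewrite /LF addr_ge0// mulr_ge0// ?(ltW hCf)// sqr_ge0. Qed.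

Let D k := gradient (Fk p k).

Let differentiable_Fk k A : differentiable (Fk p k) A.
Proof. by have [_ _ _ dg df] := hp; exact: (differentiable_comp (f := gbar p k)). Qed.

Let DE k A : D k A = jac (gbar p k) A *m kronI n (gradient (fbar p k) (gbar p k A)).
Proof. by have [_ _ _ dg df] := hp; rewrite -gradient_comp. Qed.

(** The mixed product inserted pairs [J'] with [y], so bounds are asked of these two; in [G_err]
    they are the projected [H] and the exact gradient. *)
Let mulmx_kronI_sub r (J J' : 'M[R]_(r, d * n)) (y y' : 'cV[R]_d) (c e : R) :
  fronorm y <= c -> fronorm J' <= e ->
  fronorm (J *m kronI n y - J' *m kronI n y') <=
  c * fronorm (J - J') + e * fronorm (y - y').
Proof.
move=> yc Je.
have -> : J *m kronI n y - J' *m kronI n y' =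
    (J - J') *m kronI n y + J' *m kronI n (y - y').
  by rewrite mulmxBl kronIB mulmxBr addrA subrK.
apply: le_trans (fronormD _ _) _; apply: lerD; apply: le_trans (fronorm_mulmx_kronI _ _) _.
  by rewrite mulrC ler_wpM2r// fronorm_ge0.
by rewrite ler_wpM2r// fronorm_ge0.
Qed.

Let D_lip k A B : fronorm (D k A - D k B) <= LF * fronorm (A - B).
Proof.
rewrite !DE; apply: le_trans (mulmx_kronI_sub _ _ (fronorm_df_le _ _) (fronorm_dg_le _ _)) _.
have h1 := oracle_mean_lipschitz (oracle_dg k) hLg A B.
have h2 := oracle_mean_lipschitz (oracle_g k) (ltW hCg) A B.
have h3 := oracle_mean_lipschitz (oracle_df k) hLf (gbar p k A) (gbar p k B).
have h4 : fronorm (gradient (fbar p k) (gbar p k A) - gradient (fbar p k) (gbar p k B)) <=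
    Lf * (Cg * fronorm (A - B)) by apply: le_trans h3 _; rewrite ler_wpM2l.
have -> : LF * fronorm (A - B) =
    Cf * (Lg * fronorm (A - B)) + Cg * (Lf * (Cg * fronorm (A - B))) by rewrite /LF; ring.
by apply: lerD; rewrite ler_wpM2l// ltW.
Qed.

(** Two uses of [(a + b)^2 <= 2 a^2 + 2 b^2]. With a common 2 taken out, the Jacobian part has
    weight 1 and both parts of the gradient of [f] have weight 2. *)
Let sqr_le_two_level (N x y z t : R) : 0 <= N -> N <= x + y * (z + t) ->
  N ^+ 2 <= 2 * (x ^+ 2 + 2 * y ^+ 2 * z ^+ 2 + 2 * y ^+ 2 * t ^+ 2).
Proof.
move=> N0 Nle; apply: (@le_trans _ _ ((x + y * (z + t)) ^+ 2)).
  by rewrite ler_pXn2r// nnegrE// (le_trans N0).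
rewrite -subr_ge0.
have -> : 2 * (x ^+ 2 + 2 * y ^+ 2 * z ^+ 2 + 2 * y ^+ 2 * t ^+ 2) - (x + y * (z + t)) ^+ 2 =
  (x - y * (z + t)) ^+ 2 + 2 * (y * (z - t)) ^+ 2 by ring.
by rewrite addr_ge0 ?sqr_ge0// mulr_ge0 ?sqr_ge0.
Qed.

Context (Delta_g Delta_dg Delta_f : R).
Hypotheses (hDelta_g : 0 <= Delta_g) (hDelta_dg : 0 <= Delta_dg) (hDelta_f : 0 <= Delta_f)
  (het_df : forall k j y,
     fronorm (gradient (fbar p k) y - gradient (fbar p j) y) <= Delta_f)
  (het_dg : forall k j W,
     fronorm (jac (gbar p k) W - jac (gbar p j) W) <= Delta_dg)
  (het_g : forall k j W, fronorm (gbar p k W - gbar p j W) <= Delta_g).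

Let het := Cf ^+ 2 * Delta_dg ^+ 2 + 2 * Cg ^+ 2 * Delta_f ^+ 2
  + 2 * Cg ^+ 2 * Lf ^+ 2 * Delta_g ^+ 2.

Let het_D k j A : fronorm (D k A - D j A) ^+ 2 <= 2 * het.
Proof.
have -> : het = (Cf * Delta_dg) ^+ 2 + 2 * Cg ^+ 2 * Delta_f ^+ 2 +
  2 * Cg ^+ 2 * (Lf * Delta_g) ^+ 2 by rewrite /het; ring.
apply: sqr_le_two_level; first exact: fronorm_ge0.
rewrite !DE; apply: le_trans (mulmx_kronI_sub _ _ (fronorm_df_le _ _) (fronorm_dg_le _ _)) _.
apply: lerD; first by rewrite ler_wpM2l// ltW.
rewrite ler_wpM2l ?(ltW hCg)//.
rewrite -(subrK (gradient (fbar p k) (gbar p j A)) (gradient (fbar p k) (gbar p k A))) -addrA.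
apply: le_trans (fronormD _ _) _; rewrite [leRHS]addrC; apply: lerD => //.
apply: le_trans (oracle_mean_lipschitz (oracle_df k) hLf _ _) _.
by rewrite ler_wpM2l.
Qed.

Let G k t w := H k t w *m kronI n (v k t w).

Let err k t w := Cf ^+ 2 * fronorm (H k t w - jac (gbar p k) (W k t w)) ^+ 2 +
  2 * Cg ^+ 2 * fronorm (v k t w - gradient (fbar p k) (u k t w)) ^+ 2 +
  2 * Cg ^+ 2 * Lf ^+ 2 * fronorm (u k t w - gbar p k (W k t w)) ^+ 2.

Let G_err k t w : fronorm (D k (W k t.+1 w) - G k t.+1 w) ^+ 2 <= 2 * err k t.+1 w.
Proof.
rewrite /err.
set h := fronorm (H _ _ _ - _); set c := fronorm (v _ _ _ - _); set a := fronorm (u _ _ _ - _).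
have -> : Cf ^+ 2 * h ^+ 2 + 2 * Cg ^+ 2 * c ^+ 2 + 2 * Cg ^+ 2 * Lf ^+ 2 * a ^+ 2 =
  (Cf * h) ^+ 2 + 2 * Cg ^+ 2 * c ^+ 2 + 2 * Cg ^+ 2 * (Lf * a) ^+ 2 by ring.
apply: sqr_le_two_level; first exact: fronorm_ge0.
(* This comes from the projection, hence the index [t.+1]: for the initial batch mean only the
   second moment is bounded. *)
have HC : fronorm (H k t.+1 w) <= Cg by rewrite H_step; exact: ball_proj_le.
rewrite DE; apply: le_trans (mulmx_kronI_sub _ _ (fronorm_df_le _ _) HC) _.
apply: lerD; first by rewrite fronormBC.
rewrite ler_wpM2l ?(ltW hCg)//.
rewrite -(subrK (gradient (fbar p k) (u k t.+1 w)) (gradient (fbar p k) (gbar p k _))) -addrA.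
apply: le_trans (fronormD _ _) _; rewrite [leRHS]addrC; apply: lerD; last by rewrite fronormBC.
apply: le_trans (oracle_mean_lipschitz (oracle_df k) hLf _ _) _.
by rewrite fronormBC.
Qed.

Let differentiable_F A : differentiable (Fobj p) A.
Proof. by apply: (differentiable_mean (f := Fk p)) => k; exact: differentiable_Fk. Qed.

Let gradient_F A : gradient (Fobj p) A = average (fun k => D k A).
Proof. by apply: (gradient_mean (f := Fk p)) => k; exact: differentiable_Fk. Qed.

Let F_lip A B : fronorm (gradient (Fobj p) A - gradient (Fobj p) B) <= LF * fronorm (A - B).
Proof.
rewrite !gradient_F -averageB; apply: le_trans (fronorm_average _ _) _ => //.
by rewrite -[leRHS](mean_cst hK); apply: mean_le => // k; exact: D_lip.
Qed.

Let fronorm_gradient_F A : fronorm (gradient (Fobj p) A) <= Cg * Cf.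
Proof.
rewrite gradient_F; apply: le_trans (fronorm_average _ _) _ => //.
rewrite -[leRHS](mean_cst hK); apply: mean_le => // k.
rewrite DE; apply: le_trans (fronorm_mulmx_kronI _ _) _.
by apply: ler_pM; rewrite ?fronorm_ge0 ?fronorm_df_le ?fronorm_dg_le.
Qed.

Let Wb t w := average (fun k => W k t w).
Let cons : R := LF ^+ 2 * (n%:R * eta ^+ 2 * tau%:R ^+ 2) / 2.
Let S t w := mean (fun k => err k t w).
Let e0 w := fronorm (gradient (Fobj p) W0 - average (fun k => G k 0%N w)).

Let consensus_run t w :
  mean (fun k => fronorm (W k t w - Wb t w) ^+ 2) <= n%:R * eta ^+ 2 * tau%:R ^+ 2.
Proof.
have := @consensus R K m n tau eta hK htau heta (fun k t => W k t w) (fun k t => O k t w)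
  (fun k t => sqr_fronorm_O k t w) W0 (fun k => init_W hrun k w) (fun k t => W_step k t w) t.
move/le_trans; apply; rewrite ler_wpM2l ?mulr_ge0 ?(ltW heta)//.
by rewrite ler_pXn2r ?nnegrE// ler_nat leq_pred.
Qed.

Let aggregate_error t w :
  fronorm (gradient (Fobj p) (Wb t.+1 w) - average (fun k => G k t.+1 w)) ^+ 2 <=
  4 * (S t.+1 w + cons).
Proof.
rewrite gradient_F; apply: (sqr_average_error hK (D := D) (W := fun k => W k t.+1 w) D_lip).
  by move=> k; exact: G_err.
exact: consensus_run.
Qed.

Let disagreement t w :
  mean (fun k => fronorm (G k t.+1 w - average (fun j => G j t.+1 w))) ^+ 2 <=
  6 * (S t.+1 w + cons + het).
Proof.
apply: (sqr_disagreement hK (D := D) (W := fun k => W k t.+1 w) D_lip het_D).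
  by move=> k; exact: G_err.
exact: consensus_run.
Qed.

Let amgm (q x B : R) : 0 < B -> 0 <= x -> q ^+ 2 <= 4 * x -> q <= x / B + B.
Proof.
move=> B0 x0 qx; have y0 : 0 <= x / B + B by rewrite addr_ge0 ?divr_ge0 ?(ltW B0).
rewrite leNgt; apply/negP => yq.
have : (x / B + B) ^+ 2 < q ^+ 2 by rewrite ltr_pXn2r ?nnegrE// (le_trans y0 (ltW yq)).
rewrite ltNge (le_trans qx)// -subr_ge0.
have -> : (x / B + B) ^+ 2 - 4 * x = (x / B - B) ^+ 2 by field; rewrite gt_eqF.
exact: sqr_ge0.
Qed.

Let S_ge0 t w : 0 <= S t w.
Proof. by apply: mean_ge0 => // k; rewrite /err; nonneg. Qed.

Let cons_ge0 : 0 <= cons. Proof. by rewrite /cons; nonneg; rewrite ler0n. Qed.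

Let het_ge0 : 0 <= het. Proof. by rewrite /het; nonneg. Qed.

Context (Fs : R) (F_ge : forall A, Fs <= Fobj p A) (hn : (1 <= n)%N).

Let sn : R := Num.sqrt n%:R.
Let s6 : R := Num.sqrt 6.

(** The last bound along one outcome. Its right side is affine in [e0] and [S], so that only bounds
    on their expectations remain to be inserted. *)
Lemma gradient_sum_le T (B1 B2 : R) w : 0 < B1 -> 0 < B2 ->
  \sum_(t < T) fronorm (gradient (Fobj p) (Wb t w)) <=
  (Fobj p W0 - Fs) / eta + T%:R * (LF * n%:R * eta / 2) +
  2 * sn * (e0 w / rho + T%:R * (LF * sn * eta / rho) +
    \sum_(t < T) ((S t.+1 w + cons) / B1 + B1 +
      rho * tau%:R * (s6 / 2 * ((S t.+1 w + cons + het) / B2 + B2)))).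
Proof.
move=> B10 B20; have [rho0 rho1] := andP hrho.
have s60 : 0 < s6 by rewrite sqrtr_gt0.
have s62 : s6 ^+ 2 = 6 by rewrite sqr_sqrtr.
have Oe k t := sqr_fronorm_O k t w; have Op k t := fronorm_M_le k t w.
have iW k := init_W hrun k w; have sW k t := W_step k t w.
have iM k := init_M hrun k w; have sM k t := step_M hrun k t w.
have h1 := @descent_sum R K m n tau eta LF hK heta LF0 (Fobj p) Fs differentiable_F F_lip F_ge
  (fun k t => W k t w) (fun k t => M k t w) (fun k t => O k t w) Oe Op W0 iW sW hn T.
have h2 := @momentum_error_sum R K m n tau eta rho LF hK htau heta hrho LF0 (Fobj p) F_lip
  (fun k t => W k t w) (fun k t => M k t w) (fun k t => G k t w) (fun k t => O k t w) Oe sW iM sM T.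
have h3 := @momentum_error_init R K m n hK (Fobj p)
  (fun k t => W k t w) (fun k t => M k t w) (fun k t => G k t w) W0 iW iM.
rewrite h3 in h2.
set X := \sum_(t < T) mean _ in h1 h2.
set Z := \sum_(t < T) (_ + _) in h2.
set Z' := \sum_(t < T) (_ + _).
have ZZ' : Z <= Z'.
  apply: ler_sum => t _; have SC0 := addr_ge0 (S_ge0 t.+1 w) cons_ge0.
  apply: lerD.
    by apply: amgm => //; exact: aggregate_error.
  rewrite ler_wpM2l ?mulr_ge0 ?(ltW rho0)//.
  (* Dividing by [s6 / 2] turns the factor 6 of [disagreement] into the 4 of [amgm]. *)
  rewrite -ler_pdivrMl ?divr_gt0//; apply: amgm => //; first exact: addr_ge0.
  have -> :
    ((s6 / 2)^-1 * mean (fun k => fronorm (G k t.+1 w - average (fun j => G j t.+1 w)))) ^+ 2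
    = 4 / 6 * mean (fun k => fronorm (G k t.+1 w - average (fun j => G j t.+1 w))) ^+ 2.
    by rewrite -s62; field; rewrite gt_eqF.
  by have := disagreement t w; lra.
have Y : \sum_(t < T) fronorm (gradient (Fobj p) (Wb t w)) <=
   (Fobj p W0 - Fs) / eta + 2 * sn * X + T%:R * (LF * n%:R * eta / 2).
  rewrite -(ler_pM2l heta); apply: le_trans h1 _.
  rewrite le_eqVlt; apply/orP; left; apply/eqP; rewrite /sn; field.
  by rewrite gt_eqF.
apply: le_trans Y _; rewrite addrAC lerD2l ler_wpM2l ?mulr_ge0 ?sqrtr_ge0//.
apply: le_trans h2 _; apply: lerD => //.
by rewrite le_eqVlt; apply/orP; left; apply/eqP; rewrite /e0 /sn; field; rewrite gt_eqF.
Qed.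

Let average_expect r s N (X : 'I_N -> Omega -> 'M[R]_(r, s)) c : (0 < N)%N ->
  mxmeasurable (fun w => average (fun i => X i w)) ->
  (forall i, expect_le P (fun w => fronorm (X i w) ^+ 2) c) ->
  expect_le P (fun w => fronorm (average (fun i => X i w)) ^+ 2) c.
Proof.
move=> N0 mX Xc; have := expect_le_mean Xc; rewrite mean_cst//.
apply: expect_le_mono; first exact: measurable_sqr_fronorm.
by move=> w; rewrite sqr_ge0/=; exact: sqr_fronorm_average.
Qed.

Let H0_expect k : expect_le P (fun w => fronorm (H k 0%N w) ^+ 2) (Cg ^+ 2).
Proof.
have mH : mxmeasurable (H k 0%N) by case: (adapted_run 0 k) => _ _ _ /measurable_hist.
have E : H k 0%N = fun w => average (fun i => jac (fun A => gs A (xi k (inl i) w)) W0).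
  by apply/funext => w; exact: init_H hrun k w.
rewrite E in mH *; apply: average_expect => // i.
have hO : history xi zeta set0 `<=` measurable by exact: history_measurable.
have fX : fresh P (history xi zeta set0) (Dg p k) (xi k (inl i)) by exact: fresh_xi.
have mW : adapted (history xi zeta set0) (fun=> W0) by exact: mxmeasurable_cst.
apply: (fresh_oracle (oracle_dg k) hO fX mW (f := fun B => fronorm B ^+ 2)) => //.
- exact: sqr_ge0.
- by move=> dY Y Z; exact: measurable_sqr_fronorm.
- by move=> B; exact: expect_sqr (@Mdg k B) (bound_dg k B).
Qed.

Let v0_expect k : expect_le P (fun w => fronorm (v k 0%N w) ^+ 2) (Cf ^+ 2).
Proof.
have mv : mxmeasurable (v k 0%N) by case: (adapted_run 0 k) => _ _ /measurable_hist.
have E : v k 0%N =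
    fun w => average (fun i => gradient (fun y => fs y (zeta k (inl i) w)) (u k 0%N w)).
  by apply/funext => w; exact: init_v hrun k w.
rewrite E in mv *; apply: average_expect => // i.
have hO : history xi zeta initial_xi `<=` measurable by exact: history_measurable.
have fX : fresh P (history xi zeta initial_xi) (Df p k) (zeta k (inl i)) by exact: fresh_zeta.
apply: (fresh_oracle (oracle_df k) hO fX (adapted_u0 k) (f := fun B => fronorm B ^+ 2)) => //.
- exact: sqr_ge0.
- by move=> dY Y Z; exact: measurable_sqr_fronorm.
- by move=> B; exact: expect_sqr (@Mdf k B) (bound_df k B).
Qed.

(** At time 0, [H] and [v] share the xi through [u], so the mean of the product does not factor.
    AM-GM with weights [Cf / (2 Cg)] and [Cg / (2 Cf)] reduces it to second moments, each
    contributing [Cg Cf / 2]. *)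
Let e0_expect : expect_le P e0 (2 * (Cg * Cf)).
Proof.
pose f w := Cg * Cf + mean (fun k => (Cf / (2 * Cg)) * fronorm (H k 0%N w) ^+ 2 +
  (Cg / (2 * Cf)) * fronorm (v k 0%N w) ^+ 2).
have c1 : 0 <= Cf / (2 * Cg) by rewrite divr_ge0 ?mulr_ge0 ?(ltW hCf) ?(ltW hCg).
have c2 : 0 <= Cg / (2 * Cf) by rewrite divr_ge0 ?mulr_ge0 ?(ltW hCf) ?(ltW hCg).
apply: (expect_le_mono (f := f)) => [|w|].
- apply: measurable_fronorm; apply: mxmeasurableB; first exact: mxmeasurable_cst.
  apply: mxmeasurable_average => k; apply: mxmeasurable_mulmx.
    by case: (adapted_run 0 k) => _ _ _ /measurable_hist.
  by apply: mxmeasurable_kronI; case: (adapted_run 0 k) => _ _ /measurable_hist.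
- rewrite fronorm_ge0/=; apply: le_trans (fronormB _ _) _; apply: lerD => //.
  apply: le_trans (fronorm_average _ _) _ => //; apply: mean_le => // k.
  apply: le_trans (fronorm_mulmx_kronI _ _) _.
  set x := fronorm (H _ _ _); set y := fronorm (v _ _ _); rewrite -subr_ge0.
  have -> : Cf / (2 * Cg) * x ^+ 2 + Cg / (2 * Cf) * y ^+ 2 - x * y =
    (Cf * x - Cg * y) ^+ 2 / (2 * Cf * Cg) by field; rewrite !gt_eqF.
  by rewrite divr_ge0 ?sqr_ge0// !mulr_ge0 ?(ltW hCf) ?(ltW hCg).
- have -> : 2 * (Cg * Cf) = Cg * Cf + mean (fun k : 'I_K =>
      (Cf / (2 * Cg)) * Cg ^+ 2 + (Cg / (2 * Cf)) * Cf ^+ 2).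
    by rewrite mean_cst//; field; rewrite !gt_eqF.
  apply: expect_leD; first by apply: expect_le_cst; rewrite mulr_ge0 ?(ltW hCf) ?(ltW hCg).
  by apply: expect_le_mean => k; apply: expect_leD; apply: expect_leZ.
Qed.

(** * Summation over the rounds *)

Let S_bound t := Cf ^+ 2 * dg_bound t + 2 * Cg ^+ 2 * df_bound t +
  2 * Cg ^+ 2 * Lf ^+ 2 * g_bound t.

Let S_expect t : expect_le P (S t) (S_bound t).
Proof.
have -> : S t = fun w =>
  Cf ^+ 2 * mean (fun k => fronorm (H k t w - jac (gbar p k) (W k t w)) ^+ 2) +
  2 * Cg ^+ 2 * mean (fun k => fronorm (v k t w - gradient (fbar p k) (u k t w)) ^+ 2) +
  2 * Cg ^+ 2 * Lf ^+ 2 * mean (fun k => fronorm (u k t w - gbar p k (W k t w)) ^+ 2).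
  by apply/funext => w; rewrite /S /err !meanD !meanZ.
apply: expect_leD; last by apply: expect_leZ (g_expect t); nonneg.
apply: expect_leD; first by apply: expect_leZ (dg_expect t); nonneg.
by apply: expect_leZ (df_expect t); nonneg.
Qed.

Let noise_bound (TR : R) : R :=
    Cf ^+ 2 * sigma_dg ^+ 2 * (1 / (gamma * TR * b%:R) + 2 * gamma)
    + 2 * Cg ^+ 2 * sigma_f ^+ 2 * (1 / (beta * TR * b%:R) + 2 * beta)
    + 2 * Cg ^+ 2 * Lf ^+ 2 * sigma_g ^+ 2 *
        (1 / (alpha * TR * b%:R) + 2 * alpha
         + 8 * alpha / (beta * TR * b%:R)
         + 8 * alpha ^+ 2 / beta * (1 + 2 * alpha))
    + 4 * n%:R * eta ^+ 2 * tau%:R *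
        (2 * Cg ^+ 4 * Lf ^+ 2 / alpha
         + 4 * Cg ^+ 4 * Lf ^+ 2 / beta
         + 16 * Cg ^+ 4 * Lf ^+ 2 * alpha / beta
         + Cf ^+ 2 * Lg ^+ 2 / gamma)
    + n%:R * eta ^+ 2 * tau%:R ^+ 2 *
        (Cf ^+ 2 * Lg ^+ 2 + Cg ^+ 4 * Lf ^+ 2 + LF ^+ 2 / 2).

Lemma S_bound_sum T : (0 < T)%N ->
  \sum_(t < T) S_bound t.+1 + T%:R * cons <= T%:R * noise_bound T%:R.
Proof.
move=> T0; have TR0 : 0 < T%:R :> R by rewrite ltr0n.
have b0 : 0 < b%:R :> R by rewrite ltr0n.
have [al0 _] := andP halpha; have [be0 _] := andP hbeta; have [ga0 _] := andP hgamma.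
pose dl : R := n%:R * eta ^+ 2 * tau%:R.
have dl_sum : \sum_(t < T) drift t <= dl * T%:R by exact: drift_bound_sum.
(* [ga_], [dga] and [dfa] will bound the averages over the rounds of the three error sequences;
   [dfa] contains [ga_] through the drift of [u]. *)
pose ga_ := sigma_g ^+ 2 / (alpha * T%:R * b%:R) + 2 * alpha * sigma_g ^+ 2 +
  2 * Cg ^+ 2 * dl / alpha.
pose dga := sigma_dg ^+ 2 / (gamma * T%:R * b%:R) + 2 * gamma * sigma_dg ^+ 2 +
  2 * Lg ^+ 2 * dl / gamma.
pose dfa := sigma_f ^+ 2 / (beta * T%:R * b%:R) + 2 * beta * sigma_f ^+ 2 +
  2 * Lf ^+ 2 * (2 * Cg ^+ 2 * dl + 2 * alpha ^+ 2 * sigma_g ^+ 2 + 2 * alpha ^+ 2 * ga_) / beta.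
have dr0 c t : 0 <= 2 * c ^+ 2 * drift t by nonneg.
have gE : (sigma_g ^+ 2 / b%:R + (T%:R * (2 * alpha ^+ 2 * sigma_g ^+ 2) +
    \sum_(t < T) (2 * Cg ^+ 2 * drift t))) / alpha <= T%:R * ga_.
  have -> : T%:R * ga_ = (sigma_g ^+ 2 / b%:R + (T%:R * (2 * alpha ^+ 2 * sigma_g ^+ 2) +
    2 * Cg ^+ 2 * (dl * T%:R))) / alpha by rewrite /ga_; field; rewrite !gt_eqF.
  by rewrite ler_wpM2r ?invr_ge0 ?(ltW al0)// !lerD2l -mulr_sumr ler_wpM2l//; nonneg.
have g1 : \sum_(t < T) g_bound t.+1 <= T%:R * ga_.
  by apply: le_trans gE; exact: storm_bound_sumS.
have g0 : \sum_(t < T) g_bound t <= T%:R * ga_.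
  by apply: le_trans gE; exact: storm_bound_sum.
have dg1 : \sum_(t < T) dg_bound t.+1 <= T%:R * dga.
  apply: le_trans (storm_bound_sumS _ _ _ hgamma (dr0 Lg)) _.
  have -> : T%:R * dga = (sigma_dg ^+ 2 / b%:R + (T%:R * (2 * gamma ^+ 2 * sigma_dg ^+ 2) +
    2 * Lg ^+ 2 * (dl * T%:R))) / gamma by rewrite /dga; field; rewrite !gt_eqF.
  by rewrite ler_wpM2r ?invr_ge0 ?(ltW ga0)// !lerD2l -mulr_sumr ler_wpM2l//; nonneg.
have gb0 t : 0 <= g_bound t by exact: storm_bound_ge0.
have df1 : \sum_(t < T) df_bound t.+1 <= T%:R * dfa.
  apply: le_trans (storm_bound_sumS _ _ _ hbeta _) _; first by move=> t; nonneg.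
  have -> : T%:R * dfa = (sigma_f ^+ 2 / b%:R + (T%:R * (2 * beta ^+ 2 * sigma_f ^+ 2) +
    2 * Lf ^+ 2 * (2 * Cg ^+ 2 * (dl * T%:R) + T%:R * (2 * alpha ^+ 2 * sigma_g ^+ 2) +
      2 * alpha ^+ 2 * (T%:R * ga_)))) / beta by rewrite /dfa; field; rewrite !gt_eqF.
  rewrite ler_wpM2r ?invr_ge0 ?(ltW be0)// !lerD2l -mulr_sumr ler_wpM2l//; first by nonneg.
  have -> : \sum_(t < T) (2 * Cg ^+ 2 * drift t + 2 * alpha ^+ 2 * sigma_g ^+ 2 +
      2 * alpha ^+ 2 * g_bound t) = 2 * Cg ^+ 2 * (\sum_(t < T) drift t) +
      T%:R * (2 * alpha ^+ 2 * sigma_g ^+ 2) + 2 * alpha ^+ 2 * (\sum_(t < T) g_bound t).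
    by rewrite !big_split /= !mulr_sumr sumr_const card_ord -[_ *+ T]mulr_natl.
  apply: lerD; last by rewrite ler_wpM2l//; nonneg.
  by rewrite lerD2r ler_wpM2l//; nonneg.
rewrite /S_bound !big_split /= -!mulr_sumr.
have h1 : Cf ^+ 2 * \sum_(t < T) dg_bound t.+1 <= Cf ^+ 2 * (T%:R * dga).
  by rewrite ler_wpM2l ?sqr_ge0.
have h2 : 2 * Cg ^+ 2 * \sum_(t < T) df_bound t.+1 <= 2 * Cg ^+ 2 * (T%:R * dfa).
  by rewrite ler_wpM2l//; nonneg.
have h3 : 2 * Cg ^+ 2 * Lf ^+ 2 * \sum_(t < T) g_bound t.+1 <= 2 * Cg ^+ 2 * Lf ^+ 2 * (T%:R * ga_).
  by rewrite ler_wpM2l//; nonneg.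
(* The exact excess of the stated quantity over what the recursions give; all its terms are
   nonnegative. *)
pose rest : R := 2 * Cf ^+ 2 * Lg ^+ 2 * dl / gamma + 4 * Cg ^+ 4 * Lf ^+ 2 * dl / alpha +
  8 * Cg ^+ 4 * Lf ^+ 2 * dl / beta + 48 * Cg ^+ 4 * Lf ^+ 2 * dl * alpha / beta +
  2 * Cg ^+ 2 * Lf ^+ 2 * sigma_g ^+ 2 * (4 * alpha / (beta * T%:R * b%:R) +
    4 * alpha ^+ 2 / beta + 8 * alpha ^+ 3 / beta) +
  n%:R * eta ^+ 2 * tau%:R ^+ 2 * (Cf ^+ 2 * Lg ^+ 2 + Cg ^+ 4 * Lf ^+ 2).
have rest0 : 0 <= rest.
  have ab0 := ltW al0; have bb0 := ltW be0; have gg0 := ltW ga0; have e2 := ltW heta.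
  have cg0 := ltW hCg; have cf0 := ltW hCf; have t2 := ltW TR0.
  rewrite /rest /dl; nonneg.
have E : noise_bound T%:R =
    Cf ^+ 2 * dga + 2 * Cg ^+ 2 * dfa + 2 * Cg ^+ 2 * Lf ^+ 2 * ga_ + cons + rest.
  rewrite /noise_bound /dfa /dga /ga_ /rest /cons /dl; field; rewrite !gt_eqF//.
have h4 : 0 <= T%:R * rest by rewrite mulr_ge0.
have -> : T%:R * noise_bound T%:R = Cf ^+ 2 * (T%:R * dga) + 2 * Cg ^+ 2 * (T%:R * dfa) +
    2 * Cg ^+ 2 * Lf ^+ 2 * (T%:R * ga_) + T%:R * cons + T%:R * rest.
  by rewrite E; clearbody dga dfa ga_ rest cons; ring.
by apply: ler_wpDr => //; rewrite lerD2r; apply: lerD => //; exact: lerD.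
Qed.

Let measurable_gradient_F t :
  measurable_fun setT (fun w => fronorm (gradient (Fobj p) (Wb t w))).
Proof.
apply: measurable_fronorm => i j.
apply: (measurable_caratheodory
  (Phi := fun A (_ : Omega) => gradient (Fobj p) A i j) (X := id)) => //.
  move=> _; exact: continuous_fronorm_lipschitz F_lip.
apply: mxmeasurable_average => k; by case: (adapted_run t k) => /measurable_hist.
Qed.

Hypothesis hsigma_dg : 0 < sigma_dg.

(** Its square root will be an AM-GM weight, hence a divisor. Positivity comes from the first term,
    through [sigma_dg]. *)
Let noise_gt0 T : (0 < T)%N -> 0 < noise_bound T%:R.
Proof.
move=> T0; have TR0 : 0 < T%:R :> R by rewrite ltr0n.
have b0 : 0 < b%:R :> R by rewrite ltr0n.
have [al0 _] := andP halpha; have [be0 _] := andP hbeta; have [ga0 _] := andP hgamma.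
have ab0 := ltW al0; have bb0 := ltW be0; have gg0 := ltW ga0; have e2 := ltW heta.
have cg0 := ltW hCg; have cf0 := ltW hCf; have t2 := ltW TR0.
rewrite /noise_bound -!addrA; apply: ltr_wpDr; first by nonneg.
rewrite mulr_gt0 ?mulr_gt0 ?exprn_gt0//; apply: addr_gt0; last by rewrite mulr_gt0.
by rewrite divr_gt0// !mulr_gt0.
Qed.

Let expect_leZr (c : R) f r : 0 <= c -> expect_le P f r ->
  expect_le P (fun w => f w * c) (r * c).
Proof.
move=> c0 fr; rewrite mulrC; under eq_fun do rewrite mulrC.
exact: expect_leZ.
Qed.

Lemma run_rate T : (0 < T)%N ->
  ((T%:R^-1)%:E *
     (\sum_(0 <= t < T) 'E_P[fun w => fronorm (gradient (Fobj p) (Wb t w))])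
   <= ((Fobj p W0 - Fs) / (eta * T%:R) + LF * n%:R * eta / 2
       + 2 * sn *
           (4 * Cg * Cf / (rho * T%:R)
            + LF * sn * eta / rho
            + (2 + s6 * rho * tau%:R) * Num.sqrt (noise_bound T%:R)
            + s6 * rho * tau%:R * Num.sqrt het))%:E)%E.
Proof.
move=> T0; have TR0 : 0 < T%:R :> R by rewrite ltr0n.
have [rho0 rho1] := andP hrho.
set A := noise_bound T%:R; have A0 : 0 < A by exact: noise_gt0.
have B10 : 0 < Num.sqrt A by rewrite sqrtr_gt0.
have AH0 : 0 < A + het by apply: ltr_wpDr.
have B20 : 0 < Num.sqrt (A + het) by rewrite sqrtr_gt0.
have B12 : Num.sqrt A ^+ 2 = A by rewrite sqr_sqrtr// ltW.
have B22 : Num.sqrt (A + het) ^+ 2 = A + het by rewrite sqr_sqrtr// ltW.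
have s60 : 0 <= s6 by exact: sqrtr_ge0.
have sn0 : 0 <= sn by exact: sqrtr_ge0.
have rho0' := ltW rho0; have eta0' := ltW heta.
(* Subadditivity of the square root separates the noise from the heterogeneity. *)
have B2le : Num.sqrt (A + het) <= Num.sqrt A + Num.sqrt het.
  rewrite -(@ler_pXn2r _ 2) ?nnegrE ?addr_ge0 ?sqrtr_ge0// B22 sqrrD B12 sqr_sqrtr//.
  by have := mulr_ge0 (sqrtr_ge0 A) (sqrtr_ge0 het); rewrite mulr2n; lra.
set B1 := Num.sqrt A in B10 B12 B2le *; set B2 := Num.sqrt (A + het) in B20 B22 B2le *.
have B1' := ltW B10; have B2' := ltW B20.
have Yf := gradient_sum_le T _ B10 B20.
have SE t : expect_le P (fun w => (S t.+1 w + cons) / B1 + B1 +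
      rho * tau%:R * (s6 / 2 * ((S t.+1 w + cons + het) / B2 + B2)))
    ((S_bound t.+1 + cons) / B1 + B1 +
      rho * tau%:R * (s6 / 2 * ((S_bound t.+1 + cons + het) / B2 + B2))).
  have c0 c : 0 <= c -> expect_le P (fun=> c) c by exact: expect_le_cst.
  have SC : expect_le P (fun w => S t.+1 w + cons) (S_bound t.+1 + cons).
    by apply: expect_leD; [exact: S_expect|exact: c0].
  apply: expect_leD.
    by apply: expect_leD; [apply: expect_leZr => //; rewrite invr_ge0|exact: c0].
  apply: expect_leZ; first by rewrite mulr_ge0.
  apply: expect_leZ; first by rewrite divr_ge0.
  apply: expect_leD; last exact: c0.
  by apply: expect_leZr; [rewrite invr_ge0|apply: expect_leD; [|exact: c0]].
set r := (Fobj p W0 - Fs) / eta + T%:R * (LF * n%:R * eta / 2) +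
  2 * sn * (2 * (Cg * Cf) / rho + T%:R * (LF * sn * eta / rho) +
    \sum_(t < T) ((S_bound t.+1 + cons) / B1 + B1 +
      rho * tau%:R * (s6 / 2 * ((S_bound t.+1 + cons + het) / B2 + B2)))).
have FE : expect_le P (fun w => (Fobj p W0 - Fs) / eta + T%:R * (LF * n%:R * eta / 2) +
  2 * sn * (e0 w / rho + T%:R * (LF * sn * eta / rho) +
    \sum_(t < T) ((S t.+1 w + cons) / B1 + B1 +
      rho * tau%:R * (s6 / 2 * ((S t.+1 w + cons + het) / B2 + B2))))) r.
  apply: expect_leD.
    apply: expect_le_cst; apply: addr_ge0; first by rewrite divr_ge0// subr_ge0.
    by nonneg; rewrite ?invr_ge0.
  apply: expect_leZ; first by rewrite mulr_ge0.
  apply: expect_leD; last exact: expect_le_sum.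
  apply: expect_leD; first by apply: expect_leZr => //; rewrite invr_ge0.
  by apply: expect_le_cst; nonneg.
have {}FE : expect_le P (fun w => \sum_(t < T) fronorm (gradient (Fobj p) (Wb t w))) r.
  apply: expect_le_mono FE => [|w].
    by apply: measurable_sum => t; exact: measurable_gradient_F.
  by rewrite (Yf w) andbT; apply: sumr_ge0 => t _; exact: fronorm_ge0.
have [_ _ FI] := FE.
have -> : (\sum_(0 <= t < T) 'E_P[fun w => fronorm (gradient (Fobj p) (Wb t w))] =
    \int[P]_w (\sum_(t < T) fronorm (gradient (Fobj p) (Wb t w)))%:E)%E.
  rewrite big_mkord; under [RHS]eq_integral do rewrite -sumEFin.
  rewrite ge0_integral_sum//; first by apply: eq_bigr => t _; rewrite unlock.
  - by move=> t; apply/measurable_EFinP; exact: measurable_gradient_F.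
  - by move=> t w _; rewrite lee_fin fronorm_ge0.
apply: (@le_trans _ _ ((T%:R^-1)%:E * _)%E).
  by apply: lee_wpmul2l FI; rewrite lee_fin invr_ge0.
rewrite -EFinM lee_fin -(ler_pM2l TR0) mulrA divff ?gt_eqF// mul1r /r.
(* By [Q], each sum divided by its weight is at most [T] times the weight. Every weight thus counts
   twice, which gives the factors 2 and [s6]. *)
have Q := S_bound_sum T0; rewrite -/A in Q.
set Z := \sum_(t < T) S_bound t.+1 in Q.
have sumE (x : nat -> R) (c h : R) : \sum_(t < T) ((x t.+1 + c) / B1 + B1 +
      rho * tau%:R * (s6 / 2 * ((x t.+1 + c + h) / B2 + B2))) =
  ((\sum_(t < T) x t.+1 + T%:R * c) / B1 + T%:R * B1) +
  rho * tau%:R * (s6 / 2 * ((\sum_(t < T) x t.+1 + T%:R * c + T%:R * h) / B2 + T%:R * B2)).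
  have sc (e : R) : \sum_(t < T) e = T%:R * e.
    by rewrite sumr_const card_ord -[_ *+ T]mulr_natl.
  by rewrite !big_split /= sc -!mulr_sumr big_split /= sc -!mulr_suml !big_split /= !sc.
rewrite (sumE S_bound cons het) -/Z.
have q1 : (Z + T%:R * cons) / B1 <= T%:R * B1.
  by rewrite ler_pdivrMr// -mulrA -expr2 B12.
have q2 : (Z + T%:R * cons + T%:R * het) / B2 <= T%:R * B2.
  have e : T%:R * B2 * B2 = T%:R * A + T%:R * het by rewrite -mulrA -expr2 B22 [LHS]mulrDr.
  by rewrite ler_pdivrMr// e; apply: lerD.
have q3 : rho * tau%:R * (s6 / 2 * ((Z + T%:R * cons + T%:R * het) / B2 + T%:R * B2)) <=
    rho * tau%:R * (s6 * (T%:R * (B1 + Num.sqrt het))).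
  rewrite ler_wpM2l ?mulr_ge0// -mulrA ler_wpM2l//.
  have : T%:R * B2 <= T%:R * (B1 + Num.sqrt het) by rewrite ler_pM2l.
  by lra.
have -> : T%:R * ((Fobj p W0 - Fs) / (eta * T%:R) + LF * n%:R * eta / 2
       + 2 * sn * (4 * Cg * Cf / (rho * T%:R) + LF * sn * eta / rho
            + (2 + s6 * rho * tau%:R) * B1 + s6 * rho * tau%:R * Num.sqrt het)) =
  (Fobj p W0 - Fs) / eta + T%:R * (LF * n%:R * eta / 2) +
  2 * sn * (4 * (Cg * Cf) / rho + T%:R * (LF * sn * eta / rho) +
    (2 * (T%:R * B1) + rho * tau%:R * (s6 * (T%:R * (B1 + Num.sqrt het))))).
  by field; rewrite !gt_eqF.
rewrite lerD2l ler_wpM2l ?mulr_ge0//; apply: lerD; last by lra.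
(* The initial error is at most [2 Cg Cf], which the stated 4 covers. *)
rewrite lerD2r ler_wpM2r ?invr_ge0// ler_wpM2r ?mulr_ge0 ?(ltW hCg) ?(ltW hCf)//.
by rewrite ler_nat.
Qed.

End Run.

Theorem theorem2 (R : realType) (K m n d : nat)
  (hK : (1 <= K)%N) (hm : (1 <= m)%N) (hn : (1 <= n)%N) (hd : (1 <= d)%N)
  (p : problem R K m n d) (hp : well_posed p)
  (eta alpha beta gamma rho : R) (tau b : nat) (Cf Cg : R)
  (W0 : 'M[R]_(m, n))
  (heta : 0 < eta) (halpha : 0 < alpha < 1) (hbeta : 0 < beta < 1)
  (hgamma : 0 < gamma < 1) (hrho : 0 < rho < 1)
  (htau : (1 <= tau)%N) (hb : (1 <= b)%N) (hCf : 0 < Cf) (hCg : 0 < Cg)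
  (* (1) *)
  (hF : has_lbound (range (Fobj p)))
  (* (2) *)
  (sigma_g sigma_dg sigma_f : R)
  (hsigma_g : 0 < sigma_g) (hsigma_dg : 0 < sigma_dg) (hsigma_f : 0 < sigma_f)
  (mean_g : forall k W, has_mean (Dg p k) (gs W) (gbar p k W))
  (mean_dg : forall k W,
     has_mean (Dg p k) (fun x => jac (fun A => gs A x) W) (jac (gbar p k) W))
  (mean_df : forall k y,
     has_mean (Df p k) (fun z => gradient (fun y' => fs y' z) y)
       (gradient (fbar p k) y))
  (var_g : forall k W,
     ('E_(Dg p k)[fun x => (fronorm (gs W x - gbar p k W) ^+ 2)%R]
       <= (sigma_g ^+ 2)%:E)%E)
  (var_dg : forall k W,
     ('E_(Dg p k)[fun x =>
         (fronorm (jac (fun A => gs A x) W - jac (gbar p k) W) ^+ 2)%R]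
       <= (sigma_dg ^+ 2)%:E)%E)
  (var_df : forall k y,
     ('E_(Df p k)[fun z =>
         (fronorm (gradient (fun y' => fs y' z) y - gradient (fbar p k) y)
           ^+ 2)%R]
       <= (sigma_f ^+ 2)%:E)%E)
  (dO : measure_display) (Omega : measurableType dO) (P : probability Omega R)
  (xi : forall k : 'I_K, draw b -> {mfun Omega >-> Xi p k})
  (zeta : forall k : 'I_K, draw b -> {mfun Omega >-> Zeta p k})
  (hsample : is_sampling P xi zeta)
  (* (3) *)
  (bound_dg : forall k W,
     ('E_(Dg p k)[fun x => (fronorm (jac (fun A => gs A x) W) ^+ 2)%R]
       <= (Cg ^+ 2)%:E)%E)
  (bound_df : forall k y,
     ('E_(Df p k)[fun z => (fronorm (gradient (fun y' => fs y' z) y) ^+ 2)%R]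
       <= (Cf ^+ 2)%:E)%E)
  (* (4) *)
  (Lg Lf : R) (hLg : 0 <= Lg) (hLf : 0 <= Lf)
  (lip_g : forall k W1 W2,
     ('E_(Dg p k)[fun x => (fronorm (gs W1 x - gs W2 x) ^+ 2)%R]
       <= (Cg ^+ 2 * fronorm (W1 - W2) ^+ 2)%:E)%E)
  (lip_dg : forall k W1 W2,
     ('E_(Dg p k)[fun x =>
         (fronorm (jac (fun A => gs A x) W1 - jac (fun A => gs A x) W2)
           ^+ 2)%R]
       <= (Lg ^+ 2 * fronorm (W1 - W2) ^+ 2)%:E)%E)
  (lip_df : forall k y1 y2,
     ('E_(Df p k)[fun z =>
         (fronorm (gradient (fun y => fs y z) y1
                   - gradient (fun y => fs y z) y2) ^+ 2)%R]
       <= (Lf ^+ 2 * fronorm (y1 - y2) ^+ 2)%:E)%E)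
  (* (5) *)
  (Delta_g Delta_dg Delta_f : R)
  (hDelta_g : 0 <= Delta_g) (hDelta_dg : 0 <= Delta_dg)
  (hDelta_f : 0 <= Delta_f)
  (het_df : forall k j y,
     fronorm (gradient (fbar p k) y - gradient (fbar p j) y) <= Delta_f)
  (het_dg : forall k j W,
     fronorm (jac (gbar p k) W - jac (gbar p j) W) <= Delta_dg)
  (het_g : forall k j W, fronorm (gbar p k W - gbar p j W) <= Delta_g)
  (W : 'I_K -> nat -> Omega -> 'M[R]_(m, n))
  (u v : 'I_K -> nat -> Omega -> 'cV[R]_d)
  (H : 'I_K -> nat -> Omega -> 'M[R]_(m, d * n))
  (M : 'I_K -> nat -> Omega -> 'M[R]_(m, n))
  (hrun : FedCoMuonVR eta alpha beta gamma rho tau Cf Cg W0 xi zeta W u v H M)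
  (T : nat) (hT : (1 <= T)%N) :
  let Fstar := inf (range (Fobj p)) in
  let Wbar t w := average (fun k => W k t w) in
  let nR : R := n%:R in
  let tauR : R := tau%:R in
  let bR : R := b%:R in
  let TR : R := T%:R in
  let LF := Cf * Lg + Cg ^+ 2 * Lf in
  let A :=
    Cf ^+ 2 * sigma_dg ^+ 2 * (1 / (gamma * TR * bR) + 2 * gamma)
    + 2 * Cg ^+ 2 * sigma_f ^+ 2 * (1 / (beta * TR * bR) + 2 * beta)
    + 2 * Cg ^+ 2 * Lf ^+ 2 * sigma_g ^+ 2 *
        (1 / (alpha * TR * bR) + 2 * alpha
         + 8 * alpha / (beta * TR * bR)
         + 8 * alpha ^+ 2 / beta * (1 + 2 * alpha))
    + 4 * nR * eta ^+ 2 * tauR *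
        (2 * Cg ^+ 4 * Lf ^+ 2 / alpha
         + 4 * Cg ^+ 4 * Lf ^+ 2 / beta
         + 16 * Cg ^+ 4 * Lf ^+ 2 * alpha / beta
         + Cf ^+ 2 * Lg ^+ 2 / gamma)
    + nR * eta ^+ 2 * tauR ^+ 2 *
        (Cf ^+ 2 * Lg ^+ 2 + Cg ^+ 4 * Lf ^+ 2 + LF ^+ 2 / 2) in
  ((TR^-1)%:E *
     (\sum_(0 <= t < T)
        'E_P[fun w => fronorm (gradient (Fobj p) (Wbar t w))])
   <= ((Fobj p W0 - Fstar) / (eta * TR) + LF * nR * eta / 2
       + 2 * Num.sqrt nR *
           (4 * Cg * Cf / (rho * TR)
            + LF * Num.sqrt nR * eta / rho
            + (2 + Num.sqrt 6 * rho * tauR) * Num.sqrt A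
            + Num.sqrt 6 * rho * tauR *
                Num.sqrt (Cf ^+ 2 * Delta_dg ^+ 2
                          + 2 * Cg ^+ 2 * Delta_f ^+ 2
                          + 2 * Cg ^+ 2 * Lf ^+ 2 * Delta_g ^+ 2)))%:E)%E.
Proof.
(* Here [hF] enters: the real-valued [inf] is a lower bound only of a set that has one. *)
have F_ge A : inf (range (Fobj p)) <= Fobj p A by apply: ge_inf => //; exists A.
exact: (run_rate hK hp heta halpha hbeta hgamma hrho htau hb hCf hCg mean_g mean_dg mean_df
  var_g var_dg var_df hsample bound_dg bound_df hLg hLf lip_g lip_dg lip_df hrun
  het_df het_dg het_g F_ge hn hsigma_dg hT).
Qed.
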